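(* Let $n,p\to\infty$ and consider data $\mathbf{X}=\mathbf{S}+\mathbf{N}\in\mathbb{R}^{n\times p}$ with $\mathbf{S}=\sum_{i=1}^k\theta_i\mathbf{u}_i\mathbf{z}_i^\top$, where $\theta_i\ge0$, $\mathbf{u}_i\in\mathbb{R}^n$, $\mathbf{z}_i\in\mathbb{R}^p$ may be deterministic or random and are not necessarily orthogonal, and where the coefficients $\theta_i$ and the number of terms $k$ may change with $n$ and $p$. Suppose that: 1. $\mathbf{N}$ has independent entries with symmetric distributions, i.e., $N_{ij}=_d-N_{ij}$ for all $i,j$; 2. there is a constant $\bar\sigma$ (independent of $n$ and $p$) such that $\|\mathbf{N}\|\to\bar\sigma$ in probability; 3. there is a constant $\varepsilon>0$ such that $\Pr[\sigma_k(\mathbf{X})>\|\mathbf{N}\|+\varepsilon]\to1$. Let $\hat k$ be the output of FlipPA on $\mathbf{X}$ using the upper-edge comparison method with threshold $\tau\in(0,\varepsilon)$. If $$\mathbb{E}\|\mathbf{S}\|_{2,\infty}\to0,\qquad \mathbb{E}\|\mathbf{S}^\top\|_{2,\infty}\to0,\qquad \min\bigl[\mathbb{E}\,\rho_2(\mathbf{S}),\ \mathbb{E}\,\rho_\infty(\mathbf{S})\bigr]\to0,$$ then FlipPA is consistent, i.e., $\Pr[\hat k=k]\to1$.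
   Context: $\|\cdot\|$ is the operator (spectral) norm, $\sigma_1(\mathbf{X})\ge\sigma_2(\mathbf{X})\ge\cdots$ are the singular values of $\mathbf{X}$, with $\sigma_j=0$ for $j>\min(n,p)$ and $\sigma_0=+\infty$. Norms. For a matrix $\mathbf{A}$, $\|\mathbf{A}\|_{2,\infty}$ is the maximum $\ell_2$ norm of its rows, and $\|\mathbf{A}\|_{\infty,(i)}$ is the $i$-th largest of the $\ell_\infty$ norms of its rows (row $\ell_\infty$ norms sorted in descending order). For $\mathbf{S}\in\mathbb{R}^{n\times p}$ let $\mathbf{S}^{\mathrm{sym}}=\begin{bmatrix}0&\mathbf{S}\\ \mathbf{S}^\top&0\end{bmatrix}\in\mathbb{R}^{(n+p)\times(n+p)}$ and define $$\rho_2(\mathbf{S})=\|\mathbf{S}^{\mathrm{sym}}\|_{2,\infty}\,(\log(n+p))^{1/4},\qquad \rho_\infty(\mathbf{S})=\max_{i=1,\dots,n+p}\|\mathbf{S}^{\mathrm{sym}}\|_{\infty,(i)}\sqrt{\log i}.$$ FlipPA with upper-edge comparison. Input: $\mathbf{X}\in\mathbb{R}^{n\times p}$, quantile $q\in[0,1]$, number of trials $T\ge1$, threshold $\tau\ge0$ ($q$, $T$, $\tau$ are fixed as $n,p\to\infty$). Let $\mathbf{R}^{(1)},\dots,\mathbf{R}^{(T)}$ be independent random matrices, each uniform on $\{-1,+1\}^{n\times p}$, and independent of $(\mathbf{S},\mathbf{N})$. Let $\tilde\sigma^{(t)}_1=\|\mathbf{R}^{(t)}\circ\mathbf{X}\|$,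 where $\circ$ is the entrywise product. The output $\hat k$ is the smallest integer $j\ge0$ such that $\sigma_{j+1}(\mathbf{X})\le\text{$q$-quantile of }(\tilde\sigma^{(1)}_1,\dots,\tilde\sigma^{(T)}_1)+\tau$. Sample quantiles. The $q$-quantile of a sample $x_1,\dots,x_T$ is computed by any one (fixed) of the nine definitions enumerated by Hyndman and Fan (1996). With order statistics $x_{(1)}\le\dots\le x_{(T)}$ and the conventions $x_{(j)}=x_{(1)}$ for $j<1$, $x_{(j)}=x_{(T)}$ for $j>T$, it equals $(1-c)x_{(j)}+c\,x_{(j+1)}$ with $j=\lfloor qT+m\rfloor$, $g=qT+m-j$, where: type 1: $m=0$, $c=\mathbf{1}(g>0)$; type 2: $m=0$, $c=1$ if $g>0$ and $c=1/2$ if $g=0$; type 3: $m=-1/2$, $c=0$ if $g=0$ and $j$ is even, $c=1$ otherwise; types 4–9: $c=g$ and $m=0,\ 1/2,\ q,\ 1-q,\ (q+1)/3,\ q/4+3/8$ respectively. *)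

(* Defs.v *)
From HB Require Import structures.
From mathcomp Require Import all_boot all_order all_algebra.
From mathcomp Require Import all_classical all_reals all_analysis.
From mathcomp Require polyrcf.

Set Implicit Arguments.
Unset Strict Implicit.
Unset Printing Implicit Defensive.
Import Order.TTheory GRing.Theory Num.Theory.
Local Open Scope ring_scope.
Local Open Scope classical_set_scope.

Section MatrixNorms.
Context {R : realType}.

(* Used for row and column vectors only; on other matrices this formula
   gives the Frobenius norm. *)
Definition l2norm m n (A : 'M[R]_(m, n)) : R :=
  Num.sqrt (\sum_i \sum_j A i j ^+ 2).

Definition linfnorm m n (A : 'M[R]_(m, n)) : R :=
  \big[Num.max/0]_i \big[Num.max/0]_j `|A i j|.

Definition opnorm m n (A : 'M[R]_(m, n)) : R :=
  sup [set l2norm (A *m v) | v in [set v : 'cV[R]_n | l2norm v <= 1]].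

Definition norm_2inf m n (A : 'M[R]_(m, n)) : R :=
  \big[Num.max/0]_i l2norm (row i A).

(* The rank i counts from 1. *)
Definition norm_inf_rank m n (A : 'M[R]_(m, n)) (i : nat) : R :=
  nth 0 (sort >=%R [seq linfnorm (row r A) | r <- enum 'I_m]) i.-1.

Definition symmx n p (S : 'M[R]_(n, p)) : 'M[R]_(n + p) :=
  block_mx 0 S S^T 0.

Definition rho_2 n p (S : 'M[R]_(n, p)) : R :=
  norm_2inf (symmx S) * ln (n + p)%:R `^ (4^-1).

Definition rho_inf n p (S : 'M[R]_(n, p)) : R :=
  \big[Num.max/0]_(1 <= i < (n + p).+1)
    (norm_inf_rank (symmx S) i * Num.sqrt (ln i%:R)).

Definition hadamard m n (A B : 'M[R]_(m, n)) : 'M[R]_(m, n) :=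
  map2_mx *%R A B.

End MatrixNorms.

Section SingularValues.
Context {R : realType}.

(* The real eigenvalues with their algebraic multiplicities, in descending
   order; for a symmetric matrix these are all the eigenvalues. *)
Definition eigenvalue_seq n (A : 'M[R]_n) : seq R :=
  let chi := char_poly A in
  sort >=%R (flatten [seq nseq (mup x chi) x | x <- polyrcf.rootsR chi]).

Definition singular_values n p (X : 'M[R]_(n, p)) : seq R :=
  [seq Num.sqrt x | x <- take (minn n p) (eigenvalue_seq (X *m X^T))].

(* The index j counts from 1, with sigma_0 = +oo; the default of [nth] gives
   sigma_j = 0 for j > min(n, p). *)
Definition sing_val n p (X : 'M[R]_(n, p)) (j : nat) : \bar R :=
  if j is j'.+1 then (nth 0 (singular_values X) j')%:E else +oo%E.

End SingularValues.

(* The nine sample quantiles of Hyndman and Fan, "Sample quantiles in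
   statistical packages" (1996), numbered as there; c is a step function for
   the types 1 to 3 and the fractional part g for the others. *)
Inductive quantile_type := HF1 | HF2 | HF3 | HF4 | HF5 | HF6 | HF7 | HF8 | HF9.

Section Quantiles.
Context {R : realType}.

Definition order_stat (s : seq R) (j : int) : R :=
  nth 0 (sort <=%R s)
    (`|(Num.max 1%:Z (Num.min j (size s)%:Z))|%N).-1.

Definition hf_m (ty : quantile_type) (q : R) : R :=
  match ty with
  | HF1 => 0
  | HF2 => 0
  | HF3 => - 2^-1
  | HF4 => 0
  | HF5 => 2^-1
  | HF6 => q
  | HF7 => 1 - q
  | HF8 => (q + 1) / 3
  | HF9 => q / 4 + 3 / 8
  end.

Definition hf_c (ty : quantile_type) (j : int) (g : R) : R :=
  match ty with
  | HF1 => if 0 < g then 1 else 0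
  | HF2 => if 0 < g then 1 else 2^-1
  | HF3 => if (g == 0) && ~~ odd `|j|%N then 0 else 1
  | _ => g
  end.

Definition quantile (ty : quantile_type) (q : R) (s : seq R) : R :=
  let a := q * (size s)%:R + hf_m ty q in
  let j := Num.floor a in
  let c := hf_c ty j (a - j%:~R) in
  (1 - c) * order_stat s j + c * order_stat s (j + 1).

End Quantiles.

Section FlipPA.
Context {R : realType}.

Definition flip_threshold n p T (ty : quantile_type) (q tau : R)
    (X : 'M[R]_(n, p)) (F : 'I_T -> 'M[R]_(n, p)) : R :=
  quantile ty q [seq opnorm (hadamard (F t) X) | t <- enum 'I_T] + tau.

(* The candidates 0, ..., min(n, p) suffice, as the last one always
   qualifies when tau >= 0; see [flippaP]. *)
Definition flippa n p T (ty : quantile_type) (q tau : R)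
    (X : 'M[R]_(n, p)) (F : 'I_T -> 'M[R]_(n, p)) : nat :=
  find (fun j => sing_val X j.+1 <= (flip_threshold ty q tau X F)%:E)%E
       (iota 0 (minn n p).+1).

Lemma opnorm_ge0 m n (A : 'M[R]_(m, n)) : 0 <= opnorm A.
Proof.
rewrite /opnorm; set E := (X in sup X).
have [sE|/sup_out->//] := pselect (has_sup E).
have [[x Ex] _] := sE.
apply: (@le_trans _ _ x); last exact (@ub_le_sup R E sE.2 x Ex).
by case: Ex => v _ <-; exact: sqrtr_ge0.
Qed.

Lemma order_stat_ge0 (s : seq R) j : {in s, forall x, 0 <= x} ->
  0 <= order_stat s j.
Proof.
move=> s0; rewrite /order_stat; set i := (X in nth _ _ X).
have [ilt|ige] := ltnP i (size (sort <=%R s)); last by rewrite nth_default.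
by apply: s0; rewrite -(mem_sort <=%R) mem_nth.
Qed.

Lemma hf_c_itv ty j (g : R) : 0 <= g < 1 -> 0 <= hf_c ty j g <= 1.
Proof.
move=> /andP[g0 g1]; have h : 2^-1 <= 1 :> R by rewrite invf_le1 ?ler1n.
by case: ty => /=; rewrite ?g0 ?(ltW g1)//; case: ifP;
  rewrite ?lexx ?ler01 ?invr_ge0 ?ler0n ?h.
Qed.

Lemma quantile_ge0 ty (q : R) (s : seq R) : {in s, forall x, 0 <= x} ->
  0 <= quantile ty q s.
Proof.
move=> s0; rewrite /quantile; set a := q * _ + _.
have /andP[c0 c1] : 0 <= hf_c ty (Num.floor a) (a - (Num.floor a)%:~R) <= 1.
  by apply: hf_c_itv; rewrite subr_ge0 floor_le ltrBlDl -intrD1 floorD1_gt.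
by apply: addr_ge0; apply: mulr_ge0; rewrite ?subr_ge0 //; exact: order_stat_ge0.
Qed.

Lemma flippaP n p T ty (q tau : R) (X : 'M[R]_(n, p)) (F : 'I_T -> 'M[R]_(n, p)) :
  0 <= tau ->
  let thr := (flip_threshold ty q tau X F)%:E in
  (sing_val X (flippa ty q tau X F).+1 <= thr)%E /\
  forall j, (sing_val X j.+1 <= thr)%E -> (flippa ty q tau X F <= j)%N.
Proof.
move=> tau0 thr; rewrite /flippa; set a := fun j => _.
have t0 : 0 <= flip_threshold ty q tau X F.
  by rewrite addr_ge0 // quantile_ge0 // => _ /mapP[t _ ->]; exact: opnorm_ge0.
have alast : a (minn n p).
  rewrite /a /sing_val lee_fin nth_default // size_map size_take.
  by case: ltnP => // /leq_trans; apply.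
have ha : has a (iota 0 (minn n p).+1).
  by apply/hasP; exists (minn n p) => //; rewrite mem_iota ltnSn.
split.
  have := nth_find 0 ha; rewrite nth_iota ?add0n //.
  by move: ha; rewrite has_find size_iota.
move=> j aj; rewrite leqNgt; apply/negP => lt.
have := before_find 0 lt; rewrite nth_iota ?add0n ?[a j]aj //.
by apply: (leq_trans lt); rewrite -[X in (_ <= X)%N](size_iota 0) find_size.
Qed.

End FlipPA.

Section Probability.
Context {d : measure_display} {Om : measurableType d} {R : realType}.
Variable P : probability Om R.

Definition measurable_mx m n (M : Om -> 'M[R]_(m, n)) : Prop :=
  forall i j, measurable_fun setT (fun w => M w i j).

Definition symmetric_law (X : Om -> R) : Prop :=
  forall B : set R, measurable B ->
    P (X @^-1` B) = P ((fun w => - X w) @^-1` B).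

Definition events_rv (X : Om -> R) : set_system Om :=
  preimage_set_system setT X measurable.

Definition entry_events m n (M : Om -> 'M[R]_(m, n)) : set_system Om :=
  \bigcup_(ij in [set: 'I_m * 'I_n]) events_rv (fun w => M w ij.1 ij.2).

Definition events_mx m n (M : Om -> 'M[R]_(m, n)) : set_system Om :=
  <<s entry_events M >>.

Definition events_mx2 m n (M N : Om -> 'M[R]_(m, n)) : set_system Om :=
  <<s entry_events M `|` entry_events N >>.

Definition mutually_independent (I : finType) (G : I -> set_system Om) : Prop :=
  forall (J : {set I}) (E : I -> set Om), (forall i, i \in J -> G i (E i)) ->
    P (\bigcap_(i in [set` J]) E i) = (\prod_(i in J) P (E i))%E.

Definition independent_entries m n (M : Om -> 'M[R]_(m, n)) : Prop :=
  mutually_independent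
    (fun ij : 'I_m * 'I_n => events_rv (fun w => M w ij.1 ij.2)).

Definition signmx m n (b : 'M[bool]_(m, n)) : 'M[R]_(m, n) :=
  \matrix_(i, j) (-1) ^+ b i j.

Definition uniform_signs m n (M : Om -> 'M[R]_(m, n)) : Prop :=
  forall b : 'M[bool]_(m, n),
    P [set w | M w = signmx b] = ((2 ^+ (m * n))^-1)%:E.

(* The index [None] stands for the pair (S, N): its two components may depend
   on each other. *)
Definition independent_flips m n T (F : 'I_T -> Om -> 'M[R]_(m, n))
    (S N : Om -> 'M[R]_(m, n)) : Prop :=
  mutually_independent
    (fun o : option 'I_T =>
       if o is Some t then events_mx (F t) else events_mx2 S N).

End Probability.

(* Main.v *)
Require Import Defs.
From mathcomp Require Import all_boot all_order all_algebra.
From mathcomp Require Import all_classical all_reals all_analysis.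
From mathcomp Require Import measurable_realfun ring lra zify.
From mathcomp Require complex polyrcf.

(* Flipping signs leaves the law of N unchanged, so ||F o N|| is close to sbar,
   and ||F o X|| differs from ||F o N|| by at most ||F o S||; once ||F o S|| is
   small, the threshold separates sigma_(k+1)(X) <= ||N|| (Weyl, as S has rank at
   most k) from sigma_k(X).  What remains is to bound the mean of ||F o A|| for
   a fixed matrix A and uniform signs F.

   Moments.  Expanding tr (F o A)^M in the Walsh basis of the signs gives a sum
   over walks whose state is the set O of edges crossed an odd number of times
   and the current vertex.  A product weight over the vertices, made of double
   factorials of the degrees in O, is a supersolution of the transfer operator
   of this walk; hence E tr (F o A)^M <= #vertices * (2 B)^M as soon as
   B^2 >= (max squared row or column norm) + M * (max squared entry).

   The bound by rho_2 follows by splitting A at entries of size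
   sigma (log (n+p))^(-1/4): the large entries are handled by the Schur test.

   For rho_inf, the vertices are exhausted by sets of sizes m_k = 2^(8^k), the
   (k+1)-st one containing the m_k rows of largest sup norm and the vertices
   joined to the k-th one by an entry with square above sigma^2 / m_k^4.
   Between equal or consecutive levels the matrix splits into block diagonal
   pieces, to which the moment bound applies with M of order log m_k; the
   entries joining levels at distance at least 2 are so small that the
   off-diagonal part of the Gram matrix is bounded in Hilbert-Schmidt norm. *)

Set Implicit Arguments.
Unset Strict Implicit.
Unset Printing Implicit Defensive.
Import Order.TTheory GRing.Theory Num.Theory.
Import numFieldNormedType.Exports.
Local Open Scope ring_scope.

(** The minimum in the hypothesis is between expectations over S, so each of [rho_2] and [rho_inf]
    gets its own bound, valid for every fixed matrix. Independence of the flips from (S, N) turns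
    the sign average into an expectation, and Markov's inequality suffices because no rate is
    claimed.

    A moment of order M costs a factor (dimension)^(1/M) and adds M * (max squared entry) to the
    squared row norm. Taking M of order log (n+p) makes the factor harmless but the added term too
    large for either target. Truncation repairs this for [rho_2]. For [rho_inf], a vertex outside
    the top m rows has entries at most rho_inf / sqrt (log m), which a moment of order log m can
    afford, provided the block has only a power of m vertices. Passing to a fixed power multiplies
    log m by a constant only, which leaves room to add all heavy neighbours at each level.

    Singular values come from the eigenvalues of X X^T. Their description as distances to matrices
    of low rank gives Weyl's inequality, and with rational factors also the measurability of the
    output. *)

Section OperatorNorm.
Context {R : realType}.

(** Lagrange's identity: twice the difference of the two sides is the sum of the squares of
    [x i * y j - x j * y i]. *)
Lemma cauchy_schwarz (I : finType) (x y : I -> R) :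
  (\sum_i x i * y i) ^+ 2 <= (\sum_i x i ^+ 2) * (\sum_i y i ^+ 2).
Proof.
rewrite -subr_ge0 -(@pmulr_rge0 _ 2) //.
rewrite [X in 0 <= X](_ : _ = \sum_i \sum_j (x i * y j - x j * y i) ^+ 2).
  by apply: sumr_ge0 => i _; apply: sumr_ge0 => j _; rewrite sqr_ge0.
transitivity (\sum_i (x i ^+ 2 * (\sum_j y j ^+ 2) + y i ^+ 2 * (\sum_j x j ^+ 2)
                     - 2 * (x i * y i) * (\sum_j x j * y j))).
  rewrite sumrB big_split /= -!mulr_suml -mulr_sumr; ring.
apply: eq_bigr => i _; rewrite !mulr_sumr -sumrN -!big_split /=.
by apply: eq_bigr => j _; ring.
Qed.

Lemma l2norm_ge0 m n (A : 'M[R]_(m, n)) : 0 <= l2norm A.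
Proof. exact: sqrtr_ge0. Qed.

Lemma l2norm_sqr m n (A : 'M[R]_(m, n)) :
  l2norm A ^+ 2 = \sum_i \sum_j A i j ^+ 2.
Proof.
rewrite sqr_sqrtr //; apply: sumr_ge0 => i _; apply: sumr_ge0 => j _.
exact: sqr_ge0.
Qed.

Lemma l2norm_sqr_cV n (v : 'cV[R]_n) : l2norm v ^+ 2 = \sum_i v i 0 ^+ 2.
Proof. by rewrite l2norm_sqr; apply: eq_bigr => i _; rewrite big_ord1. Qed.

Lemma l2norm_sqr_rV n (v : 'rV[R]_n) : l2norm v ^+ 2 = \sum_i v 0 i ^+ 2.
Proof. by rewrite l2norm_sqr big_ord1. Qed.

Lemma l2normZ m n (c : R) (A : 'M[R]_(m, n)) :
  l2norm (c *: A) = `|c| * l2norm A.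
Proof.
rewrite /l2norm -sqrtr_sqr -sqrtrM ?sqr_ge0 // mulr_sumr; congr Num.sqrt.
by apply: eq_bigr => i _; rewrite mulr_sumr; apply: eq_bigr => j _; rewrite mxE exprMn.
Qed.

Lemma l2normN m n (A : 'M[R]_(m, n)) : l2norm (- A) = l2norm A.
Proof. by rewrite -scaleN1r l2normZ normrN1 mul1r. Qed.

Lemma l2norm0 m n : l2norm (0 : 'M[R]_(m, n)) = 0.
Proof. by rewrite -(scale0r 0) l2normZ normr0 mul0r. Qed.

Lemma l2norm_eq0 m n (A : 'M[R]_(m, n)) : l2norm A = 0 -> A = 0.
Proof.
move=> A0; have := l2norm_sqr A; rewrite A0 expr0n /= => /esym/eqP.
rewrite psumr_eq0 => [/allP h|i _]; last by apply: sumr_ge0 => j _; exact: sqr_ge0.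
apply/matrixP => i j; rewrite mxE; have := h i (mem_index_enum _).
rewrite psumr_eq0 => [/allP/(_ j (mem_index_enum _))|? _]; last exact: sqr_ge0.
by rewrite sqrf_eq0 => /eqP.
Qed.

Lemma dot_le n (u v : 'cV[R]_n) : \sum_i u i 0 * v i 0 <= l2norm u * l2norm v.
Proof.
apply: le_trans (ler_norm _) _.
rewrite -ler_sqr ?nnegrE ?normr_ge0 ?mulr_ge0 ?l2norm_ge0 //.
by rewrite real_normK ?num_real // exprMn !l2norm_sqr_cV cauchy_schwarz.
Qed.

Lemma l2normD n (u v : 'cV[R]_n) : l2norm (u + v) <= l2norm u + l2norm v.
Proof.
rewrite -ler_sqr ?nnegrE ?addr_ge0 ?l2norm_ge0 // l2norm_sqr_cV.
rewrite [X in X <= _](_ : _ = l2norm u ^+ 2 + l2norm v ^+ 2 + 2 * \sum_i u i 0 * v i 0).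
  by have := dot_le u v; lra.
rewrite !l2norm_sqr_cV mulr_sumr -!big_split /=.
by apply: eq_bigr => i _; rewrite !mxE; ring.
Qed.

(** Crude, but it bounds the set whose supremum defines [opnorm], so that [sup] is a true least
    upper bound. *)
Lemma l2norm_mulmx_fro m n (A : 'M[R]_(m, n)) (v : 'cV_n) :
  l2norm (A *m v) <= l2norm A * l2norm v.
Proof.
rewrite -ler_sqr ?nnegrE ?mulr_ge0 ?l2norm_ge0 // exprMn l2norm_sqr_cV.
rewrite l2norm_sqr mulr_suml; apply: ler_sum => i _.
by rewrite mxE l2norm_sqr_cV cauchy_schwarz.
Qed.

Lemma opnorm_le m n (A : 'M[R]_(m, n)) c : 0 <= c ->
  (forall v : 'cV_n, l2norm v <= 1 -> l2norm (A *m v) <= c) -> opnorm A <= c.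
Proof.
move=> c0 h; rewrite /opnorm; apply: ge_sup.
  by exists (l2norm (A *m (0 : 'cV_n))); exists 0 => //=; rewrite l2norm0 ler01.
by move=> _ [v /= v1 <-]; exact: h.
Qed.

Lemma l2norm_le_opnorm m n (A : 'M[R]_(m, n)) (v : 'cV_n) :
  l2norm v <= 1 -> l2norm (A *m v) <= opnorm A.
Proof.
move=> v1; rewrite /opnorm; apply: ub_le_sup; last by exists v.
exists (l2norm A) => _ [u /= u1 <-].
by apply: le_trans (l2norm_mulmx_fro _ _) _; rewrite ler_piMr ?l2norm_ge0.
Qed.

Lemma l2norm_mulmx m n (A : 'M[R]_(m, n)) (v : 'cV_n) :
  l2norm (A *m v) <= opnorm A * l2norm v.
Proof.
have [/l2norm_eq0->|v0] := eqVneq (l2norm v) 0.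
  by rewrite mulmx0 !l2norm0 mulr0.
have vp : 0 < l2norm v by rewrite lt_def v0 l2norm_ge0.
have := @l2norm_le_opnorm _ _ A ((l2norm v)^-1 *: v).
rewrite -scalemxAr !l2normZ gtr0_norm ?invr_gt0 // mulVf // => /(_ (lexx _)).
by rewrite mulrC ler_pdivrMr.
Qed.

Lemma opnorm_fro m n (A : 'M[R]_(m, n)) : opnorm A <= l2norm A.
Proof.
apply: opnorm_le (l2norm_ge0 _) _ => v v1.
by apply: le_trans (l2norm_mulmx_fro _ _) _; rewrite ler_piMr ?l2norm_ge0.
Qed.

Lemma opnormD m n (A B : 'M[R]_(m, n)) : opnorm (A + B) <= opnorm A + opnorm B.
Proof.
apply: opnorm_le => [|v v1]; first by rewrite addr_ge0 ?opnorm_ge0.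
by rewrite mulmxDl (le_trans (l2normD _ _)) // lerD // l2norm_le_opnorm.
Qed.

Lemma opnormN m n (A : 'M[R]_(m, n)) : opnorm (- A) = opnorm A.
Proof.
by apply/eqP; rewrite eq_le; apply/andP; split;
  apply: opnorm_le (opnorm_ge0 _) _ => v v1;
  rewrite -1?l2normN -1?mulNmx 1?opprK l2norm_le_opnorm.
Qed.

Lemma opnorm_dist m n (A B : 'M[R]_(m, n)) :
  `|opnorm (A + B) - opnorm A| <= opnorm B.
Proof.
rewrite ler_distl opnormD andbT lerBlDr -{1}(addrK B A).
by apply: le_trans (opnormD _ _) _; rewrite opnormN.
Qed.

Lemma l2norm_sqr_mulmx m n (A : 'M[R]_(m, n)) (v : 'cV_n) :
  l2norm (A *m v) ^+ 2 = \sum_i v i 0 * (A^T *m (A *m v)) i 0.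
Proof.
rewrite l2norm_sqr_cV.
under eq_bigr => i _ do rewrite expr2 {1}mxE mulr_suml.
rewrite exchange_big /=; apply: eq_bigr => j _.
rewrite [in RHS]mxE mulr_sumr; apply: eq_bigr => i _.
by rewrite [A^T _ _]mxE; ring.
Qed.

(** With c = |A^T v| and |v| <= 1, c^2 = <v, A A^T v> <= |A| c; divide by c. *)
Lemma opnorm_tr_le m n (A : 'M[R]_(m, n)) : opnorm A^T <= opnorm A.
Proof.
apply: opnorm_le (opnorm_ge0 _) _ => v v1.
set c := l2norm _; have c0 : 0 <= c by exact: l2norm_ge0.
have : c ^+ 2 <= opnorm A * c.
  rewrite /c l2norm_sqr_mulmx trmxK; apply: le_trans (dot_le _ _) _.
  apply: le_trans (l2norm_mulmx _ _); rewrite ler_piMl ?l2norm_ge0 //.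
rewrite expr2; have [->|cn] := eqVneq c 0; first by rewrite opnorm_ge0.
by rewrite ler_pM2r // lt_def cn.
Qed.

Lemma opnorm_tr m n (A : 'M[R]_(m, n)) : opnorm A^T = opnorm A.
Proof.
by apply/eqP; rewrite eq_le opnorm_tr_le -{1}(trmxK A) opnorm_tr_le.
Qed.

Lemma opnorm_schur m n (A : 'M[R]_(m, n)) c : 0 <= c ->
  (forall i, \sum_j `|A i j| <= c) -> (forall j, \sum_i `|A i j| <= c) ->
  opnorm A <= c.
Proof.
move=> c0 hr hc; apply: opnorm_le => // v v1.
rewrite -ler_sqr ?nnegrE ?l2norm_ge0 // l2norm_sqr_cV.
apply: (@le_trans _ _ (\sum_i c * \sum_j `|A i j| * v j 0 ^+ 2)).
  apply: ler_sum => i _; rewrite mxE.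
  apply: (@le_trans _ _ ((\sum_j `|A i j|) * \sum_j `|A i j| * v j 0 ^+ 2)); last first.
    by rewrite ler_wpM2r // sumr_ge0 // => j _; rewrite mulr_ge0 ?sqr_ge0.
  (* Splitting each term as sqrt|A i j| times sg(A i j) sqrt|A i j| v j makes the first factor sum
     to a row sum and the second to a weighted square of v. *)
  have := cauchy_schwarz (fun j => Num.sqrt `|A i j|)
            (fun j => Num.sg (A i j) * Num.sqrt `|A i j| * v j 0).
  congr (_ ^+ 2 <= _ * _); apply: eq_bigr => j _.
  - transitivity (Num.sg (A i j) * Num.sqrt `|A i j| ^+ 2 * v j 0); first by ring.
    by rewrite sqr_sqrtr // mulr_sg_norm.
  - by rewrite sqr_sqrtr.
  rewrite !exprMn sqr_sqrtr //.
  have [->|A0] := eqVneq (A i j) 0; first by rewrite normr0 !(mulr0, mul0r).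
  by rewrite sqr_sg A0 mul1r.
rewrite -mulr_sumr exchange_big /= expr2 ler_wpM2l //.
under eq_bigr do rewrite -mulr_suml.
apply: (@le_trans _ _ (\sum_j c * v j 0 ^+ 2)).
  by apply: ler_sum => j _; rewrite ler_wpM2r ?sqr_ge0.
by rewrite -mulr_sumr -l2norm_sqr_cV ler_piMr // expr_le1 ?l2norm_ge0.
Qed.

(** Recursion on the left factor matches [walk], which peels off the first edge. *)
Fixpoint mxpow n (A : 'M[R]_n) (L : nat) : 'M[R]_n :=
  if L is L'.+1 then A *m mxpow A L' else 1%:M.

Lemma mxpowD n (A : 'M[R]_n) K L : mxpow A (K + L) = mxpow A K *m mxpow A L.
Proof. by elim: K => [|K IH] /=; rewrite ?mul1mx // IH mulmxA. Qed.

Lemma mxpow_sqr n (A : 'M[R]_n) L : mxpow (A *m A) L = mxpow A L.*2.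
Proof. by elim: L => //= L ->; rewrite mulmxA. Qed.

Lemma tr_mxpow n (A : 'M[R]_n) L : A^T = A -> (mxpow A L)^T = mxpow A L.
Proof.
move=> As; elim: L => [|L IH] /=; first by rewrite trmx1.
by rewrite trmx_mul IH As -{2}(mulmx1 A) -[A *m 1%:M]/(mxpow A 1) -mxpowD addn1.
Qed.

(** Repeated squaring: |A v|^2 = <v, A^2 v> <= |A^2 v|, and A^2 is again symmetric. *)
Lemma l2norm_mxpow2 n (A : 'M[R]_n) (v : 'cV_n) j : A^T = A -> l2norm v <= 1 ->
  l2norm (A *m v) ^+ (2 ^ j) <= l2norm (mxpow A (2 ^ j) *m v).
Proof.
move=> + v1; elim: j A => [|j IH] A As /=; first by rewrite mulmx1 expr1.
rewrite expnS exprM.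
apply: (@le_trans _ _ (l2norm (A *m A *m v) ^+ (2 ^ j))).
  apply: lerXn2r; rewrite ?nnegrE ?exprn_ge0 ?l2norm_ge0 //.
  rewrite l2norm_sqr_mulmx As -mulmxA (le_trans (dot_le _ _)) //.
  by rewrite ler_piMl ?l2norm_ge0.
apply: le_trans (IH _ _) _; first by rewrite trmx_mul As.
by rewrite mxpow_sqr mul2n.
Qed.

(** The trace of A^(2^(j+1)) is the squared Frobenius norm of A^(2^j), which dominates |A^(2^j) v|
    and hence |A v|^(2^j). No eigenvalues are involved; the price is that every moment has order a
    power of two. *)
Lemma opnorm_trace_mxpow n (A : 'M[R]_n) j : A^T = A ->
  opnorm A ^+ (2 ^ j.+1) <= \tr (mxpow A (2 ^ j.+1)).
Proof.
move=> As.
have trE : l2norm (mxpow A (2 ^ j)) ^+ 2 = \tr (mxpow A (2 ^ j.+1)).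
  rewrite l2norm_sqr expnS mul2n -addnn mxpowD /mxtrace; apply: eq_bigr => i _.
  rewrite mxE; apply: eq_bigr => k _.
  by rewrite -{3}(tr_mxpow _ As) mxE expr2.
rewrite -trE [in X in X <= _]expnSr exprM ler_sqr ?nnegrE ?exprn_ge0 ?opnorm_ge0 ?l2norm_ge0 //.
set c := l2norm _; have c0 : 0 <= c by exact: l2norm_ge0.
(* [opnorm_le] asks for a bound on |A v| itself, so the root of order 2^j is taken before the
   supremum. *)
have ge1 (v : 'cV_n) : l2norm v <= 1 -> l2norm (A *m v) <= c `^ ((2 ^ j)%:R^-1).
  move=> v1; have h : l2norm (A *m v) ^+ (2 ^ j) <= c.
    apply: le_trans (l2norm_mxpow2 _ As v1) _.
    by apply: le_trans (l2norm_mulmx_fro _ _) _; rewrite ler_piMr ?l2norm_ge0.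
  have e0 : (2 ^ j)%:R != 0 :> R by rewrite pnatr_eq0 expn_eq0.
  have -> : l2norm (A *m v) = (l2norm (A *m v) ^+ (2 ^ j)) `^ ((2 ^ j)%:R^-1).
    by rewrite -powR_mulrn ?l2norm_ge0 // -powRrM mulfV // powRr1 ?l2norm_ge0.
  by apply: ge0_ler_powR; rewrite ?nnegrE ?exprn_ge0 ?l2norm_ge0 ?invr_ge0 ?ler0n.
have := opnorm_le (powR_ge0 _ _) ge1.
have e0 : (2 ^ j)%:R != 0 :> R by rewrite pnatr_eq0 expn_eq0.
move=> h; apply: le_trans (lerXn2r (2 ^ j) _ _ h) _; rewrite ?nnegrE ?opnorm_ge0 ?powR_ge0 //.
by rewrite -powR_mulrn ?powR_ge0 // -powRrM mulVf // powRr1.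
Qed.

Lemma opnorm_symmx m n (A : 'M[R]_(m, n)) : opnorm A <= opnorm (symmx A).
Proof.
apply: opnorm_le (opnorm_ge0 _) _ => v v1.
have l2col (a : 'cV[R]_m) (b : 'cV_n) : l2norm (col_mx a b) ^+ 2 = l2norm a ^+ 2 + l2norm b ^+ 2.
  by rewrite !l2norm_sqr_cV big_split_ord; congr (_ + _); apply: eq_bigr => i _;
     rewrite ?col_mxEu ?col_mxEd.
have e : symmx A *m col_mx 0 v = col_mx (A *m v) 0.
  by rewrite mul_block_col !mul0mx mulmx0 add0r addr0.
have := @l2norm_le_opnorm _ _ (symmx A) (col_mx 0 v).
rewrite e => h; apply: le_trans (_ : _ <= l2norm (col_mx (A *m v) (0 : 'cV_n))) (h _).
  rewrite -ler_sqr ?nnegrE ?l2norm_ge0 // l2col lerDl sqr_ge0 //.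
by rewrite -(@expr_le1 _ 2) ?l2norm_ge0 // l2col l2norm0 expr0n add0r expr_le1 ?l2norm_ge0.
Qed.

Lemma symmx_tr m n (A : 'M[R]_(m, n)) : (symmx A)^T = symmx A.
Proof. by rewrite /symmx tr_block_mx !trmx0 trmxK. Qed.

End OperatorNorm.

(** * Signed walks and a supersolution of their transfer operator *)

Section SignedWalks.
Context {R : realFieldType} {V E : finType} (src tgt : E -> V).

Definition inc (x : V) (e : E) : bool := (src e == x) || (tgt e == x).
Definition other (x : V) (e : E) : V := if src e == x then tgt e else src e.
Definition deg (O : {set E}) (x : V) : nat := #|[set e in O | inc x e]|.

(** A sign pattern is encoded by the set [b] of edges with sign -1, so an average over signs is a
    sum over [{set E}]. *)
Definition sgn (b : {set E}) (e : E) : R := (-1) ^+ (e \in b).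
Definition walsh (O b : {set E}) : R := \prod_(e in O) sgn b e.

(** The (v, w) entry of the L-th power of the signed weighted adjacency matrix. *)
Fixpoint walk (a : E -> R) (b : {set E}) (L : nat) (v w : V) : R :=
  if L is L'.+1 then
    \sum_(e | inc v e) a e * sgn b e * walk a b L' (other v e) w
  else (v == w)%:R.

(** The shifted double factorial (m-1)!!; for even m it counts the pairings of m points. *)
Fixpoint dfact (m : nat) : nat :=
  if m is m'.+1 then (if m' is m''.+1 then m''.+1 * dfact m'' else 1)%N else 1%N.

Lemma dfactSS m : dfact m.+2 = (m.+1 * dfact m)%N.
Proof. by []. Qed.

Lemma prod_dfact_add2 (D : V -> nat) u :
  (\prod_x dfact (D x + (x == u).*2) = (D u).+1 * \prod_x dfact (D x))%N.
Proof.
rewrite (bigD1 u) //= eqxx addn2 dfactSS -mulnA [in RHS](bigD1 u) //=.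
by congr (_ * (_ * _))%N; apply: eq_bigr => x /negPf->; rewrite addn0.
Qed.

Lemma prod_dfact_set0 v :
  (\prod_x dfact (deg finset.set0 x + (x == v)) = 1)%N.
Proof.
rewrite big1 // => x _; rewrite (_ : deg _ x = 0%N) ?add0n; first by case: eqP.
by apply/eqP; rewrite cards_eq0; apply/eqP/setP => e; rewrite !inE.
Qed.

Lemma sgn_sq (b : {set E}) e : sgn b e * sgn b e = 1.
Proof. by rewrite /sgn -expr2 sqrr_sign. Qed.

Lemma walshU1 (O b : {set E}) e : e \notin O -> walsh O b * sgn b e = walsh (e |: O) b.
Proof. by move=> eO; rewrite /walsh big_setU1 //= mulrC. Qed.

Lemma walshD1 (O b : {set E}) e : e \in O -> walsh O b * sgn b e = walsh (O :\ e) b.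
Proof.
by move=> eO; rewrite /walsh (big_setD1 e) //= mulrC mulrA sgn_sq mul1r.
Qed.

Lemma card_setsT : #|{: {set E}}| = (2 ^ #|E|)%N.
Proof. by rewrite -(cardsT {set E}) -finset.powersetT card_powerset cardsT. Qed.

(** Toggling one edge of a nonempty O in b is an involution that reverses the sign of the
    character. *)
Lemma sum_walsh (O : {set E}) : \sum_b walsh O b = (O == finset.set0)%:R * 2 ^+ #|E|.
Proof.
have [->|/set0Pn[e eO]] := eqVneq O finset.set0.
  rewrite mul1r (eq_bigr (fun=> 1)) => [|b _]; last by rewrite /walsh big_set0.
  by rewrite sumr_const card_setsT natrX.
rewrite mul0r.
pose h (b : {set E}) := if e \in b then b :\ e else e |: b.
have hK : involutive h.
  move=> b; rewrite /h; case eb: (e \in b); first by rewrite !inE eqxx /= finset.setD1K.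
  by rewrite !inE eqxx /= finset.setU1K ?eb.
have hw b : walsh O (h b) = - walsh O b.
  rewrite /walsh (bigD1 e) //= [in RHS](bigD1 e) //= -mulNr; congr (_ * _).
    by rewrite /sgn /h; case: ifPn => eb; rewrite !inE eqxx ?eb /= ?expr0 ?expr1 ?opprK.
  apply: eq_bigr => f /andP[_ fe]; rewrite /sgn /h.
  by case: ifPn => eb; rewrite !inE (negPf fe).
have : \sum_b walsh O b = - \sum_b walsh O b.
  rewrite {1}(reindex_inj (inv_inj hK)) /= -sumrN.
  by apply: eq_bigr => b _; exact: hw.
by move/eqP; rewrite -addr_eq0 -mulr2n mulrn_eq0 => /eqP.
Qed.

Hypothesis src_neq_tgt : forall e, src e != tgt e.

Lemma other_neq x e : inc x e -> other x e != x.
Proof.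
rewrite /inc /other; have := src_neq_tgt e.
by have [<-|] := eqVneq (src e) x; first by rewrite eq_sym.
Qed.

Lemma inc_split v e x : inc v e -> inc x e = ((x == v) + (x == other v e))%N :> nat.
Proof.
rewrite /inc /other; have := src_neq_tgt e.
have [<-|nsv] /= := eqVneq (src e) v; last first.
  move=> st /eqP<-; rewrite [src e == x]eq_sym [tgt e == x]eq_sym addnC.
  by have [->|] := eqVneq x (src e); rewrite ?(negPf st).
move=> st _; rewrite [src e == x]eq_sym [tgt e == x]eq_sym.
by have [->|] := eqVneq x (src e); rewrite ?(negPf st).
Qed.

Lemma degU1 (O : {set E}) e x : e \notin O -> deg (e |: O) x = (deg O x + inc x e)%N.
Proof.
move=> eO; rewrite /deg addnC.
have [ie|ie] := boolP (inc x e).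
  rewrite -[in RHS](@finset.setU1K _ e O) //.
  rewrite (cardsD1 e) !inE eqxx ie /=; congr (_ + _)%N.
  by apply: eq_card => f; rewrite !inE andbA; case: eqP => //= _; case: (f \in O).
apply: eq_card => f; rewrite !inE.
by have [->|//] := eqVneq f e; rewrite (negPf ie) !andbF.
Qed.

Section WalkBound.
Context (a : E -> R) (B2 kap : R) (M : nat).
Hypothesis a0 : forall e, 0 <= a e.
Hypothesis kap0 : 0 < kap.
(** By [walk_wgtU1], the left side is, up to [kap], the total relative weight of the steps from v
    that enter O. *)
Hypothesis growth : forall (O : {set E}) v, (#|O| <= M)%N ->
  \sum_(e | inc v e) a e ^+ 2 * (deg O (other v e)).+1%:R <= B2.

(* The weight of a state (O, v): O is the set of edges crossed an odd number of
   times so far, v the current vertex.  The double factorials make the weight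
   of the crossings that leave O exactly cancel the number of choices. *)
Definition walk_wgt (O : {set E}) (v : V) : R :=
  (\prod_(e in O) a e ^+ 2) * kap ^+ #|O| *
  (\prod_x dfact (deg O x + (x == v)))%:R.

(** The cost of one step: [kap * B2] for the edges that enter O and [kap^-1] for those that leave
    it. With B2 = B^2 and kap = B^-1 the two are equal and K = 2 B. *)
Let K : R := kap * B2 + kap^-1.

Lemma walk_wgt_ge0 O v : 0 <= walk_wgt O v.
Proof.
rewrite /walk_wgt !mulr_ge0 ?ler0n ?exprn_ge0 ?(ltW kap0) //.
by apply: prodr_ge0 => e _; rewrite exprn_ge0.
Qed.

(** The degree gained at v replaces the mark of the current vertex, so the factor at v is unchanged;
    at the new vertex the argument of [dfact] rises by two. *)
Lemma walk_wgtU1 (O : {set E}) v e : inc v e -> e \notin O ->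
  walk_wgt (e |: O) (other v e) =
  a e ^+ 2 * (deg O (other v e)).+1%:R * (kap * walk_wgt O v).
Proof.
move=> ie eO; rewrite /walk_wgt big_setU1 //= cardsU1 eO /= add1n [kap ^+ _.+1]exprS.
set u := other v e; have uv : u != v := other_neq ie.
have -> : (\prod_x dfact (deg (e |: O) x + (x == u)) =
    (deg O u).+1 * \prod_x dfact (deg O x + (x == v)))%N.
  have := prod_dfact_add2 (fun x => deg O x + (x == v))%N u.
  rewrite (negPf uv) addn0 => <-; apply: eq_bigr => x _; congr dfact.
  by rewrite degU1 // (inc_split x ie) -/u -addnn !addnA.
by rewrite natrM; ring.
Qed.

(** The reverse of entering e: the factor at v loses two and releases deg O v, the number of edges
    of O that could have been left. *)
Lemma walk_wgtD1 (O : {set E}) v e : inc v e -> e \in O ->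
  a e ^+ 2 * (deg O v)%:R * walk_wgt (O :\ e) (other v e) = kap^-1 * walk_wgt O v.
Proof.
move=> ie eO; rewrite /walk_wgt (big_setD1 e eO) /= (cardsD1 e O) eO /= add1n [kap ^+ _.+1]exprS.
set u := other v e; have uv : u != v := other_neq ie.
have eD : e \notin O :\ e by rewrite !inE eqxx.
have dO x : deg O x = (deg (O :\ e) x + ((x == v) + (x == u)))%N.
  by rewrite -{1}(finset.setD1K eO) degU1 // (inc_split x ie).
have -> : (\prod_x dfact (deg O x + (x == v)) =
    deg O v * \prod_x dfact (deg (O :\ e) x + (x == u)))%N.
  have := prod_dfact_add2 (fun x => deg (O :\ e) x + (x == u))%N v.
  rewrite {2}/u eq_sym (negPf uv) addn0.
  rewrite dO eqxx eq_sym (negPf uv) !addn0 addn1 => <-.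
  apply: eq_bigr => x _; congr dfact.
  by rewrite dO -addnn; lia.
rewrite natrM; set p1 := \prod_(i in _) _; set p2 := (\prod_x _)%:R.
by field; rewrite gt_eqF.
Qed.

(** Crossing e multiplies the character by the sign of e, hence toggles e in O. Carrying the product
    of the [a e] over O on the left avoids any division by [a e], which may vanish: a crossing
    either extends this product or produces [a e ^+ 2]. The budget #|O| + L <= M keeps [growth]
    applicable throughout. *)
Lemma walsh_walk_bound L (O : {set E}) v w : (#|O| + L <= M)%N ->
  (\prod_(e in O) a e) * \sum_b walsh O b * walk a b L v w
    <= 2 ^+ #|E| * K ^+ L * walk_wgt O v.
Proof.
elim: L O v => [|L IH] O v hM /=.
  rewrite expr0 mulr1 -mulr_suml sum_walsh.
  have [->|nO] := eqVneq O finset.set0; last by rewrite !mul0r mulr0 mulr_ge0 ?exprn_ge0 ?walk_wgt_ge0.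
  rewrite /walk_wgt !big_set0 cards0 !mul1r; apply: ler_pM; rewrite ?ler0n ?exprn_ge0 //.
  rewrite prod_dfact_set0.
  by case: eqP.
have -> : \sum_b walsh O b * (\sum_(e | inc v e) a e * sgn b e * walk a b L (other v e) w)
   = \sum_(e | inc v e) a e * \sum_b walsh (if e \in O then O :\ e else e |: O) b * walk a b L (other v e) w.
  under eq_bigr do rewrite mulr_sumr.
  rewrite exchange_big /=; apply: eq_bigr => e ie.
  rewrite mulr_sumr; apply: eq_bigr => b _.
  by case: ifPn => eO; [rewrite -walshD1//|rewrite -walshU1//]; ring.
rewrite mulr_sumr.
have K0 : 0 <= K.
  rewrite addr_ge0 ?invr_ge0 ?(ltW kap0) // mulr_ge0 ?(ltW kap0) //.
  apply: (le_trans _ (growth (O := finset.set0) v _)); last by rewrite cards0.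
  by apply: sumr_ge0 => e _; rewrite mulr_ge0 // exprn_ge0.
set c := 2 ^+ #|E| * K ^+ L.
have c0 : 0 <= c by rewrite mulr_ge0 // exprn_ge0.
(* An entering edge is charged to the first term, a leaving one to a share 1 / deg O v of the
   second; there are deg O v such shares. *)
have step e : inc v e ->
  \prod_(i in O) a i * (a e * \sum_b walsh (if e \in O then O :\ e else e |: O) b * walk a b L (other v e) w)
  <= (a e ^+ 2 * (deg O (other v e)).+1%:R) * (c * (kap * walk_wgt O v)) + (e \in O)%:R * ((deg O v)%:R^-1 * (c * (kap^-1 * walk_wgt O v))).
  move=> ie; case: ifPn => eO.
    rewrite mul1r; apply: le_trans (_ : (deg O v)%:R^-1 * (c * (kap^-1 * walk_wgt O v)) <= _); last first.
      by rewrite lerDr; apply: mulr_ge0; [rewrite mulr_ge0 ?exprn_ge0|rewrite (mulr_ge0 c0) ?(mulr_ge0 (ltW kap0)) ?walk_wgt_ge0].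
    rewrite (big_setD1 e eO) /=.
    have dv0 : (deg O v)%:R != 0 :> R.
      by rewrite pnatr_eq0 -lt0n /deg card_gt0; apply/set0Pn; exists e; rewrite !inE eO.
    rewrite -(walk_wgtD1 ie eO).
    have -> : (deg O v)%:R^-1 * (c * (a e ^+ 2 * (deg O v)%:R * walk_wgt (O :\ e) (other v e)))
      = a e ^+ 2 * (c * walk_wgt (O :\ e) (other v e)) by field.
    rewrite [X in X <= _](_ : _ = a e ^+ 2 * (\prod_(i in O :\ e) a i * \sum_b walsh (O :\ e) b * walk a b L (other v e) w)); last by ring.
    rewrite ler_wpM2l ?exprn_ge0 //; apply: IH.
    by move: hM; rewrite (cardsD1 e O) eO; lia.
  rewrite mul0r addr0 mulrA -[X in X * _](_ : \prod_(i in e |: O) a i = _); last first.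
    by rewrite big_setU1 //= mulrC.
  apply: le_trans (IH _ _ _) _; first by rewrite cardsU1 eO; lia.
  by rewrite walk_wgtU1 // -/c le_eqVlt; apply/orP; left; apply/eqP; ring.
apply: le_trans (ler_sum _ step) _.
rewrite big_split /= -mulr_suml.
have -> : 2 ^+ #|E| * K ^+ L.+1 * walk_wgt O v = B2 * (c * (kap * walk_wgt O v)) + c * (kap^-1 * walk_wgt O v).
  by rewrite /c exprSr /K; ring.
apply: lerD.
  by rewrite ler_wpM2r ?(mulr_ge0 c0) ?(mulr_ge0 (ltW kap0)) ?walk_wgt_ge0 //; apply: growth; lia.
rewrite -mulr_suml mulrA.
have X0 : 0 <= c * (kap^-1 * walk_wgt O v) by rewrite (mulr_ge0 c0) // mulr_ge0 ?walk_wgt_ge0 ?invr_ge0 ?(ltW kap0).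
rewrite -[X in _ <= X]mul1r ler_wpM2r //.
have -> : \sum_(i | inc v i) (i \in O)%:R = (deg O v)%:R :> R.
  rewrite -natr_sum /deg -sum1_card; congr (_%:R).
  by rewrite big_mkcond [RHS]big_mkcond /=; apply: eq_bigr => i _; rewrite !inE; case: (inc v i); case: (i \in O).
have [->|d0] := eqVneq (deg O v) 0%N; first by rewrite mul0r.
by rewrite mulfV // pnatr_eq0.
Qed.

End WalkBound.

Lemma sum_walk_bound (a : E -> R) (B : R) (M : nat) v w :
  (forall e, 0 <= a e) -> 0 < B ->
  (forall (O : {set E}) v, (#|O| <= M)%N ->
    \sum_(e | inc v e) a e ^+ 2 * (deg O (other v e)).+1%:R <= B ^+ 2) ->
  \sum_b walk a b M v w <= 2 ^+ #|E| * (2 * B) ^+ M.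
Proof.
move=> a0 B0 gr.
have := walsh_walk_bound a0 (_ : 0 < B^-1) gr (L := M) (O := finset.set0) v w.
rewrite invr_gt0 cards0 => /(_ B0 (leqnn _)).
rewrite {1}big_set0 mul1r /walk_wgt big_set0 cards0 expr0 !mul1r.
rewrite [X in X <= _ -> _](_ : _ = \sum_b walk a b M v w); last first.
  by apply: eq_bigr => b _; rewrite /walsh big_set0 mul1r.
rewrite prod_dfact_set0 mulr1 invrK; congr (_ <= _ * _ ^+ _).
by field; rewrite gt_eqF.
Qed.

End SignedWalks.

(** * Sign averages and trace moments of a flipped matrix *)

Section SignAverage.
Context {R : realType} {n p : nat}.
Implicit Types (b : {set 'I_n * 'I_p}) (A : 'M[R]_(n, p)).

(** The walks live on the complete bipartite graph between row and column indices: an edge is a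
    matrix entry, and the signed adjacency matrix is [symmx (flip b A)]. *)
Definition bsrc (e : 'I_n * 'I_p) : 'I_(n + p) := lshift p e.1.
Definition btgt (e : 'I_n * 'I_p) : 'I_(n + p) := rshift n e.2.

Lemma bsrc_neq_btgt e : bsrc e != btgt e.
Proof. by rewrite /bsrc /btgt eq_lrshift. Qed.

Definition flip b A : 'M[R]_(n, p) := \matrix_(i, j) (sgn b (i, j) * A i j).

Definition avg (f : {set 'I_n * 'I_p} -> R) : R :=
  (\sum_b f b) / 2 ^+ #|{: 'I_n * 'I_p}|.

Lemma normr_sgn b e : `|sgn b e : R| = 1.
Proof. by rewrite /sgn normrX normrN1 expr1n. Qed.

Lemma flip_norm b A i j : `|flip b A i j| = `|A i j|.
Proof. by rewrite mxE normrM normr_sgn mul1r. Qed.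

Lemma flipD b A B : flip b (A + B) = flip b A + flip b B.
Proof. by apply/matrixP => i j; rewrite !mxE mulrDr. Qed.

Lemma flip0 b : flip b 0 = 0.
Proof. by apply/matrixP => i j; rewrite !mxE mulr0. Qed.

Lemma ler_avg f g : (forall b, f b <= g b) -> avg f <= avg g.
Proof. by move=> fg; rewrite ler_wpM2r ?invr_ge0 ?exprn_ge0 // ler_sum. Qed.

Lemma avgD f g : avg (fun b => f b + g b) = avg f + avg g.
Proof. by rewrite /avg big_split mulrDl. Qed.

Lemma avgZ c f : avg (fun b => c * f b) = c * avg f.
Proof. by rewrite /avg -mulr_sumr mulrA. Qed.

Lemma avg_sum (I : finType) (f : I -> {set 'I_n * 'I_p} -> R) :
  avg (fun b => \sum_i f i b) = \sum_i avg (f i).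
Proof. by rewrite /avg exchange_big mulr_suml. Qed.

Lemma avg_cst c : avg (fun=> c) = c.
Proof.
rewrite /avg sumr_const card_setsT -[c *+ _]mulr_natr natrX mulfK // expf_neq0 // pnatr_eq0.
Qed.

Lemma avg_ge0 f : (forall b, 0 <= f b) -> 0 <= avg f.
Proof. by move=> f0; rewrite -(avg_cst 0) ler_avg. Qed.

(** The signs of A are absorbed by the symmetric difference of b with the set of negative entries,
    so A may be taken nonnegative. *)
Lemma avg_flip_abs (f : 'M[R]_(n, p) -> R) A :
  avg (fun b => f (flip b A)) = avg (fun b => f (flip b (map_mx Num.norm A))).
Proof.
rewrite /avg; congr (_ / _).
pose D := [set e : 'I_n * 'I_p | A e.1 e.2 < 0].
pose h b := [set e | (e \in b) (+) (e \in D)].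
have hK : involutive h by move=> b; apply/setP => e; rewrite !inE addbK.
rewrite (reindex_inj (inv_inj hK)) /=; apply: eq_bigr => b _; congr f.
apply/matrixP => i j; rewrite !mxE /sgn !inE /= signr_addb -mulrA; congr (_ * _).
by rewrite mulrC -[_ ^+ (_ < 0)%R]/((-1) ^+ (A i j < 0)%R) [RHS]normrEsign mulrC.
Qed.

Lemma sum_inc_l i (f : 'I_n * 'I_p -> 'I_(n + p) -> R) :
  \sum_(e | inc bsrc btgt (lshift p i) e) f e (other bsrc btgt (lshift p i) e)
  = \sum_j f (i, j) (rshift n j).
Proof.
transitivity (\sum_(k | k == i) \sum_j f (k, j) (rshift n j)); last by rewrite big_pred1_eq.
rewrite pair_big_dep /=; apply: eq_big => [[k j]|[k j]] /=.
  by rewrite /inc /bsrc /btgt eq_rlshift orbF andbT (inj_eq (@lshift_inj _ _)).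
by rewrite /inc /bsrc /btgt /other eq_rlshift orbF /= => ->.
Qed.

Lemma sum_inc_r j (f : 'I_n * 'I_p -> 'I_(n + p) -> R) :
  \sum_(e | inc bsrc btgt (rshift n j) e) f e (other bsrc btgt (rshift n j) e)
  = \sum_i f (i, j) (lshift p i).
Proof.
transitivity (\sum_i \sum_(k | k == j) f (i, k) (lshift p i)); last first.
  by apply: eq_bigr => i _; rewrite big_pred1_eq.
rewrite pair_big_dep /=; apply: eq_big => [[i k]|[i k]] /=.
  by rewrite /inc /bsrc /btgt eq_lrshift (inj_eq (@rshift_inj _ _)).
by rewrite /inc /bsrc /btgt /other eq_lrshift.
Qed.

Lemma walk_mxpow b A L v w :
  walk bsrc btgt (fun e => A e.1 e.2) b L v w = mxpow (symmx (flip b A)) L v w.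
Proof.
elim: L v => [|L IH] v /=; first by rewrite mxE.
rewrite mxE big_split_ord /=.
case: (split_ordP v) => [i|j] ->.
  rewrite [X in _ = X + _]big1 ?add0r => [|k _]; last first.
    by rewrite block_mxEul mxE mul0r.
  rewrite (sum_inc_l i (fun e u => A e.1 e.2 * sgn b e * walk bsrc btgt (fun e => A e.1 e.2) b L u w)).
  by apply: eq_bigr => j _; rewrite block_mxEur IH mxE; ring.
rewrite [X in _ = _ + X]big1 ?addr0 => [|k _]; last first.
  by rewrite block_mxEdr mxE mul0r.
rewrite (sum_inc_r j (fun e u => A e.1 e.2 * sgn b e * walk bsrc btgt (fun e => A e.1 e.2) b L u w)).
by apply: eq_bigr => i _; rewrite block_mxEdl IH !mxE; ring.
Qed.

Lemma sum_deg_l (O : {set 'I_n * 'I_p}) :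
  (\sum_i deg bsrc btgt O (lshift p i) = #|O|)%N.
Proof.
rewrite -sum1_card (partition_big fst xpredT) //=; apply: eq_bigr => i _.
rewrite /deg -sum1_card; apply: eq_bigl => e.
by rewrite !inE /inc /bsrc /btgt eq_rlshift orbF (inj_eq (@lshift_inj _ _)).
Qed.

Lemma sum_deg_r (O : {set 'I_n * 'I_p}) :
  (\sum_j deg bsrc btgt O (rshift n j) = #|O|)%N.
Proof.
rewrite -sum1_card (partition_big snd xpredT) //=; apply: eq_bigr => j _.
rewrite /deg -sum1_card; apply: eq_bigl => e.
by rewrite !inE /inc /bsrc /btgt eq_lrshift (inj_eq (@rshift_inj _ _)).
Qed.

Section Moments.
Context (A : 'M[R]_(n, p)) (B s2 v2 : R).
Hypothesis A_ge0 : forall i j, 0 <= A i j.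
Hypothesis s2_ge0 : 0 <= s2.
Hypothesis row_le : forall i, \sum_j A i j ^+ 2 <= v2.
Hypothesis col_le : forall j, \sum_i A i j ^+ 2 <= v2.
Hypothesis entry_le : forall i j, A i j ^+ 2 <= s2.
Hypothesis B_gt0 : 0 < B.

(** The neighbours of a vertex lie on the opposite side, where the degrees in O add up to #|O| <= M;
    this bounds the growth sum by v2 + M * s2. *)
Lemma avg_mxpow_le M v w : v2 + M%:R * s2 <= B ^+ 2 ->
  avg (fun b => mxpow (symmx (flip b A)) M v w) <= (2 * B) ^+ M.
Proof.
move=> B_ge; rewrite /avg ler_pdivrMr ?exprn_gt0 // mulrC.
under eq_bigr do rewrite -walk_mxpow.
apply: sum_walk_bound => //; first exact: bsrc_neq_btgt.
move=> O x OM; apply: le_trans B_ge.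
have sumle (I : finType) (f : I -> R) (D : I -> nat) :
    (forall i, f i ^+ 2 <= s2) -> \sum_i f i ^+ 2 <= v2 -> (\sum_i D i = #|O|)%N ->
    \sum_i f i ^+ 2 * (D i).+1%:R <= v2 + M%:R * s2.
  move=> f2 fv DO.
  under eq_bigr do rewrite -natr1 mulrDr mulr1.
  rewrite big_split /= addrC lerD //.
  apply: (@le_trans _ _ (\sum_i s2 * (D i)%:R)).
    by apply: ler_sum => i _; rewrite ler_wpM2r.
  by rewrite -mulr_sumr -natr_sum DO mulrC ler_wpM2r ?ler_nat.
case: (split_ordP x) => [i|j] ->.
  rewrite (sum_inc_l i (fun e u => A e.1 e.2 ^+ 2 * (deg bsrc btgt O u).+1%:R)) /=.
  by apply: sumle => //; exact: sum_deg_r.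
rewrite (sum_inc_r j (fun e u => A e.1 e.2 ^+ 2 * (deg bsrc btgt O u).+1%:R)) /=.
by apply: sumle => //; exact: sum_deg_l.
Qed.

(** Rows of [symmx] outside W vanish, so the trace runs over W only. The factor #|W| instead of n +
    p is what lets small blocks use small moments. *)
Lemma avg_opnorm_moment j (W : {set 'I_(n + p)}) :
  (forall i k, A i k != 0 -> (lshift p i \in W) && (rshift n k \in W)) ->
  v2 + (2 ^ j.+1)%:R * s2 <= B ^+ 2 ->
  avg (fun b => opnorm (flip b A) ^+ (2 ^ j.+1)) <= #|W|%:R * (2 * B) ^+ (2 ^ j.+1).
Proof.
move=> WA B_ge; set M := (2 ^ j.+1)%N.
apply: (@le_trans _ _ (avg (fun b => \sum_(v in W) mxpow (symmx (flip b A)) M v v))).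
  apply: ler_avg => b.
  apply: (@le_trans _ _ (\tr (mxpow (symmx (flip b A)) M))).
    apply: le_trans (opnorm_trace_mxpow j (symmx_tr _)).
    by apply: lerXn2r; rewrite ?nnegrE ?opnorm_ge0 // opnorm_symmx.
  rewrite /mxtrace (bigID (mem W)) /= [X in _ + X]big1 ?addr0 // => v vW.
  rewrite -[M]prednK ?expn_gt0 //= mxE big1 // => u _.
  suff -> : symmx (flip b A) v u = 0 by rewrite mul0r.
  have A0 i k : (lshift p i \notin W) || (rshift n k \notin W) -> A i k = 0.
    by move=> h; apply/eqP; apply: contraTT h => /WA; rewrite negb_or !negbK.
  case: (split_ordP v) vW => [i|k] -> vW; case: (split_ordP u) => [i'|k'] ->.
  - by rewrite block_mxEul mxE.
  - by rewrite block_mxEur mxE A0 ?vW ?mulr0.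
  - by rewrite block_mxEdl !mxE A0 ?vW ?orbT ?mulr0.
  - by rewrite block_mxEdr mxE.
rewrite /avg exchange_big mulr_suml /=.
apply: (@le_trans _ _ (\sum_(v in W) (2 * B) ^+ M)).
  by apply: ler_sum => v _; apply: avg_mxpow_le.
by rewrite sumr_const [leRHS]mulr_natl.
Qed.

End Moments.

End SignAverage.

(** * Bound by truncation and moments of logarithmic order *)

Section SeginerBound.
Context {R : realType}.

Lemma ln2_ge_half : 2^-1 <= ln 2 :> R.
Proof.
rewrite -ler_expR lnK ?posrE // -[2^-1]opprK expRN -[leRHS]invrK lef_pV2 ?posrE ?expR_gt0 //.
by apply: le_trans (expR_ge1Dx _); lra.
Qed.

Lemma ln_natX2 (k : nat) : ln (2 ^ k)%:R = k%:R * ln 2 :> R.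
Proof. by rewrite natrX lnXn // mulr_natl. Qed.

Context {n p : nat}.

(** A pointwise substitute for the comparison of moments; its right side is linear in [y ^+ M], so
    blocks with different exponents can be added. *)
Lemma le_moment (c y : R) M : 0 < c -> 0 <= y -> (0 < M)%N ->
  y <= c * (1 + y ^+ M / c ^+ M).
Proof.
move=> c0 y0 M0; rewrite -expr_div_n -[leLHS](divfK (lt0r_neq0 c0)) mulrC.
rewrite ler_wpM2l ?(ltW c0) //; set z := y / c.
have z0 : 0 <= z by rewrite divr_ge0 ?(ltW c0).
have [z1|z1] := leP z 1; first by rewrite (le_trans z1) // lerDl exprn_ge0.
by rewrite (le_trans (ler_eXnr M0 (ltW z1))) // lerDr.
Qed.

Lemma avg_le_moment (f : {set 'I_n * 'I_p} -> R) c M : 0 < c -> (0 < M)%N ->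
  (forall b, 0 <= f b) -> avg (fun b => f b ^+ M) <= c ^+ M ->
  avg f <= 2 * c.
Proof.
move=> c0 M0 f0 fM.
apply: le_trans (ler_avg (fun b => le_moment c0 (f0 b) M0)) _.
rewrite avgZ avgD avg_cst mulrC ler_wpM2r ?(ltW c0) //.
have -> : avg (fun b => f b ^+ M / c ^+ M) = (c ^+ M)^-1 * avg (fun b => f b ^+ M).
  by rewrite -avgZ; congr avg; apply/funext => b; rewrite mulrC.
have : (c ^+ M)^-1 * avg (fun b => f b ^+ M) <= 1.
  by rewrite ler_pdivrMl ?exprn_gt0 // mulr1.
lra.
Qed.

(** The exponent has to be a power of two; this one is of order ln N and large enough for N <= 2^M,
    so the dimension costs a factor 2 after the M-th root. *)
Lemma exists_pow2 N : (4 <= N)%N ->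
  exists j, (N <= 2 ^ (2 ^ j.+1))%N /\ (2 ^ j.+1)%:R <= 8 * ln (N%:R : R).
Proof.
move=> N4; set t := up_log 2 N.
have t1 : (1 < t)%N.
  rewrite ltnNge; apply/negP => t1; have := leq_trans N4 (up_logP N (isT : 1 < 2)%N).
  by rewrite -/t => /leq_trans/(_ (leq_pexp2l (isT : 0 < 2)%N t1)).
exists (trunc_log 2 t); split.
  apply: leq_trans (up_logP N (isT : 1 < 2)%N) _; rewrite leq_exp2l //.
  by rewrite ltnW // trunc_log_ltn.
have : (t.-1)%:R * ln 2 <= ln (N%:R : R).
  rewrite -ln_natX2 ler_ln ?posrE ?ltr0n ?expn_gt0 //; last by lia.
  by rewrite ler_nat ltnW // up_log_gtn //; lia.
have h1 : (2 ^ (trunc_log 2 t).+1)%:R <= 4 * (t.-1)%:R :> R.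
  rewrite -natrM ler_nat expnS.
  have := trunc_logP (isT : 1 < 2)%N (ltnW t1); lia.
have := ln2_ge_half; have t0 : 0 <= (t.-1)%:R :> R by [].
nra.
Qed.

Lemma avg_opnorm_seginer (A : 'M[R]_(n, p)) (s h : R) : 0 < s -> 1 <= h ->
  (4 <= n + p)%N -> ln (n + p)%:R <= h ^+ 4 ->
  (forall i j, 0 <= A i j) ->
  (forall i, \sum_j A i j ^+ 2 <= s ^+ 2) ->
  (forall j, \sum_i A i j ^+ 2 <= s ^+ 2) ->
  avg (fun b => opnorm (flip b A)) <= 25 * (s * h).
Proof.
move=> s0 h1 N4 lnN A0 Ar Ac.
have h0 : 0 < h by apply: lt_le_trans h1.
pose D := \matrix_(i, j) (if s / h < A i j then A i j else 0).
pose C := \matrix_(i, j) (if s / h < A i j then 0 else A i j).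
have -> : A = D + C.
  by apply/matrixP => i j; rewrite !mxE; case: ifP; rewrite ?addr0 ?add0r.
have sh0 : 0 < s / h by rewrite divr_gt0.
(* A kept entry exceeds s / h, so it is at most its square times h / s; row and column sums are then
   at most s^2 * h / s = s * h. *)
have hD i j : `|D i j| <= A i j ^+ 2 * (h / s).
  rewrite mxE; case: ifP => [lt|_]; last by rewrite normr0 mulr_ge0 ?sqr_ge0 ?divr_ge0 ?(ltW h0) ?(ltW s0).
  rewrite ger0_norm ?A0 // expr2 -mulrA ler_peMr //.
  by rewrite mulrA ler_pdivlMr // mul1r -ler_pdivrMr // ltW.
have Dn b : opnorm (flip b D) <= s * h.
  have e : s ^+ 2 * (h / s) = s * h by field; rewrite gt_eqF.
  apply: opnorm_schur => [|i|j]; first by rewrite mulr_ge0 ?(ltW s0) ?(ltW h0).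
    under eq_bigr do rewrite flip_norm.
    apply: le_trans (ler_sum _ (fun j _ => hD i j)) _.
    by rewrite -mulr_suml -e ler_wpM2r // divr_ge0 ?(ltW h0) ?(ltW s0).
  under eq_bigr do rewrite flip_norm.
  apply: le_trans (ler_sum _ (fun i _ => hD i j)) _.
  by rewrite -mulr_suml -e ler_wpM2r // divr_ge0 ?(ltW h0) ?(ltW s0).
have [j [Nj jN]] := exists_pow2 N4.
have C0 i k : 0 <= C i k by rewrite mxE; case: ifP.
have CA i k : C i k ^+ 2 <= A i k ^+ 2.
  by rewrite mxE; case: ifP => // _; rewrite expr0n /= sqr_ge0.
have Cs i k : C i k ^+ 2 <= (s / h) ^+ 2.
  apply: lerXn2r; rewrite ?nnegrE ?C0 ?(ltW sh0) // mxE.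
  by case: ifPn => [_|]; rewrite ?(ltW sh0) // -leNgt.
have Cr i : \sum_k C i k ^+ 2 <= s ^+ 2 by apply: le_trans (Ar i); apply: ler_sum.
have Cc k : \sum_i C i k ^+ 2 <= s ^+ 2 by apply: le_trans (Ac k); apply: ler_sum.
have B0 : 0 < 3 * (s * h) by rewrite !mulr_gt0.
(* M <= 8 h^4 and squared entries at most (s / h)^2 give s^2 (1 + 8 h^2) <= 9 s^2 h^2, as h >= 1. *)
have Bge : s ^+ 2 + (2 ^ j.+1)%:R * (s / h) ^+ 2 <= (3 * (s * h)) ^+ 2.
  apply: (@le_trans _ _ (s ^+ 2 + 8 * h ^+ 4 * (s / h) ^+ 2)).
    rewrite lerD2l ler_wpM2r ?sqr_ge0 //; apply: le_trans jN _.
    by rewrite ler_wpM2l.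
  have -> : s ^+ 2 + 8 * h ^+ 4 * (s / h) ^+ 2 = s ^+ 2 * (1 + 8 * h ^+ 2).
    by field; rewrite gt_eqF.
  rewrite !exprMn; have : 1 <= h ^+ 2 by rewrite exprn_ege1.
  have := sqr_ge0 s; nra.
have mom := avg_opnorm_moment C0 (sqr_ge0 _) Cr Cc Cs B0 (j := j) (W := [set: 'I_(n + p)]).
have := mom (fun i k _ => _) Bge; rewrite cardsT card_ord => {}mom.
(* The constant 24: 3 from B, 2 from the walk bound, 2 from the dimension, 2 from [avg_le_moment].
   The large entries add 1. *)
have : avg (fun b => opnorm (flip b C)) <= 2 * (2 * (2 * (3 * (s * h)))).
  apply: (@avg_le_moment _ _ (2 ^ j.+1)); rewrite ?expn_gt0 ?mulr_gt0 //.
    by move=> b; exact: opnorm_ge0.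
  apply: le_trans (mom _) _; first by move=> *; rewrite !inE.
  rewrite [leRHS]exprMn ler_wpM2r ?exprn_ge0 ?mulr_ge0 ?(ltW s0) ?(ltW h0) //.
  by rewrite -natrX ler_nat.
have : avg (fun b => opnorm (flip b D)) <= s * h by rewrite -[leRHS](@avg_cst R n p) ler_avg.
have : avg (fun b => opnorm (flip b (D + C))) <=
    avg (fun b => opnorm (flip b D)) + avg (fun b => opnorm (flip b C)).
  by rewrite -avgD; apply: ler_avg => b; rewrite flipD opnormD.
lra.
Qed.

End SeginerBound.

(** * Block diagonal matrices *)

Section BlockDiagonal.
Context {R : realType} {n p K : nat}.
Implicit Types (A : 'M[R]_(n, p)) (f : 'I_n -> 'I_K) (g : 'I_p -> 'I_K).

(** A block keeps the full size and is padded with zeros, so flips and norms apply without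
    reindexing. *)
Definition block f g t A : 'M[R]_(n, p) :=
  \matrix_(i, j) (if (f i == t) && (g j == t) then A i j else 0).

Lemma opnorm_blockdiag A f g c : 0 <= c ->
  (forall i j, A i j != 0 -> f i = g j) ->
  (forall t, opnorm (block f g t A) <= c) -> opnorm A <= c.
Proof.
move=> c0 fg Ac; apply: opnorm_le => // v v1.
rewrite -ler_sqr ?nnegrE ?l2norm_ge0 // l2norm_sqr_cV.
pose vt t : 'cV[R]_p := \col_j (if g j == t then v j 0 else 0).
apply: (@le_trans _ _ (\sum_t l2norm (block f g t A *m vt t) ^+ 2)).
  rewrite (partition_big f xpredT) //=; apply: ler_sum => t _.
  rewrite l2norm_sqr_cV big_mkcond /=; apply: ler_sum => i _.
  case: eqP => [fi|_]; last exact: sqr_ge0.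
  rewrite le_eqVlt; apply/orP; left; apply/eqP; congr (_ ^+ 2).
  rewrite !mxE; apply: eq_bigr => j _; rewrite !mxE fi eqxx /=.
  case: (eqVneq (g j) t) => // gt; have [->|/fg fgij] := eqVneq (A i j) 0.
    by rewrite !mul0r.
  by rewrite -fgij fi eqxx in gt.
apply: (@le_trans _ _ (\sum_t c ^+ 2 * l2norm (vt t) ^+ 2)).
  apply: ler_sum => t _; rewrite -exprMn; apply: lerXn2r.
  - by rewrite nnegrE l2norm_ge0.
  - by rewrite nnegrE mulr_ge0 ?l2norm_ge0.
  - by rewrite (le_trans (l2norm_mulmx _ _)) // ler_wpM2r ?l2norm_ge0.
rewrite -mulr_sumr ler_piMr ?sqr_ge0 //.
suff -> : \sum_t l2norm (vt t) ^+ 2 = l2norm v ^+ 2 by rewrite expr_le1 ?l2norm_ge0.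
rewrite l2norm_sqr_cV; under eq_bigr do rewrite l2norm_sqr_cV.
rewrite exchange_big /=; apply: eq_bigr => j _.
rewrite (bigD1 (g j)) //= big1 ?addr0 => [|t tg]; first by rewrite mxE eqxx.
by rewrite mxE eq_sym (negPf tg) expr0n.
Qed.

Lemma flip_block b f g t A : flip b (block f g t A) = block f g t (flip b A).
Proof. by apply/matrixP => i j; rewrite !mxE; case: ifP => //; rewrite mulr0. Qed.

(** A union bound in moment form: the maximum over blocks is replaced by a sum, each block with its
    own exponent [M t], and the weights [w t] make the sum at most 1. *)
Lemma avg_opnorm_blockdiag A f g c (w : 'I_K -> R) (M : 'I_K -> nat) : 0 < c ->
  (forall i j, A i j != 0 -> f i = g j) ->
  (forall t, 0 < M t)%N ->
  (forall t, avg (fun b => opnorm (flip b (block f g t A)) ^+ M t) <= c ^+ M t * w t) ->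
  \sum_t w t <= 1 ->
  avg (fun b => opnorm (flip b A)) <= 2 * c.
Proof.
move=> c0 fg M0 hM w1.
pose z b t := opnorm (flip b (block f g t A)) ^+ M t / c ^+ M t.
have z0 b t : 0 <= z b t by rewrite divr_ge0 ?exprn_ge0 ?opnorm_ge0 ?(ltW c0).
apply: (@le_trans _ _ (avg (fun b => c * (1 + \sum_t z b t)))).
  apply: ler_avg => b; apply: (opnorm_blockdiag (f := f) (g := g)).
  - by rewrite mulr_ge0 ?(ltW c0) // addr_ge0 // sumr_ge0.
  - by move=> i j; rewrite mxE mulf_eq0 negb_or => /andP[_ /fg].
  move=> t; rewrite -flip_block.
  apply: le_trans (le_moment c0 (opnorm_ge0 _) (M0 t)) _.
  rewrite ler_wpM2l ?(ltW c0) // lerD2l -/(z b t) (bigD1 t) //= lerDl.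
  by apply: sumr_ge0.
rewrite avgZ avgD avg_cst avg_sum mulrC ler_wpM2r ?(ltW c0) //.
rewrite -[2]/(1 + 1) lerD2l; apply: le_trans w1; apply: ler_sum => t _.
have -> : avg (z^~ t) = (c ^+ M t)^-1 * avg (fun b => opnorm (flip b (block f g t A)) ^+ M t).
  by rewrite -avgZ; congr avg; apply/funext => b; rewrite mulrC.
by rewrite ler_pdivrMl ?exprn_gt0.
Qed.

End BlockDiagonal.

Lemma avg_opnorm_flip_tr {R : realType} n p (A : 'M[R]_(n, p)) :
  avg (fun b => opnorm (flip b A^T)) = avg (fun b => opnorm (flip b A)).
Proof.
rewrite /avg !card_prod mulnC; congr (_ / _).
pose h m l (b : {set 'I_m * 'I_l}) : {set 'I_l * 'I_m} := [set e | (e.2, e.1) \in b].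
have hK m l : cancel (@h m l) (@h l m).
  by move=> b; apply/setP => -[i j]; rewrite !inE.
rewrite (reindex (@h n p)) /=; last by exists (@h p n) => b _; exact: hK.
apply: eq_bigr => b _; rewrite -opnorm_tr; congr opnorm.
by apply/matrixP => i j; rewrite !mxE /sgn inE.
Qed.

(** * Gram matrix bound for small entries *)

Section Remainder.
Context {R : realType} {n p : nat}.

Lemma avg_walsh (O : {set 'I_n * 'I_p}) : O != finset.set0 -> avg (walsh O) = 0 :> R.
Proof. by move=> /negPf O0; rewrite /avg sum_walsh O0 !mul0r. Qed.

(** For j <> k the four signs sit at distinct positions, so the cross terms are averages of a
    nontrivial character. *)
Lemma avg_gram_sqr i i' (c : 'I_p -> R) : i != i' ->
  avg (fun b : {set 'I_n * 'I_p} => (\sum_j sgn b (i, j) * sgn b (i', j) * c j) ^+ 2)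
  = \sum_j c j ^+ 2.
Proof.
move=> ii'.
transitivity (avg (fun b : {set 'I_n * 'I_p} => \sum_j \sum_k (c j * c k) *
   (sgn b (i, j) * sgn b (i', j) * sgn b (i, k) * sgn b (i', k)))).
  congr avg; apply/funext => b; rewrite expr2 mulr_suml; apply: eq_bigr => j _.
  by rewrite mulr_sumr; apply: eq_bigr => k _; ring.
rewrite avg_sum; apply: eq_bigr => j _; rewrite avg_sum (bigD1 j) //= big1 ?addr0.
  rewrite -[RHS](@avg_cst R n p); congr avg; apply/funext => b.
  transitivity (c j * c j * ((sgn b (i, j) * sgn b (i, j)) * (sgn b (i', j) * sgn b (i', j)))); first by ring.
  by rewrite !sgn_sq !mulr1 expr2.
move=> k kj; rewrite avgZ.
pose O : {set 'I_n * 'I_p} := (i', k) |: ((i, k) |: ((i', j) |: [set (i, j)])).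
suff -> : avg (fun b : {set 'I_n * 'I_p} => sgn b (i, j) * sgn b (i', j) * sgn b (i, k) * sgn b (i', k)) = avg (walsh O) :> R.
  by rewrite avg_walsh ?mulr0 //; apply/set0Pn; exists (i', k); rewrite !inE eqxx.
congr avg; apply/funext => b; rewrite -walshU1; last first.
  by rewrite !inE !xpair_eqE !eqxx !(eq_sym i') (negPf ii') (negPf kj) ?andbF.
rewrite -walshU1; last first.
  by rewrite !inE !xpair_eqE !eqxx (negPf ii') (negPf kj) ?andbF.
rewrite -walshU1 ?inE ?xpair_eqE 1?eq_sym ?(negPf ii') //.
by rewrite /walsh big_set1.
Qed.

(** The squared norm is that of the Gram matrix of the rows. Its diagonal is at most s^2 for every
    sign pattern, and the mean squared Hilbert-Schmidt norm F of the rest is at most s^4 times the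
    squared sum of the weights. *)
Lemma avg_opnorm_flat_rows (Y : 'M[R]_(n, p)) (s : R) (w : 'I_n -> R) : 0 < s ->
  (forall i j, 0 <= Y i j) -> (forall i, 0 <= w i) ->
  (forall i, \sum_j Y i j ^+ 2 <= s ^+ 2) ->
  (forall i j, Y i j <= s * w i) -> \sum_i w i <= 1 ->
  avg (fun b => opnorm (flip b Y)) <= 2 * s.
Proof.
move=> s0 Y0 w0 Yr Yw w1.
pose G b i i' := \sum_j sgn b (i, j) * sgn b (i', j) * (Y i j * Y i' j).
pose F b := \sum_(q : 'I_n * 'I_n | q.1 != q.2) G b q.1 q.2 ^+ 2.
have s20 : 0 < s ^+ 2 by rewrite exprn_gt0.
(* Applying 2 x y <= x^2 + y^2 twice, at scales s and s^2, gives a bound linear in F, which can be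
   averaged directly. *)
have Xb b : opnorm (flip b Y) <= (s + (s ^+ 2 + (s ^+ 2 + F b / s ^+ 2) / 2) / s) / 2.
  have F0 : 0 <= F b by apply: sumr_ge0 => q _; exact: sqr_ge0.
  rewrite -opnorm_tr; apply: opnorm_le.
    by rewrite divr_ge0 // addr_ge0 ?(ltW s0) // divr_ge0 ?(ltW s0) // addr_ge0 ?(ltW s20) // divr_ge0 // addr_ge0 ?(ltW s20) // divr_ge0 ?(ltW s20).
  move=> v v1; set y := l2norm _.
  have yE : y ^+ 2 = \sum_(q : 'I_n * 'I_n) v q.1 0 * v q.2 0 * G b q.1 q.2.
    rewrite /y l2norm_sqr_cV.
    transitivity (\sum_j \sum_i \sum_i' v i 0 * v i' 0 * (sgn b (i, j) * sgn b (i', j) * (Y i j * Y i' j))).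
      apply: eq_bigr => j _; rewrite mxE expr2 mulr_suml; apply: eq_bigr => i _.
      by rewrite mulr_sumr; apply: eq_bigr => i' _; rewrite !mxE; ring.
    rewrite exchange_big /=.
    under eq_bigr do rewrite exchange_big /=.
    rewrite pair_bigA /=; apply: eq_bigr => q _.
    by rewrite /G mulr_sumr.
  pose off := \sum_(q : 'I_n * 'I_n) (v q.1 0 * v q.2 0) * (if q.1 != q.2 then G b q.1 q.2 else 0).
  have v21 : \sum_i v i 0 ^+ 2 <= 1 by rewrite -l2norm_sqr_cV expr_le1 ?l2norm_ge0.
  have y2 : y ^+ 2 <= s ^+ 2 + off.
    rewrite yE (bigID (fun q : 'I_n * 'I_n => q.1 == q.2)) /=; apply: lerD; last first.
      rewrite /off [leRHS](bigID (fun q : 'I_n * 'I_n => q.1 == q.2)) /= [X in _ <= X + _]big1.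
        by rewrite add0r; apply: ler_sum => q qq; rewrite qq.
      by move=> q /eqP->; rewrite eqxx mulr0.
    rewrite (eq_bigl (fun q : 'I_n * 'I_n => true && (q.2 == q.1))) => [|q]; last by rewrite eq_sym.
    rewrite -(pair_big_dep xpredT (fun i k => k == i) (fun i k => v i 0 * v k 0 * G b i k)) /=.
    under eq_bigr do rewrite big_pred1_eq.
    apply: (@le_trans _ _ (\sum_i v i 0 ^+ 2 * s ^+ 2)); last first.
      by rewrite -mulr_suml ler_piMl // ltW.
    apply: ler_sum => i _; rewrite -expr2 ler_wpM2l ?sqr_ge0 //.
    apply: le_trans (Yr i); apply: ler_sum => j _.
    by rewrite sgn_sq mul1r -expr2.
  have offF : off ^+ 2 <= F b.
    rewrite /off; apply: le_trans (cauchy_schwarz _ _) _.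
    rewrite [X in _ * X](_ : _ = F b); last first.
      by rewrite /F [RHS]big_mkcond /=; apply: eq_bigr => q _; case: ifP; rewrite ?expr0n.
    rewrite ler_piMl // -[leRHS]mulr1.
    have -> : \sum_(q : 'I_n * 'I_n) (v q.1 0 * v q.2 0) ^+ 2 = (\sum_i v i 0 ^+ 2) * (\sum_i v i 0 ^+ 2).
      rewrite mulr_suml; under [RHS]eq_bigr do rewrite mulr_sumr.
      by rewrite pair_bigA /=; apply: eq_bigr => q _; rewrite exprMn.
    by apply: ler_pM => //; apply: sumr_ge0 => i _; exact: sqr_ge0.
  have h1 : off <= (s ^+ 2 + F b / s ^+ 2) / 2.
    rewrite ler_pdivlMr // -subr_ge0.
    have : 0 <= (off - s ^+ 2) ^+ 2 / s ^+ 2 by rewrite divr_ge0 ?sqr_ge0 ?(ltW s20).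
    have -> : (off - s ^+ 2) ^+ 2 / s ^+ 2 = off ^+ 2 / s ^+ 2 - 2 * off + s ^+ 2 by field; rewrite gt_eqF.
    have : off ^+ 2 / s ^+ 2 <= F b / s ^+ 2 by rewrite ler_wpM2r ?invr_ge0 ?(ltW s20).
    lra.
  have h2 : y <= (s + y ^+ 2 / s) / 2.
    rewrite ler_pdivlMr // -subr_ge0.
    have -> : s + y ^+ 2 / s - y * 2 = (y - s) ^+ 2 / s by field; rewrite gt_eqF.
    by rewrite divr_ge0 ?sqr_ge0 ?(ltW s0).
  apply: le_trans h2 _; rewrite ler_wpM2r // lerD2l ler_wpM2r ?invr_ge0 ?(ltW s0) //.
  by apply: le_trans y2 _; rewrite lerD2l.
have avgF : avg F <= s ^+ 4.
  have -> : avg F = \sum_(q : 'I_n * 'I_n) avg (fun b => if q.1 != q.2 then G b q.1 q.2 ^+ 2 else 0).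
    by rewrite -avg_sum; congr avg; apply/funext => b; rewrite /F big_mkcond.
  apply: (@le_trans _ _ (\sum_(q : 'I_n * 'I_n) s ^+ 4 * (w q.1 * w q.2))).
    apply: ler_sum => q _; case qq: (q.1 != q.2); last first.
      by rewrite avg_cst !mulr_ge0 ?exprn_ge0 ?w0 ?(ltW s0).
    rewrite avg_gram_sqr //.
    (* One factor of each squared entry is spent on the weights; the remaining [Y q.1 j * Y q.2 j]
       sums against the row norms. *)
    apply: (@le_trans _ _ (\sum_j (s * w q.1) * (s * w q.2) * (2^-1 * (Y q.1 j ^+ 2 + Y q.2 j ^+ 2)))).
      apply: ler_sum => j _; rewrite expr2; apply: ler_pM; rewrite ?mulr_ge0 //.
        by apply: ler_pM.
      by have := sqr_ge0 (Y q.1 j - Y q.2 j); nra.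
    rewrite -mulr_sumr -mulr_sumr big_split /=.
    have -> : s ^+ 4 * (w q.1 * w q.2) = (s * w q.1) * (s * w q.2) * s ^+ 2 by ring.
    rewrite ler_wpM2l ?mulr_ge0 ?w0 ?(ltW s0) //.
    by have := Yr q.1; have := Yr q.2; lra.
  rewrite -mulr_sumr ler_piMr ?exprn_ge0 ?(ltW s0) //.
  have -> : \sum_(q : 'I_n * 'I_n) w q.1 * w q.2 = (\sum_i w i) * (\sum_i w i).
    rewrite mulr_suml; under [RHS]eq_bigr do rewrite mulr_sumr.
    by rewrite pair_bigA.
  have sw0 : 0 <= \sum_i w i by rewrite sumr_ge0.
  by rewrite -[leRHS]mulr1; apply: ler_pM.
apply: le_trans (ler_avg Xb) _.
have -> : avg (fun b => (s + (s ^+ 2 + (s ^+ 2 + F b / s ^+ 2) / 2) / s) / 2)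
   = 5 / 4 * s + (4 * s ^+ 3)^-1 * avg F.
  rewrite -avgZ -[X in X + _](@avg_cst R n p) -avgD; congr avg; apply/funext => b.
  by field; rewrite gt_eqF.
have : (4 * s ^+ 3)^-1 * avg F <= s / 4.
  rewrite ler_pdivrMl ?mulr_gt0 ?exprn_gt0 //.
  by have -> : 4 * s ^+ 3 * (s / 4) = s ^+ 4 by field.
lra.
Qed.

End Remainder.

Lemma sum_half_powers {R : realFieldType} K :
  \sum_(k < K) 2^-1 ^+ k.+1 <= 1 :> R.
Proof.
suff -> : \sum_(k < K) 2^-1 ^+ k.+1 = 1 - 2^-1 ^+ K :> R.
  by rewrite gerBl exprn_ge0 // invr_ge0.
elim: K => [|L IH]; first by rewrite big_ord0 expr0 subrr.
by rewrite big_ord_recr /= IH exprS; field.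
Qed.

(** * Dimension-free bound through levels of vertices *)

Section DimensionFree.
Context {R : realType} {n p : nat} (A : 'M[R]_(n, p)) (s r : R).
Context (bv : 'I_(n + p) -> R).
Hypothesis s0 : 0 < s.
Hypothesis r0 : 0 <= r.
Hypothesis A0 : forall i j, 0 <= A i j.
Hypothesis Ar : forall i, \sum_j A i j ^+ 2 <= s ^+ 2.
Hypothesis Ac : forall j, \sum_i A i j ^+ 2 <= s ^+ 2.
Hypothesis bl : forall i j, A i j <= bv (lshift p i).
Hypothesis br : forall i j, A i j <= bv (rshift n j).
(** The counting form of rho_inf <= r: outside some m vertices, [bv] is at most r / sqrt (ln
    (m+1)). *)
Hypothesis top : forall m, (0 < m)%N ->
  (#|[set v | (r < bv v * Num.sqrt (ln m.+1%:R))%R]| <= m)%N.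

Let H : 'M[R]_(n + p) := symmx A.

(** Each size is the eighth power of the preceding one: this absorbs the m + m^5 vertices added by
    [lset] and makes ln (msz k) grow by a factor 8. *)
Definition msz k := (2 ^ (8 ^ k))%N.

Lemma msz_ge2 k : (2 <= msz k)%N.
Proof. by rewrite -[X in (X <= _)%N]expn1 leq_exp2l // expn_gt0. Qed.

Lemma mszS k : msz k.+1 = (msz k ^ 8)%N.
Proof. by rewrite /msz expnSr expnM. Qed.

Lemma msz_gt k : (k < msz k)%N.
Proof. by rewrite (leq_trans (ltn_expl k (isT : 1 < 8)%N)) // ltnW // ltn_expl. Qed.

(* An increasing exhaustion of the vertices, of doubly exponential size: each
   set contains the rows of largest sup norm, and all the neighbours to which
   some vertex of the previous set is joined by a large entry. *)
Fixpoint lset k : {set 'I_(n + p)} :=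
  if k is k'.+1 then
    lset k' :|: [set v | r < bv v * Num.sqrt (ln (msz k').+1%:R)]
      :|: [set u | [exists v in lset k', s ^+ 2 < H v u ^+ 2 * (msz k' ^ 4)%:R]]
  else finset.set0.

Lemma H_row v : \sum_u H v u ^+ 2 <= s ^+ 2.
Proof.
rewrite big_split_ord /=; case: (split_ordP v) => [i|j] ->.
  rewrite big1 ?add0r => [|k _]; last by rewrite block_mxEul mxE expr0n.
  by under eq_bigr do rewrite block_mxEur.
rewrite addrC big1 ?add0r => [|k _]; last by rewrite block_mxEdr mxE expr0n.
by under eq_bigr do rewrite block_mxEdl mxE.
Qed.

(** Chebyshev's inequality for the squared entries of a row. *)
Lemma card_large v M : (#|[set u | (s ^+ 2 < H v u ^+ 2 * M%:R)%R]| <= M)%N.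
Proof.
set L := [set _ | _]; rewrite -(ler_nat R) -(@ler_pM2l _ (s ^+ 2)) ?exprn_gt0 //.
rewrite -sum1_card natr_sum mulr_sumr.
apply: (@le_trans _ _ (\sum_(u in L) H v u ^+ 2 * M%:R)).
  by apply: ler_sum => u; rewrite inE mulr1 => /ltW.
rewrite -mulr_suml ler_wpM2r //; apply: le_trans (H_row v).
rewrite big_mkcond /=; apply: ler_sum => u _; case: ifP => // _; exact: sqr_ge0.
Qed.

Lemma card_exists_in_le (T : finType) (I : {set T}) (Q : T -> pred T) M :
  (forall v, #|[set u | Q v u]| <= M)%N ->
  (#|[set u | [exists v in I, Q v u]]| <= #|I| * M)%N.
Proof.
move=> hM; apply: (@leq_trans (\sum_(v in I) #|[set u | Q v u]|)); last first.
  by rewrite -sum_nat_const; apply: leq_sum.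
rewrite -sum1_card; under [leqRHS]eq_bigr do rewrite -sum1_card big_mkcond.
rewrite exchange_big big_mkcond /=; apply: leq_sum => u _; rewrite inE.
case: existsP => // -[v /andP[vI vu]].
by rewrite (bigD1 v) //= inE vu.
Qed.

Lemma card_lset k : (#|lset k| <= msz k)%N.
Proof.
elim: k => [|k IH] /=; first by rewrite cards0.
set m := msz k; have m2 : (2 <= m)%N := msz_ge2 k.
apply: leq_trans (leq_card_setU _ _) _.
have h1 : (#|lset k :|: [set v | (r < bv v * Num.sqrt (ln m.+1%:R))%R]| <= m + m)%N.
  apply: leq_trans (leq_card_setU _ _) _; apply: leq_add => //.
  by apply: top; apply: leq_trans m2.
have h2 := card_exists_in_le (lset k) (fun v => card_large v (m ^ 4)%N).
have h3 : (#|lset k| * m ^ 4 <= m ^ 5)%N by rewrite expnS leq_mul2r IH orbT.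
apply: leq_trans (leq_add h1 (leq_trans h2 h3)) _.
rewrite mszS -/m addnn -mul2n.
have m5 : (m ^ 5 * 2 <= m ^ 6)%N by rewrite [leqRHS]expnSr leq_mul2l m2 orbT.
have m56 : (2 * m <= m ^ 5)%N.
  by rewrite expnSr leq_mul2r (leq_trans m2) ?orbT // -{1}(expn1 m) leq_pexp2l // ltnW.
have m68 : (m ^ 6 <= m ^ 8)%N by rewrite leq_pexp2l // ltnW.
lia.
Qed.

Lemma lsetS k l : (k <= l)%N -> lset k \subset lset l.
Proof.
move=> kl; rewrite -(subnK kl); elim: (l - k)%N => //= d.
by move=> h; apply: (fintype.subset_trans h); rewrite -finset.setUA finset.subsetUl.
Qed.

(** Level n + p is the default for vertices in none of the sets searched. It respects the count in
    [card_lvl], since msz (n + p) exceeds the number of vertices. *)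
Definition lvl v := find (fun k => v \in lset k) (iota 0 (n + p)).

Lemma lvl_le v : (lvl v <= n + p)%N.
Proof. by rewrite -[leqRHS](size_iota 0) find_size. Qed.

Lemma lvl_in v : (lvl v < n + p)%N -> v \in lset (lvl v).
Proof.
move=> h; have := h; rewrite -[X in (_ < X)%N -> _](size_iota 0) -has_find.
by move=> /(nth_find 0); rewrite nth_iota.
Qed.

Lemma lvl_notin v k : (k < lvl v)%N -> v \notin lset k.
Proof.
move=> kv; have := before_find 0 kv; rewrite nth_iota ?add0n => [->//|].
exact: leq_trans kv (lvl_le v).
Qed.

Lemma card_lvl k : (#|[set v | lvl v <= k]| <= msz k)%N.
Proof.
have [kn|nk] := ltnP k (n + p).
  apply: leq_trans (card_lset k); apply/subset_leq_card/fintype.subsetP => v.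
  rewrite inE => vk; apply: (fintype.subsetP (lsetS vk)).
  by rewrite lvl_in // (leq_ltn_trans vk).
apply: leq_trans (max_card _) _; rewrite card_ord.
by apply: leq_trans nk _; rewrite ltnW // msz_gt.
Qed.

Lemma entry_sqr_le i j : A i j ^+ 2 <= s ^+ 2.
Proof.
apply: le_trans (Ar i); rewrite (bigD1 j) //= lerDl.
by apply: sumr_ge0 => k _; exact: sqr_ge0.
Qed.

(** A vertex outside [lset k.+1] is not among the rows above r / sqrt (ln (msz k + 1)), and this
    logarithm is at least 8^k ln 2 >= 8^k / 2. *)
Lemma entry_lvl i j v k : v = lshift p i \/ v = rshift n j -> (k.+1 < lvl v)%N ->
  A i j ^+ 2 * (8 ^ k)%:R <= 2 * r ^+ 2.
Proof.
move=> ij /lvl_notin /=; rewrite !inE !negb_or -!andbA => /and3P[_ + _].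
rewrite -leNgt => h.
have Ab : A i j <= bv v by case: ij => ->.
have l0 : 0 <= ln (msz k).+1%:R :> R by rewrite ln_ge0 // ler1n.
have h2 : (A i j * Num.sqrt (ln (msz k).+1%:R)) ^+ 2 <= r ^+ 2.
  apply: lerXn2r; rewrite ?nnegrE ?mulr_ge0 ?sqrtr_ge0 //.
  by apply: le_trans h; rewrite ler_wpM2r ?sqrtr_ge0.
rewrite exprMn sqr_sqrtr // in h2.
have h3 : (8 ^ k)%:R * ln 2 <= ln (msz k).+1%:R :> R.
  by rewrite -ln_natX2 ler_ln ?posrE ?ltr0n ?expn_gt0 // ler_nat.
have l2 := @ln2_ge_half R.
have h4 : A i j ^+ 2 * ((8 ^ k)%:R * 2^-1) <= A i j ^+ 2 * ln (msz k).+1%:R.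
  rewrite ler_wpM2l ?sqr_ge0 //; apply: le_trans h3; rewrite ler_wpM2l //.
lra.
Qed.

(** A gap of two levels puts the column outside the set that receives all heavy neighbours of the
    row's level. It also rules out the default level for the row. *)
Lemma remainder_entry i j : (lvl (lshift p i) + 2 <= lvl (rshift n j))%N ->
  A i j <= s * ((msz (lvl (lshift p i)))%:R ^+ 2)^-1.
Proof.
set x := lvl _; set y := lvl _ => xy.
have := lvl_le (rshift n j); rewrite -/y => yn.
have /lvl_in : (lvl (lshift p i) < n + p)%N by rewrite -/x; lia.
rewrite -/x => iI.
have /lvl_notin /= : (x.+1 < lvl (rshift n j))%N by rewrite -/y; lia.
rewrite !inE !negb_or -!andbA => /and3P[_ _ /existsPn/(_ (lshift p i))].
rewrite iI /= -leNgt /H block_mxEur => h.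
have m0 : 0 < (msz x)%:R :> R by rewrite ltr0n expn_gt0.
rewrite ler_pdivlMr ?exprn_gt0 // -ler_sqr ?nnegrE ?mulr_ge0 ?exprn_ge0 ?(ltW s0) //.
by rewrite exprMn -exprM -natrX.
Qed.

(** Level k has at most msz k vertices, each of weight 1 / msz k ^ 2, and msz k >= 2^(k+1). *)
Lemma sum_lvl_weights (I : finType) (f : I -> 'I_(n + p)) : injective f ->
  \sum_i ((msz (lvl (f i)))%:R ^+ 2)^-1 <= 1 :> R.
Proof.
move=> fI.
pose K := (n + p).+1.
pose g i : 'I_K := inord (lvl (f i)).
have gE i : g i = lvl (f i) :> nat by rewrite inordK // ltnS lvl_le.
rewrite (partition_big g xpredT) //=.
apply: (@le_trans _ _ (\sum_(k < K) 2^-1 ^+ k.+1)); last exact: sum_half_powers.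
apply: ler_sum => k _.
apply: (@le_trans _ _ (\sum_(i | g i == k) ((msz k)%:R ^+ 2)^-1)).
  by apply: ler_sum => i /eqP<-; rewrite gE.
have m0 : 0 < (msz k)%:R :> R by rewrite ltr0n expn_gt0.
rewrite sumr_const -[leLHS]mulr_natr ler_pdivrMl ?exprn_gt0 //.
have hc : (#|[pred i | g i == k]| <= msz k)%N.
  apply: leq_trans (card_lvl k); rewrite -(card_imset _ fI).
  apply/subset_leq_card/fintype.subsetP => _ /imsetP[i ik ->].
  by move: ik; rewrite !inE => /eqP<-; rewrite gE.
apply: (@le_trans _ _ (msz k)%:R); first by rewrite ler_nat.
rewrite exprVn ler_pdivlMr ?exprn_gt0 // expr2 ler_pM2l // -natrX ler_nat.
by rewrite leq_exp2l // ltn_expl.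
Qed.

(** The factor 50 secures B^2 >= s^2 + (128 s^2 + 2048 r^2), as the moment bound for a class
    requires. *)
Let B : R := 50 * (s + r).

(** The class is block diagonal with index t, the larger of the two levels. Its vertices have level
    at most t, so there are at most msz t = 2^(8^t) of them, and the exponent M = 2 * 8^t is twice
    the binary logarithm of that. *)
Lemma avg_opnorm_class (al be : nat) (C : 'M[R]_(n, p)) : (al + be <= 1)%N ->
  (forall i j, C i j = if (lvl (lshift p i) + be == lvl (rshift n j) + al)%N then A i j else 0) ->
  avg (fun b => opnorm (flip b C)) <= 16 * B.
Proof.
move=> ab CE.
pose K := (n + p).+2.
have B0 : 0 < B by rewrite mulr_gt0 // ltr_pwDl.
pose f i : 'I_K := inord (lvl (lshift p i) + be).
pose g j : 'I_K := inord (lvl (rshift n j) + al).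
have fE i : f i = (lvl (lshift p i) + be)%N :> nat.
  by rewrite inordK //; have := lvl_le (lshift p i); rewrite /K; lia.
have gE j : g j = (lvl (rshift n j) + al)%N :> nat.
  by rewrite inordK //; have := lvl_le (rshift n j); rewrite /K; lia.
have -> : 16 * B = 2 * (8 * B) by ring.
apply: (avg_opnorm_blockdiag (f := f) (g := g) (w := fun t => 2^-1 ^+ t.+1)
         (M := fun t => (2 ^ (3 * t).+1)%N)).
- by rewrite mulr_gt0.
- move=> i j; rewrite CE; case: ifP => [/eqP e _|_]; last by rewrite eqxx.
  by apply: val_inj; rewrite /= fE gE.
- by move=> t; rewrite expn_gt0.
- move=> t; set D := block f g t C; set M := (2 ^ _)%N.
  have M8 : M = (2 * 8 ^ t)%N by rewrite /M expnS expnM.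
  have DE i j : D i j = if (lvl (lshift p i) + be == t)%N && (lvl (rshift n j) + al == t)%N then A i j else 0.
    rewrite mxE CE -!(inj_eq val_inj) /= fE gE.
    by case: eqP => // ->; case: eqP => // ->; rewrite eqxx.
  have D0 i j : 0 <= D i j by rewrite DE; case: ifP.
  have DA i j : D i j ^+ 2 <= A i j ^+ 2.
    by rewrite DE; case: ifP => // _; rewrite expr0n /= sqr_ge0.
  have Dr i : \sum_j D i j ^+ 2 <= s ^+ 2 by apply: le_trans (Ar i); apply: ler_sum.
  have Dc j : \sum_i D i j ^+ 2 <= s ^+ 2 by apply: le_trans (Ac j); apply: ler_sum.
  have num_ge0 : 0 <= 128 * s ^+ 2 + 2048 * r ^+ 2.
    by have := sqr_ge0 s; have := sqr_ge0 r; lra.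
  have M0 : 0 < M%:R :> R by rewrite ltr0n expn_gt0.
  pose s2 := (128 * s ^+ 2 + 2048 * r ^+ 2) / M%:R.
  have s20 : 0 <= s2.
    exact: divr_ge0 num_ge0 (ltW M0).
  have De i j : D i j ^+ 2 <= s2.
    rewrite ler_pdivlMr // DE; case: ifP => [/andP[/eqP xt /eqP yt]|_]; last first.
      by rewrite expr0n /= mul0r.
    have es := entry_sqr_le i j; have r20 := sqr_ge0 r; have e0 := sqr_ge0 (A i j).
    (* For t >= 3 the row has level at least t - 1, so [entry_lvl] applies at k = t - 3; the
       constant is 2 * 8^3 * 2 = 2048. For t <= 2, M <= 128 and the squared entry is at most s^2. *)
    rewrite M8 natrM; case: (ltnP 2 t) => t2.
      have := @entry_lvl i j (lshift p i) (t - 3) (or_introl erefl).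
      have -> : ((t - 3).+1 < lvl (lshift p i))%N by move: xt ab t2; clear; lia.
      move=> /(_ isT) hz; have -> : (8 ^ t = 512 * 8 ^ (t - 3))%N.
        by move: (nat_of_ord t) t2 => t' t2; rewrite -{1}(subnK t2) expnD mulnC.
      rewrite natrM.
      apply: (@le_trans _ _ (1024 * (A i j ^+ 2 * (8 ^ (t - 3))%:R))).
        by rewrite le_eqVlt; apply/orP; left; apply/eqP; ring.
      have := sqr_ge0 s; move: hz; lra.
    have h64 : (8 ^ t)%:R <= 64 :> R by rewrite ler_nat (leq_pexp2l _ t2).
    apply: (@le_trans _ _ (s ^+ 2 * (2 * 64))).
      by apply: ler_pM; rewrite ?mulr_ge0 // ler_wpM2l.
    by move: r20; lra.
  have Bge : s ^+ 2 + M%:R * s2 <= B ^+ 2.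
    rewrite /s2 mulrCA mulfV ?gt_eqF // mulr1 /B.
    by have := ltW s0; move: r0; nra.
  have mom := avg_opnorm_moment D0 s20 Dr Dc De B0 (j := (3 * t)%N) (W := [set v | lvl v <= t]%N).
  apply: le_trans (mom _ Bge) _.
    move=> i j; rewrite DE !inE; case: ifP => [/andP[/eqP xt /eqP yt] _|]; last by rewrite eqxx.
    by move: xt yt; clear; move=> xt yt; apply/andP; split; lia.
  rewrite -/M.
  (* Passing from (2 B)^M to (8 B)^M leaves a factor 4^M, which covers the count 2^(8^t) and the
     weight 2^-(t+1). *)
  apply: (@le_trans _ _ (2 ^+ M * 2^-1 ^+ t.+1 * 2 ^+ M * (2 * B) ^+ M)); last first.
    rewrite (_ : 8 * B = 2 * 2 * (2 * B)); last by ring.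
    by rewrite [in leRHS]exprMn [in leRHS]exprMn le_eqVlt; apply/orP; left; apply/eqP; ring.
  apply: ler_wpM2r; first by apply/exprn_ge0/mulr_ge0/ltW/B0.
  apply: (@le_trans _ _ (msz t)%:R); first by rewrite ler_nat card_lvl.
  have Mt : (t.+1 <= M)%N by rewrite M8; have := ltn_expl t (isT : 1 < 8)%N; clear; lia.
  have -> : 2 ^+ M * 2^-1 ^+ t.+1 * 2 ^+ M = 2 ^+ (M - t.+1) * 2 ^+ M :> R.
    by rewrite -{1}(subnK Mt) exprD exprVn mulfK // expf_neq0 // pnatr_eq0.
  rewrite -exprD -natrX ler_nat leq_exp2l //; move: Mt; rewrite M8; clear; have := ltn_expl t (isT : 1 < 8)%N; lia.
- exact: sum_half_powers.
Qed.

Lemma remainder_entry_r i j : (lvl (rshift n j) + 2 <= lvl (lshift p i))%N ->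
  A i j <= s * ((msz (lvl (rshift n j)))%:R ^+ 2)^-1.
Proof.
set x := lvl _; set y := lvl _ => xy.
have := lvl_le (lshift p i); rewrite -/y => yn.
have /lvl_in : (lvl (rshift n j) < n + p)%N by rewrite -/x; lia.
rewrite -/x => iI.
have /lvl_notin /= : (x.+1 < lvl (lshift p i))%N by rewrite -/y; lia.
rewrite !inE !negb_or -!andbA => /and3P[_ _ /existsPn/(_ (rshift n j))].
rewrite iI /= -leNgt /H block_mxEdl mxE => h.
have m0 : 0 < (msz x)%:R :> R by rewrite ltr0n expn_gt0.
rewrite ler_pdivlMr ?exprn_gt0 // -ler_sqr ?nnegrE ?mulr_ge0 ?exprn_ge0 ?(ltW s0) //.
by rewrite exprMn -exprM -natrX.
Qed.

Lemma avg_opnorm_dimension_free : avg (fun b => opnorm (flip b A)) <= 50 ^+ 2 * (s + r).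
Proof.
pose C (al be : nat) : 'M[R]_(n, p) := \matrix_(i, j)
  (if (lvl (lshift p i) + be == lvl (rshift n j) + al)%N then A i j else 0).
pose Y : 'M[R]_(n, p) := \matrix_(i, j)
  (if (lvl (lshift p i) + 2 <= lvl (rshift n j))%N then A i j else 0).
pose Z : 'M[R]_(n, p) := \matrix_(i, j)
  (if (lvl (rshift n j) + 2 <= lvl (lshift p i))%N then A i j else 0).
(* The level difference is 0, 1, -1, at least 2 or at most -2. *)
have AE : A = C 0%N 0%N + C 0%N 1%N + C 1%N 0%N + Y + Z.
  apply/matrixP => i j; rewrite !mxE; move: (lvl _) (lvl _) => x y.
  case: eqP => e1; case: eqP => e2; case: eqP => e3; case: leqP => e4; case: leqP => e5;
    rewrite ?(addr0, add0r) //; lia.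
have hY : avg (fun b => opnorm (flip b Y)) <= 2 * s.
  apply: (avg_opnorm_flat_rows (w := fun i => ((msz (lvl (lshift p i)))%:R ^+ 2)^-1)) => //.
  - by move=> i j; rewrite mxE; case: ifP.
  - move=> i; apply: le_trans (Ar i); apply: ler_sum => j _.
    by rewrite mxE; case: ifP => // _; rewrite expr0n /= sqr_ge0.
  - move=> i j; rewrite mxE; case: ifP => [|_]; first exact: remainder_entry.
    by rewrite /= mulr_ge0 ?(ltW s0) // invr_ge0 exprn_ge0.
  - exact/sum_lvl_weights/lshift_inj.
(* Here the columns have the lower level and carry the weights, hence the transpose. *)
have hZ : avg (fun b => opnorm (flip b Z)) <= 2 * s.
  rewrite -avg_opnorm_flip_tr.
  apply: (avg_opnorm_flat_rows (w := fun j => ((msz (lvl (rshift n j)))%:R ^+ 2)^-1)) => //.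
  - by move=> i j; rewrite !mxE; case: ifP.
  - move=> j; apply: le_trans (Ac j); apply: ler_sum => i _.
    by rewrite !mxE; case: ifP => // _; rewrite expr0n /= sqr_ge0.
  - move=> i j; rewrite !mxE; case: ifP => [|_]; first exact: remainder_entry_r.
    by rewrite /= mulr_ge0 ?(ltW s0) // invr_ge0 exprn_ge0.
  - exact/sum_lvl_weights/rshift_inj.
have hC al be : (al + be <= 1)%N -> avg (fun b => opnorm (flip b (C al be))) <= 16 * B.
  by move=> ab; apply: (avg_opnorm_class ab) => i j; rewrite mxE.
apply: (@le_trans _ _ (avg (fun b => opnorm (flip b (C 0%N 0%N)) + opnorm (flip b (C 0%N 1%N))
    + opnorm (flip b (C 1%N 0%N)) + opnorm (flip b Y) + opnorm (flip b Z)))).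
  apply: ler_avg => b; rewrite {1}AE !flipD.
  by do 4 (apply: le_trans (opnormD _ _) _; rewrite lerD2r).
(* Three classes at 16 * 50 and two remainders at 2 add up to 2404 <= 50^2. *)
rewrite !avgD; have := hC 0%N 0%N isT; have := hC 0%N 1%N isT; have := hC 1%N 0%N isT.
rewrite /B; move: (avg _) (avg _) (avg _) (avg _) (avg _) hY hZ.
by have := ltW s0; have := r0; move=> ? ? *; lra.
Qed.

End DimensionFree.

(** Turns a statement about the m-th entry of a sorted list, counted from 0, into a count. Ranks of
    rows, singular values and order statistics are all handled through it. *)
Lemma sorted_nth_count {T : Type} (x0 : T) (r : rel T) (P : pred T) (t : seq T) m :
  transitive r -> sorted r t -> (forall x y, r x y -> P y -> P x) ->
  (m < count P t)%N = (m < size t)%N && P (nth x0 t m).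
Proof.
move=> rtr + mono; elim: t m => [|x t IH] m //= xt.
have [Px|nPx] := boolP (P x).
  case: m => [|m] /=; first by rewrite Px.
  by rewrite add1n !ltnS IH // (path_sorted xt).
have c0 : count P t = 0%N.
  have h : all (predC P) t.
    apply: sub_all (order_path_min rtr xt) => y xy.
    by apply: contra nPx; exact: mono.
  by apply/eqP; rewrite -leqn0 leqNgt -has_count -all_predC.
rewrite c0 add0n ltn0; case: m => [|m] /=; first by rewrite (negPf nPx).
by rewrite ltnS -IH ?c0 // (path_sorted xt).
Qed.

(** * The two bounds for a fixed matrix *)

Section SignAverageBounds.
Context {R : realType} {n p : nat} (A : 'M[R]_(n, p)).

Let A' := map_mx Num.norm A.
Let s := norm_2inf (symmx A).

Let A'_row i : \sum_j A' i j ^+ 2 <= s ^+ 2.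
Proof.
have : l2norm (row (lshift p i) (symmx A)) <= s by exact: le_bigmax.
rewrite -ler_sqr ?nnegrE ?l2norm_ge0 //; last first.
  by apply: le_trans (l2norm_ge0 _) (le_bigmax _ _ (lshift p i)).
apply: le_trans; rewrite l2norm_sqr_rV big_split_ord /= -[leLHS]add0r.
apply: lerD; first by apply: sumr_ge0 => k _; exact: sqr_ge0.
by apply: ler_sum => j _; rewrite !mxE (unsplitK (inl i)) mxE (unsplitK (inr j)) real_normK ?num_real.
Qed.

Let A'_col j : \sum_i A' i j ^+ 2 <= s ^+ 2.
Proof.
have : l2norm (row (rshift n j) (symmx A)) <= s by exact: le_bigmax.
rewrite -ler_sqr ?nnegrE ?l2norm_ge0 //; last first.
  by apply: le_trans (l2norm_ge0 _) (le_bigmax _ _ (rshift n j)).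
apply: le_trans; rewrite l2norm_sqr_rV big_split_ord /= -[leLHS]addr0.
apply: lerD; last by apply: sumr_ge0 => k _; exact: sqr_ge0.
by apply: ler_sum => i _; rewrite mxE [in leRHS]mxE block_mxEdl mxE real_normK ?num_real.
Qed.

Let s_ge0 : 0 <= s.
Proof. exact: bigmax_ge_id. Qed.

Let A'_ge0 i j : 0 <= A' i j.
Proof. by rewrite mxE. Qed.

Lemma norm_2inf_symmx_eq0 : norm_2inf (symmx A) = 0 -> A = 0.
Proof.
rewrite -/s => se; apply/matrixP => i j; rewrite mxE.
have := A'_row i; rewrite se expr0n /= => h.
have : A' i j ^+ 2 <= 0.
  apply: le_trans h; rewrite (bigD1 j) //= lerDl sumr_ge0 // => k _; exact: sqr_ge0.
rewrite le_eqVlt ltNge sqr_ge0 orbF sqrf_eq0 mxE normr_eq0 => /eqP //.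
Qed.

(** Both bounds use s > 0 as the scale of truncation or of levels; s = 0 forces A = 0. *)
Let avg_eq0 : s = 0 -> avg (fun b => opnorm (flip b A)) = 0.
Proof.
move=> /norm_2inf_symmx_eq0->; rewrite -[RHS](@avg_cst R n p); congr avg.
apply/funext => b; rewrite flip0; apply/eqP; rewrite eq_le opnorm_ge0 andbT.
by apply: le_trans (opnorm_fro _) _; rewrite l2norm0.
Qed.

Theorem avg_opnorm_rho_2 : (4 <= n + p)%N ->
  avg (fun b => opnorm (flip b A)) <= 25 * rho_2 A.
Proof.
move=> N4; have ln1 : 1 <= ln (n + p)%:R :> R.
  have := @ln2_ge_half R; have : ln (2 ^ 2)%:R <= ln (n + p)%:R :> R.
    by rewrite ler_ln ?posrE ?ltr0n ?ler_nat // (leq_trans _ N4).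
  by rewrite ln_natX2; lra.
have [se|sn] := eqVneq s 0; first by rewrite avg_eq0 // /rho_2 -/s se mul0r mulr0.
have s0 : 0 < s by rewrite lt_def sn s_ge0.
rewrite avg_flip_abs; apply: avg_opnorm_seginer => //.
  have : 1 `^ 4^-1 <= ln (n + p)%:R `^ 4^-1 :> R.
    by apply: ge0_ler_powR; rewrite ?nnegrE ?invr_ge0 // (le_trans _ ln1).
  by rewrite powR1.
rewrite -powR_mulrn ?powR_ge0 // -powRrM mulVf // powRr1 //.
by rewrite (le_trans _ ln1).
Qed.

Let bv v := linfnorm (row v (symmx A)).

Let le_bv v u : `|symmx A v u| <= bv v.
Proof.
apply: (@le_trans _ _ (\big[Num.max/0]_u `|row v (symmx A) 0 u|)).
  by have := le_bigmax 0 (fun u => `|row v (symmx A) 0 u|) u; rewrite /= [row _ _ _ _]mxE.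
exact: (le_bigmax 0 (fun i => \big[Num.max/0]_u `|row v (symmx A) i u|)).
Qed.

(** If more than m rows exceeded the bound, so would the row of rank m + 1, against the term i = m +
    1 of [rho_inf]. For m >= n + p there is no such term, but also no more than m vertices. *)
Let card_bv m : (0 < m)%N ->
  (#|[set v | (rho_inf A < bv v * Num.sqrt (ln m.+1%:R))%R]| <= m)%N.
Proof.
move=> m0; have [Nm|mN] := leqP (n + p) m.
  by apply: leq_trans (max_card _) _; rewrite card_ord.
rewrite leqNgt; apply/negP => h.
pose L := sort >=%R [seq linfnorm (row v (symmx A)) | v <- enum 'I_(n + p)].
pose P (x : R) := rho_inf A < x * Num.sqrt (ln m.+1%:R).
have mono x y : y <= x -> P y -> P x.
  by move=> xy /lt_le_trans; apply; rewrite ler_wpM2r ?sqrtr_ge0.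
have cP : count P L = #|[set v | (rho_inf A < bv v * Num.sqrt (ln m.+1%:R))%R]|.
  rewrite count_sort count_map -sum1_count -sum1_card big_enum_cond /=.
  by apply: eq_bigl => v; rewrite inE.
have := @sorted_nth_count _ 0 _ P L m (rev_trans le_trans) (sort_sorted (fun x y => le_total y x) _) mono.
rewrite cP h => /esym/andP[_]; apply/negP; rewrite -leNgt.
apply: (le_bigmax_seq 0 m.+1 xpredT
  (fun i => norm_inf_rank (symmx A) i * Num.sqrt (ln i%:R))) => //.
by rewrite mem_index_iota.
Qed.

Let rho_inf_ge0 : 0 <= rho_inf A.
Proof. exact: bigmax_ge_id. Qed.

Theorem avg_opnorm_rho_inf :
  avg (fun b => opnorm (flip b A)) <= 50 ^+ 2 * (norm_2inf (symmx A) + rho_inf A).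
Proof.
have [se|sn] := eqVneq s 0.
  by rewrite avg_eq0 // mulr_ge0 ?exprn_ge0 ?addr_ge0.
have s0 : 0 < s by rewrite lt_def sn s_ge0.
rewrite avg_flip_abs; apply: (avg_opnorm_dimension_free (bv := bv)) => //.
  by move=> i j; have := le_bv (lshift p i) (rshift n j); rewrite block_mxEur [A' _ _]mxE.
by move=> i j; have := le_bv (rshift n j) (lshift p i); rewrite block_mxEdl [A^T _ _]mxE [A' _ _]mxE.
Qed.

End SignAverageBounds.

(** * Spectral theorem for real symmetric matrices *)

Section RealSpectral.
Import mathcomp.real_closed.complex.
Context {R : rcfType}.

(* The eigenvalue comes from the algebraically closed field R[i], where a
   matrix equal to its adjoint has only real eigenvalues. *)
Lemma symmetric_eigenvalue n (A : 'M[R]_n.+1) : A^T = A ->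
  exists l, eigenvalue A l.
Proof.
move=> As.
pose C : numClosedFieldType := complex.complex R.
pose f : {rmorphism R -> C} := complex.real_complex R.
have /closed_rootP[l] : size (char_poly (map_mx f A)) != 1%N.
  by rewrite size_char_poly.
rewrite -eigenvalue_root_char => evl; have /eigenvalueP[v vA v0] := evl.
have fc x : (f x)^* = f x.
  by apply/CrealP/complex.complex_realP; exists x.
pose vc := map_mx Num.conj v.
have vcA : vc *m map_mx f A = l^* *: vc.
  rewrite /vc -map_mxZ -vA map_mxM; congr (_ *m _).
  by apply/matrixP => i j; rewrite !mxE [RHS]fc.
pose N : C := \sum_i v 0 i * vc 0 i.
have N0 : N != 0.
  apply: contraNneq v0 => /eqP; rewrite psumr_eq0 => [/allP h|i _]; last first.
    by rewrite mxE mul_conjC_ge0.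
  apply/eqP/rowP => i; have := h i (mem_index_enum _).
  by rewrite !mxE /= mul_conjC_eq0 => /eqP.
have eN : (v *m vc^T) 0 0 = N.
  by rewrite mxE; apply: eq_bigr => i _; rewrite [vc^T _ _]mxE.
have lN : l * N = l^* * N.
  transitivity ((v *m map_mx f A *m vc^T) 0 0).
    by rewrite vA -scalemxAl mxE eN.
  rewrite -mulmxA -{1}As -map_trmx -trmx_mul vcA.
  by rewrite linearZ -scalemxAr mxE eN.
have lr : l \is Num.real by apply/CrealP/(mulIf N0).
have /complex.complex_realP[x lx] := lr; exists x.
by move: evl; rewrite lx -[complex.real_complex_def _ _]/(f x) eigenvalue_map.
Qed.

Lemma symmetric_unit_eigenvector n (A : 'M[R]_n.+1) : A^T = A ->
  exists l (v : 'cV[R]_n.+1), A *m v = l *: v /\ v^T *m v = 1%:M.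
Proof.
move=> As; have [l /eigenvalueP[w wA w0]] := symmetric_eigenvalue As.
exists l; pose N := \sum_i w 0 i ^+ 2.
have N0 : 0 < N.
  rewrite lt_def sumr_ge0 ?andbT => [|i _]; last exact: sqr_ge0.
  apply: contraNneq w0 => /eqP; rewrite psumr_eq0 => [/allP h|i _]; last exact: sqr_ge0.
  apply/eqP/rowP => i; have := h i (mem_index_enum _).
  by rewrite mxE sqrf_eq0 => /eqP.
exists ((Num.sqrt N)^-1 *: w^T); split.
  by rewrite -scalemxAr -{1}As -trmx_mul wA linearZ /= scalerA mulrC -scalerA.
rewrite (_ : _^T = (Num.sqrt N)^-1 *: w); last by apply/matrixP => i j; rewrite !mxE.
rewrite -scalemxAl -scalemxAr scalerA -invfM -expr2 sqr_sqrtr ?(ltW N0) //.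
apply/matrixP => i j; rewrite !ord1 !mxE eqxx mulr1n.
rewrite (_ : \sum_k _ = N) ?mulVf ?gt_eqF //.
by apply: eq_bigr => k _; rewrite mxE expr2.
Qed.

(* The Householder reflection that exchanges v and the first basis vector. *)
Lemma householder n (v : 'cV[R]_n.+1) : v^T *m v = 1%:M ->
  exists H : 'M[R]_n.+1, [/\ H^T = H, H *m H = 1%:M & H *m v = delta_mx 0 0].
Proof.
move=> v1; pose e : 'cV[R]_n.+1 := delta_mx 0 0.
have [->|ve] := eqVneq v e.
  by exists 1%:M; rewrite trmx1 mul1mx; split=> //; rewrite mul1mx.
pose u := v - e; pose N := (u^T *m u) 0 0.
have NE : u^T *m u = N%:M by rewrite [LHS]mx11_scalar.
have N0 : N != 0.
  apply: contraNneq ve; rewrite /N mxE => /eqP.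
  under eq_bigr do rewrite mxE.
  rewrite psumr_eq0 => [/allP h|i _]; last by rewrite -expr2 sqr_ge0.
  rewrite -subr_eq0; apply/eqP/colP => i; have := h i (mem_index_enum _).
  by rewrite [in RHS]mxE -expr2 sqrf_eq0 => /eqP.
have e1 : e^T *m e = 1%:M.
  by rewrite trmx_delta mul_delta_mx; apply/matrixP => i j; rewrite !ord1 !mxE.
have ev : e^T *m v = v^T *m e.
  by rewrite -[LHS]trmxK trmx_mul trmxK; apply/matrixP => i j; rewrite !ord1 mxE.
have uv : (u^T *m v) *+ 2 = N%:M.
  rewrite -NE /u linearB /= !mulmxBl !mulmxBr v1 e1 ev mulr2n.
  by rewrite opprB.
exists (1%:M - (2 / N) *: (u *m u^T)); split.
- by rewrite linearB /= trmx1 linearZ /= trmx_mul trmxK.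
- set W := u *m u^T.
  have WW : W *m W = N *: W.
    by rewrite /W -mulmxA (mulmxA u^T) NE mul_scalar_mx scalemxAr.
  rewrite mulmxBl mul1mx mulmxBr mulmx1 -scalemxAl -scalemxAr WW.
  by apply/matrixP => i j; move: W {WW} => W; rewrite !mxE; field.
rewrite mulmxBl mul1mx -scalemxAl -mulmxA.
have -> : u^T *m v = (N / 2)%:M.
  have /(congr1 (fun x => 2^-1 *: x)) /= := uv.
  rewrite -[(_ *m _) *+ 2]scaler_nat scalerA mulVf ?pnatr_eq0 // scale1r => ->.
  by rewrite scale_scalar_mx mulrC.
rewrite mul_mx_scalar scalerA (_ : 2 / N * (N / 2) = 1) ?scale1r; last by field.
by rewrite /u opprB addrC subrK.
Qed.

Lemma symmetric_first_column n (B : 'M[R]_(1 + n)) l : B^T = B ->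
  (forall i, B i (lshift n 0) = l * (i == lshift n 0)%:R) ->
  B = block_mx l%:M 0 0 (drsubmx B).
Proof.
move=> Bs Bcol; rewrite -[LHS]submxK; congr block_mx; apply/matrixP => i j.
- by rewrite !ord1 !mxE Bcol eqxx mulr1.
- by rewrite -Bs !mxE !ord1 Bcol eq_rlshift mulr0.
- by rewrite !mxE !ord1 Bcol eq_rlshift mulr0.
Qed.

(** Deflation: a reflection moves a unit eigenvector to the first basis vector, conjugation splits
    off its eigenvalue, and the induction applies to the lower right block. *)
Theorem symmetric_spectral n (A : 'M[R]_n) : A^T = A ->
  exists (Q : 'M[R]_n) (d : 'rV[R]_n),
    Q^T *m Q = 1%:M /\ A = Q *m diag_mx d *m Q^T.
Proof.
elim: n A => [|n IH] A As.
  by exists 1%:M, 0; split; apply/matrixP => -[].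
have [l [v [vA v1]]] := symmetric_unit_eigenvector As.
have [H [Hs HH Hv]] := householder v1.
have He : H *m delta_mx 0 0 = v by rewrite -Hv mulmxA HH mul1mx.
pose B : 'M[R]_(1 + n) := H *m A *m H.
have Bs : B^T = B by rewrite /B !trmx_mul Hs As mulmxA.
have Be : H *m A *m H *m (delta_mx 0 0 : 'cV_n.+1) = l *: delta_mx 0 0.
  by rewrite -mulmxA He -mulmxA vA -scalemxAr Hv.
have BE : B = block_mx l%:M 0 0 (drsubmx B).
  apply: symmetric_first_column Bs _ => i.
  have l0 : lshift n (0 : 'I_1) = 0 :> 'I_n.+1 by exact/ord_inj.
  have /matrixP/(_ i 0) := Be; rewrite -colE mxE [X in _ = X -> _]mxE -l0 => ->.
  by rewrite mxE eqxx andbT.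
have AB : A = H *m B *m H by rewrite /B !mulmxA HH mul1mx -mulmxA HH mulmx1.
clearbody B.
have [|Q [d [QQ dE]]] := IH (drsubmx B).
  by rewrite trmx_drsub Bs.
pose K : 'M[R]_(1 + n) := block_mx 1%:M 0 0 Q.
have KK : K^T *m K = 1%:M.
  rewrite tr_block_mx mulmx_block !trmx0 trmx1 !mul0mx !mulmx0 !addr0 !add0r mul1mx QQ.
  by rewrite -scalar_mx_block.
exists (H *m K), (row_mx l%:M d : 'rV_(1 + n)); split.
  by rewrite trmx_mul Hs mulmxA -(mulmxA K^T) HH mulmx1 KK.
rewrite AB.
suff KB : B = K *m diag_mx (row_mx l%:M d) *m K^T.
  by rewrite trmx_mul Hs {1}KB !mulmxA.
rewrite [LHS]BE dE diag_mx_row /K tr_block_mx !mulmx_block !trmx0 trmx1.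
rewrite !(mul0mx, mulmx0, addr0, add0r, mul1mx, mulmx1).
by congr block_mx; apply/matrixP => i j; rewrite !ord1 !mxE eqxx.
Qed.

End RealSpectral.

(** * Singular values and approximation by matrices of low rank *)

Section SingularValueTheory.
Context {R : realType}.

Section Diagonalized.
Context {n : nat} (A Q : 'M[R]_n) (d : 'rV[R]_n).
Hypothesis QQ : Q^T *m Q = 1%:M.
Hypothesis AE : A = Q *m diag_mx d *m Q^T.

Lemma char_poly_diagonalized : char_poly A = \prod_i ('X - (d 0 i)%:P).
Proof.
pose q := map_mx (@polyC R) Q.
have QQ' : Q *m Q^T = 1%:M by apply: mulmx1C.
have qq : q *m q^T = 1%:M by rewrite /q map_trmx -map_mxM QQ' map_mx1.
have e : char_poly_mx A = q *m char_poly_mx (diag_mx d) *m q^T.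
  rewrite /char_poly_mx mulmxBr mulmxBl mul_mx_scalar -scalemxAl qq scalemx1.
  by rewrite AE !map_mxM /q map_trmx.
rewrite /char_poly e !det_mulmx mulrC mulrA -det_mulmx (mulmx1C qq) det1 mul1r.
rewrite -/(char_poly _) char_poly_trig ?diag_mx_is_trig //.
by apply: eq_bigr => i _; rewrite mxE eqxx.
Qed.

(** The roots of the characteristic polynomial, repeated by multiplicity, are a permutation of d;
    counts are what [sorted_nth_count] can use. *)
Lemma count_eigenvalue_seq (P : pred R) :
  count P (eigenvalue_seq A) = #|[set i | P (d 0 i)]|.
Proof.
have mupE x : mup x (char_poly A) = count (pred1 x) [seq d 0 i | i <- enum 'I_n].
  rewrite char_poly_diagonalized -big_enum /=.
  elim: (enum 'I_n) => [|i s IH] /=.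
    by rewrite big_nil mupNroot // root1.
  rewrite big_cons mupM ?polyXsubC_eq0 //; last first.
    by apply: monic_neq0; apply: monic_prod_XsubC.
  by rewrite IH -['X - _]expr1 mup_XsubCX; case: eqP.
have chi0 : char_poly A != 0 by rewrite monic_neq0 ?char_poly_monic.
have perm : perm_eq (eigenvalue_seq A) [seq d 0 i | i <- enum 'I_n].
  apply/allP => x _ /=; rewrite -mupE /eigenvalue_seq count_sort; apply/eqP.
  set s := polyrcf.rootsR _.
  have us : uniq s by exact: polyrcf.uniq_roots.
  rewrite count_flatten sumnE !big_map.
  under eq_bigr do rewrite count_nseq /=.
  have [xs|xs] := boolP (x \in s).
    rewrite (bigD1_seq x) //= eqxx mul1n big1 ?addn0 // => y /negPf yx.
    by rewrite yx.
  rewrite big_seq big1 => [|y ys]; last first.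
    by case: eqP => // yx; rewrite -yx ys in xs.
  apply/esym/mupNroot; move: xs; rewrite -(polyrcf.roots_on_rootsR chi0).
  by rewrite in_itv.
rewrite (permP perm) count_map -sum1_count -sum1_card big_enum_cond /=.
by apply: eq_bigl => i; rewrite inE.
Qed.

Lemma size_eigenvalue_seq : size (eigenvalue_seq A) = n.
Proof.
rewrite -[LHS](count_predT) count_eigenvalue_seq -[RHS](card_ord n).
by apply: eq_card => i; rewrite !inE.
Qed.

Lemma l2norm_orthogonal (v : 'cV[R]_n) : l2norm (Q^T *m v) = l2norm v.
Proof.
apply/eqP; rewrite -(@eqrXn2 _ 2) ?l2norm_ge0 // l2norm_sqr_mulmx trmxK mulmxA.
by rewrite (mulmx1C QQ) mul1mx l2norm_sqr_cV; apply/eqP/eq_bigr => i _; rewrite expr2.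
Qed.

Lemma quadratic_form_diagonalized p (X : 'M[R]_(n, p)) (v : 'cV_n) :
  X *m X^T = A ->
  l2norm (X^T *m v) ^+ 2 = \sum_i d 0 i * (Q^T *m v) i 0 ^+ 2.
Proof.
move=> XA; rewrite l2norm_sqr_mulmx trmxK mulmxA XA.
have : (v^T *m (A *m v)) 0 0 = ((Q^T *m v)^T *m (diag_mx d *m (Q^T *m v))) 0 0.
  by rewrite AE trmx_mul trmxK !mulmxA.
rewrite mxE [in X in _ = X]mxE => e.
transitivity (\sum_j v^T 0 j * (A *m v) j 0).
  by apply: eq_bigr => i _; rewrite [v^T _ _]mxE.
rewrite e; apply: eq_bigr => i _; rewrite [_^T _ _]mxE mul_diag_mx.
by rewrite [X in _ * X]mxE; ring.
Qed.

End Diagonalized.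

Lemma sorted_eigenvalue_seq n (A : 'M[R]_n) : sorted >=%R (eigenvalue_seq A).
Proof. by apply: sort_sorted => x y; exact: le_total. Qed.

Lemma mulmx_trC_sym n p (X : 'M[R]_(n, p)) : (X *m X^T)^T = X *m X^T.
Proof. by rewrite trmx_mul trmxK. Qed.

(** Dimension count: with more than k such eigenvalues, their eigenvectors would span a nonzero u
    orthogonal to the columns of U. There X^T u = (X - U V)^T u has norm at most c |u|, while the
    quadratic form exceeds c^2 |u|^2. *)
Lemma card_eigenvalue_gt n p k (X : 'M[R]_(n, p)) (Q : 'M[R]_n) (d : 'rV[R]_n)
    (U : 'M[R]_(n, k)) (V : 'M[R]_(k, p)) :
  Q^T *m Q = 1%:M -> X *m X^T = Q *m diag_mx d *m Q^T ->
  (#|[set i | (opnorm (X - U *m V) ^+ 2 < d 0 i)%R]| <= k)%N.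
Proof.
move=> QQ XE; set c := opnorm _; set I := [set i | _].
rewrite leqNgt; apply/negP => kI.
pose E : 'M[R]_(#|I|, n) := \matrix_(t, j) (enum_val t == j)%:R.
pose B := E *m (Q^T *m U).
(* B has #|I| > k rows and k columns, so its left kernel supplies the coordinates w of u. *)
have : kermx B != 0.
  by rewrite kermx_eq0; apply: contraTN kI => /eqP rB; rewrite -leqNgt -rB rank_leq_col.
move=> /rowV0Pn[w /sub_kermxP wB w0].
pose a : 'cV[R]_n := (w *m E)^T; pose u := Q *m a.
have aE t : a (enum_val t) 0 = w 0 t.
  rewrite !mxE (bigD1 t) //= mxE eqxx mulr1 big1 ?addr0 // => s st.
  by rewrite mxE (inj_eq enum_val_inj) (negPf st) mulr0.
have aI i : i \notin I -> a i 0 = 0.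
  move=> iI; rewrite !mxE big1 // => t _; rewrite mxE.
  by case: eqP => [ti|_]; [rewrite -ti enum_valP in iI|rewrite mulr0].
have Qu : Q^T *m u = a by rewrite mulmxA QQ mul1mx.
have Uu : U^T *m u = 0.
  have -> : U^T *m u = (w *m B)^T by rewrite /u /a /B !trmx_mul !trmxK !mulmxA.
  by rewrite wB trmx0.
have Xu : X^T *m u = (X - U *m V)^T *m u.
  by rewrite linearB /= mulmxBl trmx_mul -mulmxA Uu mulmx0 subr0.
have le : l2norm (X^T *m u) ^+ 2 <= c ^+ 2 * \sum_i a i 0 ^+ 2.
  rewrite Xu -l2norm_sqr_cV -Qu l2norm_orthogonal // -exprMn.
  apply: lerXn2r; rewrite ?nnegrE ?mulr_ge0 ?l2norm_ge0 ?opnorm_ge0 //.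
  by apply: le_trans (l2norm_mulmx _ _) _; rewrite opnorm_tr.
have [t wt] : exists t, w 0 t != 0.
  by apply/existsP; apply: contraNT w0 => /existsPn h; apply/eqP/rowP => t;
     rewrite mxE; apply/eqP; rewrite -[_ == _]negbK h.
have : 0 < \sum_i (d 0 i - c ^+ 2) * a i 0 ^+ 2.
  have nn i : 0 <= (d 0 i - c ^+ 2) * a i 0 ^+ 2.
    have [iI|/aI->] := boolP (i \in I); last by rewrite expr0n mulr0.
    by rewrite mulr_ge0 ?sqr_ge0 // subr_ge0 ltW //; move: iI; rewrite inE.
  rewrite (bigD1 (enum_val t)) //=; apply: ltr_pwDl; last by apply: sumr_ge0.
  rewrite aE pmulr_rgt0 ?exprn_even_gt0 // subr_gt0.
  by have := enum_valP t; rewrite inE.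
under eq_bigr do rewrite mulrBl.
rewrite sumrB -mulr_sumr subr_gt0 -{2}Qu -(quadratic_form_diagonalized XE u erefl).
by rewrite ltNge le.
Qed.

Lemma singular_values_size n p (X : 'M[R]_(n, p)) :
  size (singular_values X) = minn n p.
Proof.
have [Q [d [QQ AE]]] := symmetric_spectral (mulmx_trC_sym X).
rewrite size_map size_take (size_eigenvalue_seq QQ AE).
by case: ltnP => //; lia.
Qed.

Lemma nth_singular_values n p (X : 'M[R]_(n, p)) j : (j < minn n p)%N ->
  nth 0 (singular_values X) j = Num.sqrt (nth 0 (eigenvalue_seq (X *m X^T)) j).
Proof.
move=> jm; rewrite (nth_map 0) ?nth_take //.
by have := singular_values_size X; rewrite size_map => ->.
Qed.

Lemma singular_values_ge0 n p (X : 'M[R]_(n, p)) j : 0 <= nth 0 (singular_values X) j.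
Proof.
have [jm|mj] := ltnP j (minn n p); first by rewrite nth_singular_values ?sqrtr_ge0.
by rewrite nth_default ?singular_values_size.
Qed.

Lemma sing_val_anti n p (X : 'M[R]_(n, p)) i j : (i <= j)%N ->
  (sing_val X j <= sing_val X i)%E.
Proof.
case: i => [|i]; first by rewrite leey.
case: j => [//|j] ij; rewrite /sing_val lee_fin.
have [jm|mj] := ltnP j (minn n p); last first.
  by rewrite (nth_default _ (_ : size _ <= j)%N) ?singular_values_size ?singular_values_ge0.
have im : (i < minn n p)%N by exact: leq_ltn_trans jm.
rewrite !nth_singular_values //.
have [Q [d [QQ AE]]] := symmetric_spectral (mulmx_trC_sym X).
have jn : (j < n)%N by apply: leq_trans jm (geq_minl _ _).
apply: ler_wsqrtr; have := sorted_leq_nth (rev_trans le_trans) (@lexx _ _) 0 (sorted_eigenvalue_seq (X *m X^T)).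
by apply; rewrite ?inE ?(size_eigenvalue_seq QQ AE) // (leq_ltn_trans _ jn).
Qed.

(** The easy half of the Eckart-Young theorem. With U V = S and X = S + N it is the instance of
    Weyl's inequality needed for FlipPA. *)
Lemma sing_val_le_opnorm n p k (X : 'M[R]_(n, p)) (U : 'M[R]_(n, k)) (V : 'M[R]_(k, p)) :
  (sing_val X k.+1 <= (opnorm (X - U *m V))%:E)%E.
Proof.
rewrite /sing_val lee_fin; set c := opnorm _.
have c0 : 0 <= c by exact: opnorm_ge0.
have [km|mk] := ltnP k (minn n p); last by rewrite nth_default ?singular_values_size.
rewrite nth_singular_values // leNgt; apply/negP => lt.
have [Q [d [QQ AE]]] := symmetric_spectral (mulmx_trC_sym X).
have := card_eigenvalue_gt U V QQ AE; rewrite -/c.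
rewrite -(count_eigenvalue_seq QQ AE (fun x => c ^+ 2 < x)) leqNgt => /negP; apply.
rewrite (sorted_nth_count 0 _ (rev_trans le_trans) (sorted_eigenvalue_seq _)); last first.
  by move=> x y xy /lt_le_trans; apply.
rewrite (size_eigenvalue_seq QQ AE) (leq_trans km (geq_minl _ _)) /=.
rewrite ltNge; apply: contraTN lt => le; rewrite -leNgt.
by rewrite -[leRHS]ger0_norm // -sqrtr_sqr ler_wsqrtr.
Qed.

Lemma factor_of_rank n p j (W : 'M[R]_(n, p)) : (\rank W <= j)%N ->
  exists (U : 'M[R]_(n, j)) (V : 'M[R]_(j, p)), W = U *m V.
Proof.
move=> rj; exists (col_base W *m pid_mx (\rank W)), (pid_mx (\rank W) *m row_base W).
rewrite mulmxA -(mulmxA (col_base W)) mul_pid_mx minnn (minn_idPr rj) pid_mx_1 mulmx1.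
by rewrite mulmx_base.
Qed.

(** The other half of Eckart-Young: W projects X on the eigenvectors of X X^T with eigenvalue at
    least c^2. *)
Lemma low_rank_approximation n p j (X : 'M[R]_(n, p)) c :
  (sing_val X j.+1 < c%:E)%E ->
  exists (U : 'M[R]_(n, j)) (V : 'M[R]_(j, p)), opnorm (X - U *m V) < c.
Proof.
rewrite /sing_val lte_fin => Xc.
have c0 : 0 < c by apply: le_lt_trans Xc; exact: singular_values_ge0.
have [Q [d [QQ AE]]] := symmetric_spectral (mulmx_trC_sym X).
have QQ' : Q *m Q^T = 1%:M := mulmx1C QQ.
pose J := [set i | c ^+ 2 <= d 0 i].
have Jj : (#|J| <= j)%N.
  (* Below min(n, p) the hypothesis counts J. For j >= n the number of indices does; for j >= p, J
     holds only positive eigenvalues, at most p by [card_eigenvalue_gt] with the factorization X = X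
     1. *)
  have [jm|mj] := ltnP j (minn n p).
    rewrite -(count_eigenvalue_seq QQ AE (fun x => c ^+ 2 <= x)) leqNgt.
    rewrite (sorted_nth_count 0 _ (rev_trans le_trans) (sorted_eigenvalue_seq _)); last first.
      by move=> x y xy h; exact: le_trans xy.
    rewrite negb_and -ltNge; apply/orP; right.
    rewrite ltNge; apply: contraTN Xc => le; rewrite -leNgt nth_singular_values //.
    by rewrite -[leLHS]gtr0_norm // -sqrtr_sqr ler_wsqrtr.
  move: mj; rewrite geq_min => /orP[nj|pj].
    by apply: leq_trans (max_card _) _; rewrite card_ord.
  apply: leq_trans pj; have := card_eigenvalue_gt X 1%:M QQ AE.
  rewrite mulmx1 subrr; apply: leq_trans; apply/subset_leq_card/fintype.subsetP => i.
  rewrite !inE; apply: lt_le_trans; apply: le_lt_trans (_ : 0 ^+ 2 < _).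
    by apply: lerXn2r; rewrite ?nnegrE ?opnorm_ge0 // (le_trans (opnorm_fro _)) // l2norm0.
  by rewrite expr0n exprn_gt0.
pose D : 'rV[R]_n := \row_i (i \in J)%:R.
pose W := Q *m diag_mx D *m Q^T *m X.
have rW : (\rank W <= j)%N.
  apply: leq_trans (mxrankM_maxl _ _) _; apply: leq_trans (mxrankM_maxl _ _) _.
  apply: leq_trans (mxrankM_maxr _ _) _; apply: leq_trans Jj.
  have -> : diag_mx D = \sum_(i in J) (delta_mx i 0 : 'cV_n) *m (delta_mx 0 i : 'rV_n).
    apply/matrixP => i k; rewrite summxE !mxE.
    under eq_bigr do rewrite mul_delta_mx mxE.
    have [iJ|iJ] := boolP (i \in J).
      rewrite (bigD1 i) //= eqxx /= big1 ?addr0 => [|t /andP[_ ti]].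
        by rewrite eq_sym; case: eqP.
      by rewrite eq_sym (negPf ti).
    rewrite mul0rn big1 // => t tJ; case: eqP => // it.
    by rewrite it tJ in iJ.
  rewrite -sum1_card; elim/big_ind2: _ => [|A1 a1 A2 a2 h1 h2|i _].
  - by rewrite mxrank0.
  - by apply: leq_trans (mxrank_add _ _) (leq_add h1 h2).
  - by apply: leq_trans (mxrankM_maxl _ _) (rank_leq_col _).
have [U [V WE]] := factor_of_rank rW; exists U, V; rewrite -WE.
(* The largest eigenvalue left out: a maximum over a finite set keeps the inequality with c^2
   strict. *)
pose m := \big[Num.max/0]_(i | i \notin J) d 0 i.
have m0 : 0 <= m by exact: bigmax_ge_id.
have mc : m < c ^+ 2.
  apply: bigmax_lt => [|i]; first by rewrite exprn_gt0.
  by rewrite inE ltNge.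
apply: le_lt_trans (_ : Num.sqrt m < c); last first.
  by rewrite -[ltRHS]gtr0_norm // -sqrtr_sqr ltr_sqrt // exprn_gt0.
rewrite -opnorm_tr; apply: opnorm_le => [|v v1]; first exact: sqrtr_ge0.
rewrite -ler_sqr ?nnegrE ?l2norm_ge0 ?sqrtr_ge0 // [leRHS]sqr_sqrtr //.
pose P := Q *m diag_mx D *m Q^T.
have -> : (X - W)^T *m v = X^T *m ((1%:M - P) *m v).
  have Ps : P^T = P by rewrite /P !trmx_mul trmxK tr_diag_mx mulmxA.
  by rewrite /W -/P linearB /= trmx_mul Ps !mulmxBl mul1mx mulmxBr -[X^T *m P *m v]mulmxA.
rewrite (quadratic_form_diagonalized AE _ erefl).
have -> : Q^T *m ((1%:M - P) *m v) = (1%:M - diag_mx D) *m (Q^T *m v).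
  rewrite /P !mulmxBl !mul1mx mulmxBr !mulmxA QQ mul1mx //.
set a := Q^T *m v.
apply: (@le_trans _ _ (\sum_i m * a i 0 ^+ 2)).
  apply: ler_sum => i _; rewrite mulmxBl mul1mx mul_diag_mx !mxE -/(a i 0).
  have [iJ|iJ] := boolP (i \in J).
    by rewrite mul1r subrr expr0n mulr0 mulr_ge0 ?sqr_ge0.
  rewrite mul0r subr0 ler_wpM2r ?sqr_ge0 //.
  exact: (le_bigmax_cond 0 (fun i => d 0 i)).
rewrite -mulr_sumr -l2norm_sqr_cV l2norm_orthogonal // ler_piMr //.
by rewrite expr_le1 ?l2norm_ge0.
Qed.

End SingularValueTheory.

Local Open Scope classical_set_scope.

(** * Countable descriptions of the operator norm and of singular values *)

Section RationalApproximation.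
Context {R : realType}.

Lemma rat_approx_mx m n (A : 'M[R]_(m, n)) e : 0 < e ->
  exists B : 'M[rat]_(m, n), l2norm (A - map_mx ratr B) <= e.
Proof.
move=> e0; pose c : R := (m * n).+1%:R; have c0 : 0 < c by rewrite ltr0n.
have c1 : 1 <= c by rewrite ler1n.
have ec0 : 0 < e / c by rewrite divr_gt0.
have h (ij : 'I_m * 'I_n) : exists q : rat, `|A ij.1 ij.2 - ratr q| <= e / c.
  have /rat_in_itvoo[q] : A ij.1 ij.2 - e / c < A ij.1 ij.2 by rewrite gtrBl.
  rewrite in_itv /= => /andP[q1 q2]; exists q.
  have q0 : 0 <= A ij.1 ij.2 - ratr q by rewrite subr_ge0 ltW.
  by rewrite ger0_norm // lerBlDl -lerBlDr ltW.
have [f fP] := choice h.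
exists (\matrix_(i, j) f (i, j)).
rewrite -ler_sqr ?nnegrE ?l2norm_ge0 ?(ltW e0) // l2norm_sqr.
apply: (@le_trans _ _ (\sum_(i < m) \sum_(j < n) (e / c) ^+ 2)).
  apply: ler_sum => i _; apply: ler_sum => j _; rewrite !mxE -real_normK ?num_real //.
  by apply: lerXn2r; rewrite ?nnegrE ?normr_ge0 ?(ltW ec0) // (fP (i, j)).
rewrite !sumr_const !card_ord -mulrnA -mulr_natl mulnC.
rewrite expr_div_n mulrCA ler_piMr ?sqr_ge0 // ler_pdivrMr ?exprn_gt0 // mul1r.
rewrite expr2 -[leLHS]mulr1; apply: ler_pM => //.
by rewrite ler_nat.
Qed.

(** The homogeneous form removes the constraint |v| <= 1, which a rational approximation of v might
    violate. *)
Lemma opnorm_gt_rat m n (M : 'M[R]_(m, n)) c : 0 <= c ->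
  c < opnorm M <->
  exists v : 'cV[rat]_n, c * l2norm (map_mx ratr v) < l2norm (M *m map_mx ratr v).
Proof.
move=> c0; split=> [|[v cv]]; last first.
  have : c * l2norm (map_mx ratr v) < opnorm M * l2norm (map_mx ratr v).
    by apply: lt_le_trans cv (l2norm_mulmx _ _).
  apply: contraTT; rewrite -!leNgt => h.
  by rewrite ler_wpM2r ?l2norm_ge0.
move=> cM; apply: contrapT => nex; move: cM; apply/negP; rewrite -leNgt.
have le v : l2norm (M *m map_mx ratr v) <= c * l2norm (map_mx ratr v : 'cV[R]_n).
  by rewrite leNgt; apply/negP => h; apply: nex; exists v.
apply: opnorm_le => // v v1; apply/ler_addgt0Pr => e e0.
(* An error e / K in v costs (c + |M|) e / K <= e; the added 1 keeps K positive. *)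
pose K := c + l2norm M + 1.
have K0 : 0 < K by rewrite ltr_wpDl // addr_ge0 // l2norm_ge0.
have eK0 : 0 < e / K by rewrite divr_gt0.
have [v' vv'] := rat_approx_mx v eK0; set r := map_mx ratr v' in vv' *.
have -> : M *m v = M *m r + M *m (v - r) by rewrite -mulmxDr addrC subrK.
apply: le_trans (l2normD _ _) _.
have h1 := le v'; rewrite -/r in h1.
have h2 := l2norm_mulmx_fro M (v - r).
have h3 : l2norm r <= l2norm v + l2norm (v - r).
  rewrite -{1}(subKr v r); apply: le_trans (l2normD _ _) _.
  by rewrite l2normN.
have h4 : l2norm M * l2norm (v - r) <= l2norm M * (e / K) by rewrite ler_wpM2l ?l2norm_ge0.
have h5 : c * l2norm r <= c * (1 + e / K) by rewrite ler_wpM2l // (le_trans h3) // lerD.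
have h6 : (c + l2norm M) * (e / K) <= e.
  rewrite mulrA ler_pdivrMr // mulrC ler_wpM2l ?(ltW e0) // /K lerDl //.
apply: le_trans (lerD h1 h2) _; apply: le_trans (lerD h5 h4) _.
by rewrite mulrDr mulr1 -addrA lerD2l -mulrDl.
Qed.

(** By Eckart-Young the condition is that some factorization lies at distance below c, an open
    condition on the factors. *)
Lemma sing_val_lt_rat n p j (X : 'M[R]_(n, p)) c :
  (nth 0 (singular_values X) j < c) <->
  exists UV : 'M[rat]_(n, j) * 'M[rat]_(j, p),
    opnorm (X - map_mx ratr UV.1 *m map_mx ratr UV.2) < c.
Proof.
split=> [|[[U V] /= UVc]]; last first.
  apply: le_lt_trans UVc.
  have := sing_val_le_opnorm X (map_mx ratr U) (map_mx ratr V).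
  by rewrite lee_fin.
rewrite -lte_fin -[_%:E]/(sing_val X j.+1) => /low_rank_approximation[U [V UVc]].
pose e := c - opnorm (X - U *m V); have e0 : 0 < e by rewrite subr_gt0.
have K0 : 0 < l2norm V + 1 by rewrite ltr_wpDl // l2norm_ge0.
have [|U' hU] := @rat_approx_mx _ _ U (e / 3 / (l2norm V + 1)).
  by rewrite !divr_gt0.
pose r : 'M[R]_(n, j) := map_mx ratr U'.
have L0 : 0 < l2norm r + 1 by rewrite ltr_wpDl // l2norm_ge0.
(* The accuracy for V depends on the approximation r already chosen for U, since the error splits as
   (U - r) V + r (V - t). *)
have [|V' hV] := @rat_approx_mx _ _ V (e / 3 / (l2norm r + 1)).
  by rewrite !divr_gt0.
pose t : 'M[R]_(j, p) := map_mx ratr V'.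
exists (U', V') => /=; rewrite -/r -/t.
have fro m1 m2 m3 (A : 'M[R]_(m1, m2)) (B : 'M[R]_(m2, m3)) :
    opnorm (A *m B) <= l2norm A * l2norm B.
  apply: opnorm_le => [|v v1]; first by rewrite mulr_ge0 ?l2norm_ge0.
  rewrite -mulmxA; apply: le_trans (l2norm_mulmx_fro _ _) _.
  rewrite ler_wpM2l ?l2norm_ge0 // (le_trans (l2norm_mulmx_fro _ _)) //.
  by rewrite ler_piMr ?l2norm_ge0.
have -> : X - r *m t = (X - U *m V) + ((U - r) *m V + r *m (V - t)).
  rewrite mulmxBl mulmxBr addrA subrKA addrA subrK //.
apply: le_lt_trans (opnormD _ _) _; apply: (@le_lt_trans _ _ (opnorm (X - U *m V) + (e / 3 + e / 3))).
  rewrite lerD2l; apply: le_trans (opnormD _ _) _; apply: lerD.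
    apply: le_trans (fro _ _ _ _ _) _.
    apply: (@le_trans _ _ (e / 3 / (l2norm V + 1) * (l2norm V + 1))).
      by apply: ler_pM; rewrite ?l2norm_ge0 ?lerDl.
    by rewrite divfK ?gt_eqF.
  apply: le_trans (fro _ _ _ _ _) _.
  apply: (@le_trans _ _ ((l2norm r + 1) * (e / 3 / (l2norm r + 1)))).
    by apply: ler_pM; rewrite ?l2norm_ge0 ?lerDl.
  by rewrite mulrC divfK ?gt_eqF.
by move: e0; rewrite /e; lra.
Qed.

End RationalApproximation.

(** * Measurability of the norms, the singular values and the FlipPA output *)

Section Measurability.
Context {d : measure_display} {T : measurableType d} {R : realType}.
Implicit Types f g : T -> R.

Lemma measurable_fun_gt f :
  (forall c, measurable [set w | c < f w]) -> measurable_fun setT f.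
Proof.
move=> h mD; apply: (measurability _ (RGenOInfty.measurableE R)) => //.
move=> _ [_ [x ->] <-]; rewrite setTI.
rewrite (_ : _ @^-1` _ = [set w | x < f w]); first exact: h.
by apply/seteqP; split => w /=; rewrite in_itv /= andbT.
Qed.

Lemma measurable_fun_lt f :
  (forall c, measurable [set w | f w < c]) -> measurable_fun setT f.
Proof.
move=> h mD; apply: (measurability _ (RGenInftyO.measurableE R)) => //.
move=> _ [_ [x ->] <-]; rewrite setTI.
rewrite (_ : _ @^-1` _ = [set w | f w < x]); first exact: h.
by apply/seteqP; split => w /=; rewrite in_itv.
Qed.

Lemma measurable_ltr_set f g : measurable_fun setT f -> measurable_fun setT g ->
  measurable [set w | f w < g w].
Proof.
move=> mf mg; have mt : measurable [set true] by [].
by have := measurable_fun_ltr mf mg measurableT mt; rewrite setTI.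
Qed.

Lemma measurable_ler_set f g : measurable_fun setT f -> measurable_fun setT g ->
  measurable [set w | f w <= g w].
Proof.
move=> mf mg; have mt : measurable [set true] by [].
by have := measurable_fun_ler mf mg measurableT mt; rewrite setTI.
Qed.

Lemma measurable_sqrtr : measurable_fun setT (@Num.sqrt R).
Proof. by apply: nondecreasing_measurable => // x y; exact: ler_wsqrtr. Qed.

Lemma measurable_fun_bigmax (I : Type) (s : seq I) (f : I -> T -> R) :
  (forall i, measurable_fun setT (f i)) ->
  measurable_fun setT (fun w => \big[Num.max/0]_(i <- s) f i w).
Proof.
move=> mf; elim: s => [|i s IH].
  by under eq_fun do rewrite big_nil; exact: measurable_cst.
by under eq_fun do rewrite big_cons; exact: measurable_maxr.
Qed.

Lemma measurable_l2norm m n (M : T -> 'M[R]_(m, n)) : measurable_mx M ->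
  measurable_fun setT (fun w => l2norm (M w)).
Proof.
move=> mM; apply: (measurableT_comp measurable_sqrtr).
by apply: measurable_sum => i; apply: measurable_sum => j; exact: measurable_funX.
Qed.

Lemma measurable_linfnorm m n (M : T -> 'M[R]_(m, n)) : measurable_mx M ->
  measurable_fun setT (fun w => linfnorm (M w)).
Proof.
move=> mM; apply: measurable_fun_bigmax => i; apply: measurable_fun_bigmax => j.
exact: measurableT_comp.
Qed.

Lemma measurable_mx_cst m n (A : 'M[R]_(m, n)) : measurable_mx (fun _ : T => A).
Proof. by move=> i j; exact: measurable_cst. Qed.

Lemma measurable_mulmx m n l (A : T -> 'M[R]_(m, n)) (B : T -> 'M[R]_(n, l)) :
  measurable_mx A -> measurable_mx B -> measurable_mx (fun w => A w *m B w).
Proof.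
move=> mA mB i j; under eq_fun do rewrite mxE.
by apply: measurable_sum => k; exact: measurable_funM.
Qed.

Lemma measurable_addmx m n (A B : T -> 'M[R]_(m, n)) :
  measurable_mx A -> measurable_mx B -> measurable_mx (fun w => A w + B w).
Proof.
move=> mA mB i j; under eq_fun do rewrite mxE.
exact: measurable_funD.
Qed.

Lemma measurable_hadamard m n (A B : T -> 'M[R]_(m, n)) :
  measurable_mx A -> measurable_mx B -> measurable_mx (fun w => hadamard (A w) (B w)).
Proof.
move=> mA mB i j; under eq_fun do rewrite mxE.
exact: measurable_funM.
Qed.

Lemma measurable_trmx m n (A : T -> 'M[R]_(m, n)) :
  measurable_mx A -> measurable_mx (fun w => (A w)^T).
Proof. by move=> mA i j; under eq_fun do rewrite mxE; exact: mA. Qed.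

Lemma measurable_row m n i (A : T -> 'M[R]_(m, n)) :
  measurable_mx A -> measurable_mx (fun w => row i (A w)).
Proof. by move=> mA k j; under eq_fun do rewrite mxE; exact: mA. Qed.

Lemma measurable_symmx m n (A : T -> 'M[R]_(m, n)) :
  measurable_mx A -> measurable_mx (fun w => symmx (A w)).
Proof.
move=> mA i j; case: (split_ordP i) => i' ->; case: (split_ordP j) => j' ->.
- by under eq_fun do rewrite block_mxEul mxE; exact: measurable_cst.
- by under eq_fun do rewrite block_mxEur; exact: mA.
- by under eq_fun do rewrite block_mxEdl mxE; exact: mA.
- by under eq_fun do rewrite block_mxEdr mxE; exact: measurable_cst.
Qed.

Lemma measurable_opnorm m n (M : T -> 'M[R]_(m, n)) : measurable_mx M ->
  measurable_fun setT (fun w => opnorm (M w)).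
Proof.
move=> mM; apply: measurable_fun_gt => c.
have [c0|c0] := ltP c 0.
  rewrite (_ : [set _ | _] = setT) //; apply/seteqP; split => // w _ /=.
  by apply: lt_le_trans c0 (opnorm_ge0 _).
rewrite (_ : [set _ | _] = \bigcup_(v : 'cV[rat]_n)
    [set w | c * l2norm (map_mx ratr v : 'cV[R]_n) < l2norm (M w *m map_mx ratr v)]); last first.
  apply/seteqP; split => w /=.
    by move=> /(opnorm_gt_rat _ c0)[v hv]; exists v.
  by move=> [v _ hv]; apply/(opnorm_gt_rat _ c0); exists v.
apply: countable_bigcupT_measurable => // v.
apply: measurable_ltr_set; first exact: measurable_cst.
by apply/measurable_l2norm/measurable_mulmx => //; exact: measurable_mx_cst.
Qed.

Lemma measurable_singular_value n p j (X : T -> 'M[R]_(n, p)) : measurable_mx X ->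
  measurable_fun setT (fun w => nth 0 (singular_values (X w)) j).
Proof.
move=> mX; apply: measurable_fun_lt => c.
rewrite (_ : [set _ | _] = \bigcup_(UV : 'M[rat]_(n, j) * 'M[rat]_(j, p))
    [set w | opnorm (X w - map_mx ratr UV.1 *m map_mx ratr UV.2) < c]); last first.
  apply/seteqP; split => w /=.
    by move=> /sing_val_lt_rat[UV hUV]; exists UV.
  by move=> [UV _ hUV]; apply/sing_val_lt_rat; exists UV.
apply: countable_bigcupT_measurable => // UV.
apply: measurable_ltr_set; last exact: measurable_cst.
by apply/measurable_opnorm/measurable_addmx => //; exact: measurable_mx_cst.
Qed.

Lemma measurable_count_gt (I : Type) (s : seq I) (P : I -> T -> bool) m :
  (forall i, measurable [set w | P i w]) ->
  measurable [set w | (m < count (P^~ w) s)%N].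
Proof.
move=> mP; elim: s m => [|i s IH] m /=.
  by rewrite (_ : [set _ | _] = set0) //; apply/seteqP; split => w //=; rewrite ltn0.
case: m => [|m].
  rewrite (_ : [set _ | _] = [set w | P i w] `|` [set w | (0 < count (P^~ w) s)%N]).
    by apply: measurableU.
  apply/seteqP; split => w /=; case: (P i w) => //=; try by left.
    by rewrite add0n => ?; right.
  by case.
rewrite (_ : [set _ | _] = ([set w | P i w] `&` [set w | (m < count (P^~ w) s)%N])
    `|` [set w | (m.+1 < count (P^~ w) s)%N]).
  by apply: measurableU => //; apply: measurableI.
apply/seteqP; split => w /=; case: (P i w) => /=; rewrite ?add1n ?ltnS ?add0n.
- by left.
- by right.
- by case=> [[]//|/ltnW].
- by case=> [[]|].
Qed.

Lemma measurable_cst_set (Q : Prop) : measurable [set _ : T | Q].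
Proof.
have [q|nq] := pselect Q.
  by rewrite (_ : [set _ | _] = setT) //; apply/seteqP; split.
by rewrite (_ : [set _ | _] = set0) //; apply/seteqP; split.
Qed.

Section SortedSamples.
Context {I : Type} (s : seq I) (f : I -> T -> R).
Hypothesis mf : forall i, measurable_fun setT (f i).

Lemma measurable_nth_sort_ge j :
  measurable_fun setT (fun w => nth 0 (sort >=%R [seq f i w | i <- s]) j).
Proof.
apply: measurable_fun_gt => c; have [js|sj] := ltnP j (size s); last first.
  rewrite (_ : [set _ | _] = [set _ : T | c < 0]); first exact: measurable_cst_set.
  by apply/seteqP; split => w /=; rewrite nth_default ?size_sort ?size_map.
rewrite (_ : [set _ | _] = [set w | (j < count (fun i => (c < f i w)%R) s)%N]).
  apply: measurable_count_gt => i.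
  by apply: measurable_ltr_set => //; exact: measurable_cst.
apply/seteqP; split => w /=;
  have := sorted_nth_count 0 j (rev_trans le_trans)
    (sort_sorted (fun x y : R => le_total y x) [seq f i w | i <- s])
    (fun (x y : R) (yx : y <= x) (cy : c < y) => lt_le_trans cy yx);
  rewrite count_sort count_map size_sort size_map js /=.
  by move=> <-.
by move=> ->.
Qed.

Lemma measurable_nth_sort_le j :
  measurable_fun setT (fun w => nth 0 (sort <=%R [seq f i w | i <- s]) j).
Proof.
apply: measurable_fun_lt => c; have [js|sj] := ltnP j (size s); last first.
  rewrite (_ : [set _ | _] = [set _ : T | 0 < c]); first exact: measurable_cst_set.
  by apply/seteqP; split => w /=; rewrite nth_default ?size_sort ?size_map.
rewrite (_ : [set _ | _] = [set w | (j < count (fun i => (f i w < c)%R) s)%N]).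
  apply: measurable_count_gt => i.
  by apply: measurable_ltr_set => //; exact: measurable_cst.
apply/seteqP; split => w /=;
  have := sorted_nth_count 0 j le_trans
    (sort_sorted (fun x y : R => le_total x y) [seq f i w | i <- s])
    (fun (x y : R) (xy : x <= y) (yc : y < c) => le_lt_trans xy yc);
  rewrite count_sort count_map size_sort size_map js /=.
  by move=> <-.
by move=> ->.
Qed.

End SortedSamples.

Lemma measurable_norm_2inf m n (M : T -> 'M[R]_(m, n)) : measurable_mx M ->
  measurable_fun setT (fun w => norm_2inf (M w)).
Proof.
by move=> mM; apply: measurable_fun_bigmax => i; exact/measurable_l2norm/measurable_row.
Qed.

Lemma measurable_rho_2 m n (M : T -> 'M[R]_(m, n)) : measurable_mx M ->
  measurable_fun setT (fun w => rho_2 (M w)).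
Proof.
move=> mM; apply: measurable_funM; last exact: measurable_cst.
exact/measurable_norm_2inf/measurable_symmx.
Qed.

Lemma measurable_rho_inf m n (M : T -> 'M[R]_(m, n)) : measurable_mx M ->
  measurable_fun setT (fun w => rho_inf (M w)).
Proof.
move=> mM; apply: measurable_fun_bigmax => i.
apply: measurable_funM; last exact: measurable_cst.
apply: measurable_nth_sort_ge => r.
exact/measurable_linfnorm/measurable_row/measurable_symmx.
Qed.

Lemma measurable_quantile ty q T' (f : 'I_T' -> T -> R) :
  (forall t, measurable_fun setT (f t)) ->
  measurable_fun setT (fun w => quantile ty q [seq f t w | t <- enum 'I_T']).
Proof.
move=> mf; rewrite /quantile.
(* The sample size is fixed, so the rank j and the weight c are constants. *)
under eq_fun do rewrite size_map.
have mo j : measurable_fun setT (fun w => order_stat [seq f t w | t <- enum 'I_T'] j).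
  rewrite /order_stat; under eq_fun do rewrite size_map.
  exact: measurable_nth_sort_le.
by apply: measurable_funD; apply: measurable_funM => //; exact: measurable_cst.
Qed.

Lemma measurable_find_eq (I : Type) (s : seq I) (P : I -> T -> bool) m :
  (forall i, measurable [set w | P i w]) ->
  measurable [set w | find (P^~ w) s = m].
Proof.
move=> mP; elim: s m => [|i s IH] m /=.
  exact: measurable_cst_set.
case: m => [|m].
  rewrite (_ : [set _ | _] = [set w | P i w]) //.
  by apply/seteqP; split => w /=; case: (P i w).
rewrite (_ : [set _ | _] = (~` [set w | P i w]) `&` [set w | find (P^~ w) s = m]).
  by apply: measurableI => //; apply: measurableC.
apply/seteqP; split => w /=; case: (P i w) => //=.
- by move=> [].
- by move=> [/(_ isT)].
- by move=> [_ ->].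
Qed.

Lemma measurable_flippa n p T' ty q tau (X : T -> 'M[R]_(n, p))
    (F : 'I_T' -> T -> 'M[R]_(n, p)) k :
  measurable_mx X -> (forall t, measurable_mx (F t)) ->
  measurable [set w | flippa ty q tau (X w) (fun t => F t w) = k].
Proof.
move=> mX mF; rewrite /flippa.
apply: (@measurable_find_eq nat _ (fun j w => (sing_val (X w) j.+1 <=
  (flip_threshold ty q tau (X w) (fun t => F t w))%:E)%E)) => j.
under eq_set => w do rewrite /sing_val lee_fin.
apply: measurable_ler_set; first exact: measurable_singular_value.
apply: measurable_funD; last exact: measurable_cst.
apply: measurable_quantile => t.
exact/measurable_opnorm/measurable_hadamard.
Qed.

End Measurability.

(** * Events generated by matrix entries *)

Section GeneratedEvents.
Context {R : realType}.

(** With a generated sigma-algebra on the sample space, the measurability lemmas above show that an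
    event lies in that particular sigma-algebra. *)
Lemma g_sigma_measurable_fun (T : pointedType) (G : set (set T)) (f : T -> R) :
  (forall B, measurable B -> G (f @^-1` B)) ->
  measurable_fun (setT : set (g_sigma_algebraType G)) f.
Proof. by move=> h _ B mB; rewrite setTI; apply: sub_sigma_algebra; exact: h. Qed.

(** Boxes form a pi-system on which independence of the entries becomes a product formula. *)
Definition rectangle n p (C : 'I_n -> 'I_p -> set R) : set 'M[R]_(n, p) :=
  [set M | forall i j, C i j (M i j)].

Definition rectangles n p : set (set 'M[R]_(n, p)) :=
  [set B | exists2 C, (forall i j, measurable (C i j)) & B = rectangle C].

Lemma setI_closed_rectangles n p : setI_closed (@rectangles n p).
Proof.
move=> _ _ [C mC ->] [D mD ->]; exists (fun i j => C i j `&` D i j).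
  by move=> i j; exact: measurableI.
by apply/seteqP; split => M /= => [[hC hD] i j|h]; split => //;
  move=> i j; have [] := h i j.
Qed.

Lemma rectangle_coord n p (i : 'I_n) (j : 'I_p) (B : set R) : measurable B ->
  rectangles [set M : 'M[R]_(n, p) | B (M i j)].
Proof.
move=> mB.
exists (fun i' j' => if (i' == i) && (j' == j) then B else setT).
  by move=> i' j'; case: ifP.
apply/seteqP; split => M /= => [h i' j'|/(_ i j)]; last by rewrite !eqxx.
by case: ifP => // /andP[/eqP-> /eqP->].
Qed.

Lemma measurable_mx_id n p :
  measurable_mx (fun M : g_sigma_algebraType (@rectangles n p) => (M : 'M[R]_(n, p))).
Proof.
by move=> i j; apply: g_sigma_measurable_fun => B mB; exact: rectangle_coord.
Qed.

End GeneratedEvents.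

(** * Union bound, disjoint unions and Markov's inequality *)

Section ProbabilityTools.
Context {d : measure_display} {Om : measurableType d} {R : realType}.
Variable P : probability Om R.
Local Open Scope ereal_scope.

Lemma prob_cover (I : choiceType) (s : seq I) (A : set Om) (B : I -> set Om) :
  measurable A -> (forall i, measurable (B i)) ->
  (forall w, A w -> exists2 i, i \in s & B i w) ->
  P A <= \sum_(i <- s) P (B i).
Proof.
move=> + mB; elim: s A => [|i s IH] A mA cov.
  rewrite (_ : A = set0) ?measure0 ?big_nil //.
  by apply/seteqP; split => // w /cov[].
rewrite big_cons; apply: (@le_trans _ _ (P (B i `|` (A `\` B i)))).
  apply: le_measure; rewrite ?inE //; first by apply: measurableU => //; exact: measurableD.
  by move=> w Aw; have [Bw|nBw] := pselect (B i w); [left|right].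
apply: le_trans (measureU2 _ _ _) _ => //; first exact: measurableD.
rewrite leeD2l //; apply: IH; first exact: measurableD.
move=> w [Aw nBw]; have [k] := cov w Aw.
by rewrite inE => /predU1P[->//|ks Bk]; exists k.
Qed.

Lemma prob_disjoint (I : choiceType) (s : seq I) (B : I -> set Om) :
  (forall i, measurable (B i)) -> uniq s ->
  (forall i j w, B i w -> B j w -> i = j) ->
  P (\big[setU/set0]_(i <- s) B i) = \sum_(i <- s) P (B i).
Proof.
move=> mB + dB; elim: s => [|i s IH] /=; first by rewrite !big_nil measure0.
move=> /andP[nis us]; rewrite !big_cons -IH // measureU //; first exact: bigsetU_measurable.
apply/seteqP; split => // w [Bi]; rewrite -bigcup_seq => -[j /= js Bj].
by move: nis; rewrite (dB _ _ _ Bi Bj) js.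
Qed.

Lemma integral_markov (f : Om -> R) (t : R) : (0 < t)%R ->
  measurable_fun setT f -> (forall w, (0 <= f w)%R) ->
  P [set w | (t < f w)%R] <= (t^-1)%:E * \int[P]_w (f w)%:E.
Proof.
move=> t0 mf f0; set A := [set w | _].
have mA : measurable A by apply: measurable_ltr_set => //; exact: measurable_cst.
have m1 : measurable_fun setT (fun w => (\1_A w : R)%:E).
  by apply/measurable_EFinP; exact: measurable_indic.
have e : t%:E * P A = \int[P]_w (t%:E * (\1_A w)%:E).
  rewrite ge0_integralZl_EFin //; last exact: ltW.
  by rewrite integral_indic // setIT.
rewrite lee_pdivlMl // e.
apply: ge0_le_integral => //.
- by move=> w _; rewrite -EFinM lee_fin mulr_ge0 // ltW.
- apply/measurable_EFinP; apply: measurable_funM; first exact: measurable_cst.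
  exact: measurable_indic.
- exact/measurable_EFinP.
move=> w _; rewrite -EFinM lee_fin indicE.
have [wA|_] := boolP (w \in A); last by rewrite mulr0.
by rewrite mulr1 ltW //; move: wA; rewrite inE.
Qed.

End ProbabilityTools.

(** * Invariance of the noise law under a fixed flip *)

Section SignedCopies.
Context {d : measure_display} {Om : measurableType d} {R : realType}.
Variable P : probability Om R.
Context {n p : nat}.
Local Open Scope ereal_scope.

Definition flipmx (b : {set 'I_n * 'I_p}) : 'M[R]_(n, p) :=
  signmx (\matrix_(i, j) ((i, j) \in b)).

Lemma hadamard_flipmx b A : hadamard (flipmx b) A = flip b A.
Proof. by apply/matrixP => i j; rewrite !mxE /sgn. Qed.

Lemma flipmx_inj : injective flipmx.
Proof.
move=> b c /matrixP bc; apply/setP => -[i j]; have := bc i j; rewrite !mxE.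
case: (_ \in b); case: (_ \in c) => // /eqP; rewrite ?expr1 ?expr0.
  by rewrite eq_sym -subr_eq0 opprK (_ : 1 + 1 = 2%:R)%R // pnatr_eq0.
by rewrite -subr_eq0 opprK (_ : 1 + 1 = 2%:R)%R // pnatr_eq0.
Qed.

(** On a box, flipping an entry replaces its side by the opposite set, of equal probability by
    symmetry; Dynkin's theorem extends this from boxes to the generated sigma-algebra. *)
Lemma flip_law_invariant (N : Om -> 'M[R]_(n, p)) (B : set 'M[R]_(n, p)) b :
  measurable_mx N -> independent_entries P N ->
  (forall i j, symmetric_law P (fun w => N w i j)) ->
  <<s @rectangles R n p >> B ->
  P [set w | B (flip b (N w))] = P [set w | B (N w)].
Proof.
move=> mN iN sN.
pose T := g_sigma_algebraType (@rectangles R n p).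
have mrect (M : Om -> 'M[R]_(n, p)) : measurable_mx M ->
    measurable_fun setT (M : Om -> T).
  move=> mM; apply: (@measurability _ _ Om T setT M (@rectangles R n p)) => //.
  move=> _ [_ [C mC ->] <-]; rewrite setTI.
  rewrite (_ : _ @^-1` _ = \bigcap_i \bigcap_j ((fun w => M w i j) @^-1` C i j)).
    apply: fin_bigcap_measurable => [//|i _]; apply: fin_bigcap_measurable => [//|j _].
    by rewrite -[X in measurable X]setTI; exact: mM.
  by apply/seteqP; split => w /= => [h i _ j _|h i j]; [exact: h|exact: (h i I j I)].
have mbN : measurable_mx (fun w => flip b (N w)).
  move=> i j; under eq_fun do rewrite mxE.
  by apply: measurable_funM => //; exact: measurable_cst.
have pre (M : Om -> 'M[R]_(n, p)) S : measurable_mx M ->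
    @measurable _ T S -> measurable [set w | S (M w)].
  by move=> /mrect mM mS; have := mM measurableT _ mS; rewrite setTI.
apply: (@dynkin_induction _ T (@rectangles R n p)
   (fun B => P [set w | B (flip b (N w))] = P [set w | B (N w)])).
- by [].
- exact: setI_closed_rectangles.
- by [].
- move=> _ [C mC ->].
  have prodE (D : 'I_n -> 'I_p -> set R) : (forall i j, measurable (D i j)) ->
      P [set w | rectangle D (N w)] = \prod_ij P ((fun w => N w ij.1 ij.2) @^-1` D ij.1 ij.2).
    move=> mD.
    have := iN [set: 'I_n * 'I_p]%SET (fun ij => (fun w => N w ij.1 ij.2) @^-1` D ij.1 ij.2).
    rewrite (_ : \bigcap_(_ in _) _ = [set w | rectangle D (N w)]); last first.
      apply/seteqP; split => w /= => [h i j|h [i j] _]; last exact: h.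
      by apply: (h (i, j)); rewrite /= inE.
    move=> -> => [|[i j] _]; first by apply: eq_bigl => ij; rewrite inE.
    by exists (D i j) => //; rewrite setTI.
  rewrite prodE //.
  pose D i j := if (i, j) \in b then -%R @^-1` C i j else C i j.
  rewrite (_ : [set w | rectangle C _] = [set w | rectangle D (N w)]); last first.
    apply/seteqP; split => w /= h i j; have := h i j; rewrite /D !mxE /sgn.
      by case: ifP => _ /=; rewrite ?expr1 ?expr0 ?mulN1r ?mul1r.
    by case: ifP => _ /=; rewrite ?expr1 ?expr0 ?mulN1r ?mul1r.
  rewrite prodE; last first.
    move=> i j; rewrite /D; case: ifP => // _.
    rewrite -[X in measurable X]setTI.
    exact: (@oppr_measurable R setT measurableT _ (mC i j)).
  apply: eq_bigr => -[i j] _ /=; rewrite /D; case: ifP => // _.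
  by rewrite (sN i j _ (mC i j)).
- move=> S mS PS.
  rewrite (_ : [set w | (~` S) (flip b (N w))] = ~` [set w | S (flip b (N w))]) //.
  rewrite (_ : [set w | (~` S) (N w)] = ~` [set w | S (N w)]) //.
  by rewrite !probability_setC ?PS //; exact: pre.
- move=> F mF tF PF.
  have e (M : Om -> 'M[R]_(n, p)) : measurable_mx M ->
      P [set w | (\bigcup_k F k) (M w)] = \sum_(k <oo) P [set w | F k (M w)].
    move=> mM; rewrite (_ : [set w | _] = \bigcup_k [set w | F k (M w)]); last first.
      by apply/seteqP; split => w /= [k _ h]; exists k.
    rewrite measure_bigcup //=.
    - by apply: eq_eseriesl => k; rewrite in_setT.
    - by move=> k _; exact: pre.
    - by move=> i j _ _ [w [/= h1 h2]]; apply: (tF i j) => //; exists (M w).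
  by rewrite !e //; apply: eq_eseriesr => k _; exact: PF.
Qed.

End SignedCopies.

(** * Conditioning on the random signs *)

Section IndependentFlips.
Context {d : measure_display} {Om : measurableType d} {R : realType}.
Variable P : probability Om R.
Context {n p T : nat} (F : 'I_T -> Om -> 'M[R]_(n, p)) (S N : Om -> 'M[R]_(n, p)).
Hypothesis mF : forall t, measurable_mx (F t).
Hypothesis mS : measurable_mx S.
Hypothesis mN : measurable_mx N.
Hypothesis uF : forall t, uniform_signs P (F t).
Hypothesis iF : independent_flips P F S N.
Local Open Scope ereal_scope.

Let c : R := ((2 ^+ (n * p))^-1)%R.

Let c_ge0 : (0 <= c)%R.
Proof. by rewrite invr_ge0 exprn_ge0. Qed.

Lemma measurable_mx_eq {d'} {Om' : measurableType d'} (M : Om' -> 'M[R]_(n, p)) A :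
  measurable_mx M -> measurable [set w | M w = A].
Proof.
move=> mM; rewrite (_ : [set _ | _] = [set w | (l2norm (M w - A) <= 0)%R]).
  apply: measurable_ler_set; last exact: measurable_cst.
  by apply/measurable_l2norm/measurable_addmx => //; exact: measurable_mx_cst.
apply/seteqP; split => w /= => [->|]; first by rewrite subrr l2norm0.
rewrite le_eqVlt ltNge l2norm_ge0 orbF => /eqP/l2norm_eq0 h.
by apply/eqP; rewrite -subr_eq0 h.
Qed.

Lemma measurable_entry_events (M : Om -> 'M[R]_(n, p)) (G : set_system Om) :
  entry_events M `<=` G ->
  measurable_mx (fun w : g_sigma_algebraType G => M w).
Proof.
move=> MG i j; apply: g_sigma_measurable_fun => B mB; apply: MG.
by exists (i, j) => //; exists B => //; rewrite setTI.
Qed.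

Lemma events_mx2_measurable E : events_mx2 S N E -> measurable E.
Proof.
move: E; apply: smallest_sub; first exact: sigma_algebra_measurable.
by move=> _ [|] [[i j] _ [B mB <-]]; [exact: mS|exact: mN].
Qed.

Lemma prob_flip_eq t b E : events_mx2 S N E ->
  P ([set w | F t w = flipmx b] `&` E) = c%:E * P E.
Proof.
move=> EE.
pose G (o : option 'I_T) := if o is Some _ then [set w | F t w = flipmx b] else E.
have := iF (J := [set Some t; None]%SET) (E := G).
rewrite big_setU1 ?inE //= big_set1 (uF t) => <- //; last first.
  move=> [s|//]; rewrite !inE orbF => /eqP[->] /=.
  have := @measurable_mx_eq _ _ _ (flipmx b) (measurable_entry_events (M := F t) (G := entry_events (F t)) (fun _ h => h)).
  by [].
congr (P _); apply/seteqP; split => w /=.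
  by move=> [h1 h2] [s|]; rewrite /= !inE.
move=> h; split; first by apply: (h (Some t)); rewrite /= !inE eqxx.
by apply: (h None); rewrite /= !inE.
Qed.

(** Conditioning on F t, which takes finitely many values almost surely and is independent of (S,
    N); an upper bound is enough, so a union bound over the values does it. *)
Lemma prob_flip_le t (Q : 'M[R]_(n, p) -> Om -> Prop) :
  (forall b, events_mx2 S N [set w | Q (flipmx b) w]) ->
  measurable [set w | Q (F t w) w] ->
  P [set w | Q (F t w) w] <= \sum_b c%:E * P [set w | Q (flipmx b) w].
Proof.
move=> EQ mQ; set A := [set w | Q (F t w) w].
pose D b := [set w | F t w = flipmx b].
have mD b : measurable (D b) by exact: measurable_mx_eq.
pose U := \big[setU/set0]_(b <- index_enum {set 'I_n * 'I_p}) D b.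
have mU : measurable U by apply: bigsetU_measurable.
(* The 2^(n p) disjoint patterns exhaust the total mass, so F t is almost surely a sign matrix. *)
have PU : P U = 1.
  rewrite prob_disjoint //; last 2 first.
  - exact: index_enum_uniq.
  - by move=> b b' w; rewrite /D /= => -> /flipmx_inj.
  rewrite (eq_bigr (fun=> c%:E)) => [|b _]; last exact: uF.
  rewrite sumEFin sumr_const card_setsT card_prod !card_ord; congr (_%:E).
  by rewrite -mulr_natr natrX mulVf // expf_neq0 // pnatr_eq0.
have -> : P A = P (A `&` U).
  rewrite -[in LHS](setIT A) -(setUv U) setIUr measureU; last 3 first.
  - exact: measurableI.
  - by apply: measurableI => //; exact: measurableC.
  - by apply/seteqP; split => // w [[_ h] [_ /(_ h)]].
  rewrite [X in _ + X](_ : _ = 0) ?adde0 //; apply/eqP.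
  rewrite eq_le measure_ge0 andbT; apply: (@le_trans _ _ (P (~` U))).
    apply: le_measure; rewrite ?inE; [|exact: measurableC|by move=> w []].
    by apply: measurableI => //; exact: measurableC.
  by rewrite probability_setC // PU subee.
apply: (@le_trans _ _ (\sum_(b <- index_enum {set 'I_n * 'I_p})
    P (D b `&` [set w | Q (flipmx b) w]))); last first.
  by apply: lee_sum => b _; rewrite prob_flip_eq.
apply: prob_cover; first exact: measurableI.
  by move=> b; apply: measurableI => //; exact: events_mx2_measurable.
move=> w [Aw]; rewrite /U -bigcup_seq => -[b /= bs Db]; exists b => //.
by split => //=; rewrite -Db.
Qed.

(** For each fixed pattern the flipped noise has the law of N, so averaging over patterns changes
    nothing. *)
Lemma noise_flip_prob t (s e : R) : independent_entries P N ->
  (forall i j, symmetric_law P (fun w => N w i j)) ->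
  P [set w | (e < `|opnorm (hadamard (F t w) (N w)) - s|)%R] <=
  P [set w | (e < `|opnorm (N w) - s|)%R].
Proof.
move=> iN sN.
pose B := [set M : 'M[R]_(n, p) | (e < `|opnorm M - s|)%R].
have mB d' (Om' : measurableType d') (M : Om' -> 'M[R]_(n, p)) : measurable_mx M ->
    measurable [set w | B (M w)].
  move=> mM; apply: measurable_ltr_set; first exact: measurable_cst.
  apply: measurableT_comp => //; apply: measurable_funB; last exact: measurable_cst.
  exact: measurable_opnorm.
have Bg : <<s @rectangles R n p >> B.
  by have := mB _ _ _ (@measurable_mx_id R n p).
apply: le_trans (prob_flip_le (Q := fun M w => B (hadamard M (N w))) _ _) _.
- move=> b.
  (* The event must belong to the sigma-algebra of (S, N); this is its measurability on the same
     space with that sigma-algebra. *)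
  pose G := entry_events S `|` entry_events N.
  have mN' : measurable_mx (fun w : g_sigma_algebraType G => N w).
    by apply: measurable_entry_events => w; right.
  have := mB _ _ _ (measurable_hadamard (measurable_mx_cst (flipmx b)) mN').
  by [].
- by apply: mB; exact: measurable_hadamard.
under eq_bigr => b _.
  rewrite (_ : [set w | _] = [set w | B (flip b (N w))]); last first.
    by apply/seteqP; split => w /=; rewrite hadamard_flipmx.
  rewrite flip_law_invariant //.
  over.
rewrite -ge0_sume_distrl; last by move=> *; rewrite lee_fin.
rewrite sumEFin sumr_const card_setsT card_prod !card_ord.
rewrite -[(c *+ _)%R]mulr_natr natrX mulVf ?mul1e // expf_neq0 // pnatr_eq0 //.
Qed.

(** Markov's inequality for each fixed pattern; the finite sum over patterns then moves inside the
    integral as [avg]. *)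
Lemma signal_flip_prob t (e : R) : (0 < e)%R ->
  P [set w | (e < opnorm (hadamard (F t w) (S w)))%R] <=
  (e^-1)%:E * \int[P]_w (avg (fun b => opnorm (flip b (S w))))%:E.
Proof.
move=> e0.
have mfS b : measurable_fun setT (fun w => opnorm (flip b (S w))).
  apply: measurable_opnorm; under eq_fun do rewrite -hadamard_flipmx.
  by apply: measurable_hadamard => //; exact: measurable_mx_cst.
apply: le_trans (prob_flip_le (Q := fun M w => (e < opnorm (hadamard M (S w)))%R) _ _) _.
- move=> b.
  pose G := entry_events S `|` entry_events N.
  have mS' : measurable_mx (fun w : g_sigma_algebraType G => S w).
    by apply: measurable_entry_events => w; left.
  have := measurable_ltr_set (measurable_cst e)
    (measurable_opnorm (measurable_hadamard (measurable_mx_cst (flipmx b)) mS')).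
  by [].
- apply: measurable_ltr_set; first exact: measurable_cst.
  by apply/measurable_opnorm/measurable_hadamard.
apply: (@le_trans _ _ (\sum_b c%:E * ((e^-1)%:E * \int[P]_w (opnorm (flip b (S w)))%:E))).
  apply: lee_sum => b _; rewrite lee_wpmul2l ?lee_fin //.
  rewrite (_ : [set w | _] = [set w | (e < opnorm (flip b (S w)))%R]); last first.
    by apply/seteqP; split => w /=; rewrite hadamard_flipmx.
  by apply: integral_markov => // w; exact: opnorm_ge0.
under eq_bigr do rewrite muleCA.
rewrite -ge0_sume_distrr; last first.
  move=> b _; rewrite mule_ge0 ?lee_fin //; apply: integral_ge0 => w _.
  by rewrite lee_fin opnorm_ge0.
apply: lee_wpmul2l; first by rewrite lee_fin invr_ge0 ltW.
suff -> : \sum_b c%:E * \int[P]_w (opnorm (flip b (S w)))%:E =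
    \int[P]_w (avg (fun b => opnorm (flip b (S w))))%:E by [].
transitivity (\sum_b \int[P]_w (c%:E * (opnorm (flip b (S w)))%:E)).
  apply: eq_bigr => b _; rewrite ge0_integralZl_EFin //.
  - by move=> w _; rewrite lee_fin opnorm_ge0.
  - exact/measurable_EFinP.
rewrite -ge0_integral_sum //; last 2 first.
- move=> b; apply/measurable_EFinP; apply: measurable_funM => //; exact: measurable_cst.
- by move=> b w _; rewrite -EFinM lee_fin mulr_ge0 // opnorm_ge0.
apply: eq_integral => w _; rewrite -ge0_sume_distrr; last first.
  by move=> b _; rewrite lee_fin opnorm_ge0.
by rewrite sumEFin -EFinM /avg card_prod !card_ord mulrC.
Qed.

End IndependentFlips.

(** * From a fixed matrix to the random signal *)

Section ExpectedFlips.
Context {d : measure_display} {Om : measurableType d} {R : realType}.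
Variable P : probability Om R.
Context {n p : nat}.

Lemma norm_2inf_symmx_le (A : 'M[R]_(n, p)) :
  norm_2inf (symmx A) <= norm_2inf A + norm_2inf A^T.
Proof.
have pos m l (B : 'M[R]_(m, l)) : 0 <= norm_2inf B by exact: bigmax_ge_id.
apply: bigmax_le => [|v _]; first by rewrite addr_ge0.
rewrite -ler_sqr ?nnegrE ?l2norm_ge0 ?addr_ge0 //.
have sq m l (B : 'M[R]_(m, l)) i : l2norm (row i B) ^+ 2 <= norm_2inf B ^+ 2.
  apply: lerXn2r; rewrite ?nnegrE ?l2norm_ge0 //; exact: le_bigmax.
rewrite l2norm_sqr_rV big_split_ord /=; case: (split_ordP v) => i ->.
  rewrite big1 ?add0r => [|j _]; last by rewrite mxE block_mxEul mxE expr0n.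
  apply: (@le_trans _ _ (norm_2inf A ^+ 2)).
    apply: le_trans (sq _ _ A i); rewrite l2norm_sqr_rV.
    by apply: ler_sum => j _; rewrite mxE block_mxEur [in leRHS]mxE.
  by apply: lerXn2r; rewrite ?nnegrE ?addr_ge0 // lerDl.
rewrite addrC big1 ?add0r => [|j _]; last by rewrite mxE block_mxEdr mxE expr0n.
apply: (@le_trans _ _ (norm_2inf A^T ^+ 2)).
  apply: le_trans (sq _ _ A^T i); rewrite l2norm_sqr_rV.
  by apply: ler_sum => j _; rewrite mxE block_mxEdl [in leRHS]mxE.
by apply: lerXn2r; rewrite ?nnegrE ?addr_ge0 // lerDr.
Qed.

Local Open Scope ereal_scope.

Lemma integral_avg_flip_le (S : Om -> 'M[R]_(n, p)) : measurable_mx S ->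
  (4 <= n + p)%N ->
  \int[P]_w (avg (fun b => opnorm (flip b (S w))))%:E <=
  ((50 ^+ 2)%R)%:E * (expectation P (fun w => norm_2inf (S w))
    + expectation P (fun w => norm_2inf (S w)^T)
    + mine (expectation P (fun w => rho_2 (S w)))
           (expectation P (fun w => rho_inf (S w)))).
Proof.
move=> mS N4; rewrite unlock.
set C : R := (50 ^+ 2)%R; have C0 : (0 <= C)%R by rewrite exprn_ge0.
have C25 : (25 <= C)%R by rewrite /C; lra.
have Cinf w := avg_opnorm_rho_inf (S w).
rewrite -/C in Cinf; clearbody C.
have n0 m l (B : 'M[R]_(m, l)) : (0 <= norm_2inf B)%R by exact: bigmax_ge_id.
have i0 (B : 'M[R]_(n, p)) : (0 <= rho_inf B)%R by exact: bigmax_ge_id.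
have r0 (B : 'M[R]_(n, p)) : (0 <= rho_2 B)%R by rewrite mulr_ge0 // powR_ge0.
have m1 := measurable_norm_2inf mS.
have m2 := measurable_norm_2inf (measurable_trmx mS).
have m3 := measurable_rho_2 mS.
have m4 := measurable_rho_inf mS.
have a0 w : (0 <= avg (fun b => opnorm (flip b (S w))))%R.
  by apply: avg_ge0 => b; exact: opnorm_ge0.
have ma : measurable_fun setT (fun w => avg (fun b => opnorm (flip b (S w)))).
  apply: measurable_funM; last exact: measurable_cst.
  apply: measurable_sum => b; apply: measurable_opnorm.
  under eq_fun do rewrite -hadamard_flipmx.
  by apply: measurable_hadamard => //; exact: measurable_mx_cst.
(* An unspecified r is integrated, because the minimum compares two expectations and is not taken
   pointwise. *)
have bound (r : Om -> R) : measurable_fun setT r -> (forall w, (0 <= r w)%R) ->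
    (forall w, (avg (fun b => opnorm (flip b (S w))) <=
       C * (norm_2inf (S w) + norm_2inf (S w)^T + r w))%R) ->
    \int[P]_w (avg (fun b => opnorm (flip b (S w))))%:E <=
    C%:E * (\int[P]_w (norm_2inf (S w))%:E + \int[P]_w (norm_2inf (S w)^T)%:E
            + \int[P]_w (r w)%:E).
  move=> mr rr le.
  have me f : measurable_fun setT f -> measurable_fun setT (fun w : Om => (f w : R)%:E).
    by move=> mf; exact/measurable_EFinP.
  have e0 (f : Om -> R) : (forall w, (0 <= f w)%R) -> forall w, setT w -> 0 <= (f w)%:E.
    by move=> f0 w _; rewrite lee_fin.
  have m12 := measurable_funD m1 m2; have m12r := measurable_funD m12 mr.
  have p12 w : (0 <= norm_2inf (S w) + norm_2inf (S w)^T)%R by rewrite addr_ge0.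
  rewrite -(ge0_integralD P measurableT (e0 _ (fun w => n0 _ _ (S w))) (me _ m1)
           (e0 _ (fun w => n0 _ _ (S w)^T)) (me _ m2)).
  rewrite -(ge0_integralD P measurableT (e0 _ p12) (me _ m12) (e0 _ rr) (me _ mr)).
  rewrite -ge0_integralZl_EFin //; last 2 first.
  - by move=> w _; rewrite lee_fin addr_ge0.
  - exact: (me _ m12r).
  apply: ge0_le_integral => //.
  - exact: e0.
  - exact: me.
  - apply: me; apply: measurable_funM => //; exact: measurable_cst.
  - by move=> w _; rewrite lee_fin.
rewrite /mine; case: ifP => _; apply: bound => // w.
  apply: le_trans (avg_opnorm_rho_2 (S w) N4) _.
  apply: (@le_trans _ _ (C * rho_2 (S w)))%R; first by rewrite ler_wpM2r.
  by rewrite ler_wpM2l // lerDr addr_ge0.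
apply: le_trans (Cinf w) _; rewrite ler_wpM2l // lerD2r.
exact: norm_2inf_symmx_le.
Qed.

End ExpectedFlips.

(** * FlipPA on the good event *)

Section DeterministicSelection.
Context {R : realType}.

Lemma order_stat_itv (s : seq R) j lo hi : (0 < size s)%N ->
  {in s, forall x, lo <= x <= hi} -> lo <= order_stat s j <= hi.
Proof.
move=> s0 hs; apply: hs; rewrite /order_stat -(mem_sort <=%R) mem_nth // size_sort.
set m := Num.max _ _.
have m1 : 1%:Z <= m by rewrite le_max lexx.
have m2 : m <= (size s)%:Z by rewrite ge_max ge_min lexx orbT andbT lez_nat.
by case: m m1 m2 => [m|m] //; rewrite !lez_nat => m1 m2; rewrite prednK.
Qed.

(** In all nine types c lies in [0, 1], so the quantile is a convex combination of order
    statistics. *)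
Lemma quantile_itv ty (q : R) (s : seq R) lo hi : (0 < size s)%N ->
  {in s, forall x, lo <= x <= hi} -> lo <= quantile ty q s <= hi.
Proof.
move=> s0 hs; rewrite /quantile; set a := q * _ + _.
have /andP[c0 c1] : 0 <= hf_c ty (Num.floor a) (a - (Num.floor a)%:~R) <= 1.
  by apply: hf_c_itv; rewrite subr_ge0 floor_le ltrBlDl -intrD1 floorD1_gt.
move: (hf_c _ _ _) c0 c1 => c c0 c1.
have /andP[l1 h1] := order_stat_itv (Num.floor a) s0 hs.
have /andP[l2 h2] := order_stat_itv (Num.floor a + 1) s0 hs.
by apply/andP; split; nra.
Qed.

(** The quantile is within 2 dl of sbar. Hence the threshold is at least sbar + dl >= |N| >=
    sigma_(k+1)(X), and at most sbar + 2 dl + tau, which lies below |N| + eps < sigma_k(X). *)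
Lemma flippa_eq n p k T ty (q tau eps sbar dl : R) (X S N : 'M[R]_(n, p))
    (U : 'M[R]_(n, k)) (V : 'M[R]_(k, p)) (F : 'I_T -> 'M[R]_(n, p)) :
  S = U *m V -> X = S + N -> (0 < T)%N -> 0 <= tau ->
  3 * dl <= tau -> 4 * dl <= eps - tau -> 0 < dl ->
  `|opnorm N - sbar| <= dl ->
  ((opnorm N + eps)%:E < sing_val X k)%E ->
  (forall t, `|opnorm (hadamard (F t) N) - sbar| <= dl) ->
  (forall t, opnorm (hadamard (F t) S) <= dl) ->
  flippa ty q tau X F = k.
Proof.
move=> SE XE T0 tau0 d1 d2 d0 hN hk hFN hFS.
have [lN uN] : sbar - dl <= opnorm N /\ opnorm N <= sbar + dl.
  by move: hN; rewrite ler_distl => /andP[].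
have /andP[lq uq] : sbar - 2 * dl <=
    quantile ty q [seq opnorm (hadamard (F t) X) | t <- enum 'I_T] <= sbar + 2 * dl.
  apply: quantile_itv; first by rewrite size_map size_enum_ord.
  move=> _ /mapP[t _ ->].
  have XF : hadamard (F t) X = hadamard (F t) N + hadamard (F t) S.
    by rewrite XE; apply/matrixP => i j; rewrite !mxE mulrDr addrC.
  have := opnorm_dist (hadamard (F t) N) (hadamard (F t) S); rewrite -XF.
  move=> /le_trans/(_ (hFS t)); have := hFN t.
  rewrite !ler_distl => /andP[h1 h2] /andP[h3 h4].
  by apply/andP; split; lra.
have [le_thr least] := flippaP ty q X F tau0.
apply/eqP; rewrite eqn_leq; apply/andP; split.
  apply: least; apply: le_trans (sing_val_le_opnorm X U V) _.
  have -> : X - U *m V = N by rewrite XE SE addrC addKr.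
  by rewrite lee_fin /flip_threshold; lra.
rewrite leqNgt; apply/negP => /(sing_val_anti X) kle.
have := lt_le_trans hk (le_trans kle le_thr).
by rewrite lte_fin /flip_threshold; lra.
Qed.

End DeterministicSelection.

(** * Probability of a wrong selection *)

Section BadEvents.
Context {d : measure_display} {Om : measurableType d} {R : realType}.
Variable P : probability Om R.
Context {n p k T : nat} (ty : quantile_type) (q tau eps sbar dl : R).
Context (F : 'I_T -> Om -> 'M[R]_(n, p)) (S N X : Om -> 'M[R]_(n, p)).
Context (U : Om -> 'M[R]_(n, k)) (V : Om -> 'M[R]_(k, p)).
Hypothesis mF : forall t, measurable_mx (F t).
Hypothesis mS : measurable_mx S.
Hypothesis mN : measurable_mx N.
Hypothesis uF : forall t, uniform_signs P (F t).
Hypothesis iF : independent_flips P F S N.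
Hypothesis iN : independent_entries P N.
Hypothesis sN : forall i j, symmetric_law P (fun w => N w i j).
Hypothesis SE : forall w, S w = U w *m V w.
Hypothesis XE : forall w, X w = S w + N w.
Hypothesis T_gt0 : (0 < T)%N.
Hypothesis tau_ge0 : 0 <= tau.
Hypothesis dl_tau : 3 * dl <= tau.
Hypothesis dl_eps : 4 * dl <= eps - tau.
Hypothesis dl_gt0 : 0 < dl.
Hypothesis np_ge4 : (4 <= n + p)%N.
Local Open Scope ereal_scope.

Let Good := [set w | flippa ty q tau (X w) (fun t => F t w) = k].
Let Gap := [set w | (opnorm (N w) + eps)%:E < sing_val (X w) k].
Let Noise := [set w | (dl < `|opnorm (N w) - sbar|)%R].

Let mX : measurable_mx X.
Proof.
by move=> i j; rewrite (_ : X = fun w => S w + N w)%R; [exact: measurable_addmx|exact/funext].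
Qed.

Lemma measurable_good : measurable Good.
Proof. exact: measurable_flippa. Qed.

Lemma measurable_gap : measurable Gap.
Proof.
rewrite /Gap; case: (k) => [|j] /=.
  rewrite (_ : [set _ | _] = setT) //; apply/seteqP; split => // w _ /=.
  by rewrite ltry.
under eq_set => w do rewrite lte_fin.
apply: measurable_ltr_set; last exact: measurable_singular_value.
by apply: measurable_funD; [exact: measurable_opnorm|exact: measurable_cst].
Qed.

Let measurable_dev (M : Om -> 'M[R]_(n, p)) : measurable_mx M ->
  measurable [set w | (dl < `|opnorm (M w) - sbar|)%R].
Proof.
move=> mM; apply: measurable_ltr_set; first exact: measurable_cst.
apply: measurableT_comp => //; apply: measurable_funB; last exact: measurable_cst.
exact: measurable_opnorm.
Qed.

(** The deviation of |N| is paid once for N itself and once for each flipped copy, by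
    [noise_flip_prob]. *)
Lemma prob_bad_le :
  P (~` Good) <= P (~` Gap) + P Noise + T%:R%:E * (P Noise +
    (dl^-1 * 50 ^+ 2)%:E * (expectation P (fun w => norm_2inf (S w))
      + expectation P (fun w => norm_2inf (S w)^T)
      + mine (expectation P (fun w => rho_2 (S w)))
             (expectation P (fun w => rho_inf (S w))))).
Proof.
set e := (expectation _ _ + _ + _).
pose A t := [set w | (dl < `|opnorm (hadamard (F t w) (N w)) - sbar|)%R].
pose B t := [set w | (dl < opnorm (hadamard (F t w) (S w)))%R].
have mA t : measurable (A t) by apply/measurable_dev/measurable_hadamard.
have mB t : measurable (B t).
  apply: measurable_ltr_set; first exact: measurable_cst.
  by apply/measurable_opnorm/measurable_hadamard.
have mG := measurableC measurable_good.
have mH := measurableC measurable_gap.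
have mNo : measurable Noise by exact: measurable_dev.
pose C := (~` Good `\` ~` Gap) `\` Noise.
have mC : measurable C by apply: measurableD => //; apply: measurableD.
apply: (@le_trans _ _ (P (~` Gap `|` Noise `|` C))).
  apply: le_measure; rewrite ?inE //; first by apply: measurableU => //; exact: measurableU.
  move=> w Gw; have [?|h1] := pselect ((~` Gap) w); first by left; left.
  by have [?|h2] := pselect (Noise w); [left; right|right].
apply: le_trans (measureU2 _ _ mC) _; first exact: measurableU.
apply: leeD; first exact: measureU2.
apply: (@le_trans _ _ (\sum_(t <- enum 'I_T) P (A t `|` B t))).
  apply: prob_cover => // [t|w [[nG /contrapT Hw] nN]]; first exact: measurableU.
  apply: contrapT => nAB; apply: nG.
  apply: (@flippa_eq R n p k T ty q tau eps sbar dl (X w) (S w) (N w) (U w) (V w)) => //.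
  - by rewrite leNgt; apply/negP => h; apply: nN.
  - move=> t; rewrite leNgt; apply/negP => h; apply: nAB; exists t; first by rewrite mem_enum.
    by left.
  - move=> t; rewrite leNgt; apply/negP => h; apply: nAB; exists t; first by rewrite mem_enum.
    by right.
apply: (@le_trans _ _ (\sum_(t <- enum 'I_T) (P Noise + (dl^-1 * 50 ^+ 2)%:E * e))).
  apply: lee_sum => t _; apply: le_trans (measureU2 _ (mA t) (mB t)) _.
  apply: leeD; first exact: (noise_flip_prob mF mS mN).
  apply: le_trans (signal_flip_prob mF mS mN uF iF t dl_gt0) _.
  rewrite EFinM -muleA; apply: lee_wpmul2l; first by rewrite lee_fin invr_ge0 ltW.
  exact: integral_avg_flip_le.
by rewrite big_enum /= sumr_const card_ord mule_natl.
Qed.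

End BadEvents.

(** * Passage to the limit *)

Theorem theorem3p8 (R : realType)
  (n p k : nat -> nat)
  (d : nat -> measure_display) (Om : forall m, measurableType (d m))
  (P : forall m, probability (Om m) R)
  (theta : forall m, 'I_(k m) -> Om m -> R)
  (u : forall m, 'I_(k m) -> Om m -> 'cV[R]_(n m))
  (z : forall m, 'I_(k m) -> Om m -> 'cV[R]_(p m))
  (S N X : forall m, Om m -> 'M[R]_(n m, p m))
  (ty : quantile_type) (q tau : R) (T : nat)
  (F : forall m, 'I_T -> Om m -> 'M[R]_(n m, p m))
  (sbar eps : R) :
  (n @ \oo --> \oo) ->
  (p @ \oo --> \oo) ->
  (forall m i, measurable_fun setT (theta m i)) ->
  (forall m i w, 0 <= theta m i w) ->
  (forall m i, measurable_mx (u m i)) ->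
  (forall m i, measurable_mx (z m i)) ->
  (forall m w, S m w = \sum_(i < k m) theta m i w *: (u m i w *m (z m i w)^T)) ->
  (forall m, measurable_mx (N m)) ->
  (forall m w, X m w = S m w + N m w) ->
  (forall m, independent_entries (P m) (N m)) ->
  (forall m i j, symmetric_law (P m) (fun w => N m w i j)) ->
  (forall e : R, 0 < e ->
    P m [set w | e < `|opnorm (N m w) - sbar|] @[m --> \oo] --> 0%E) ->
  0 < eps ->
  (P m [set w | ((opnorm (N m w) + eps)%:E < sing_val (X m w) (k m))%E]
    @[m --> \oo] --> 1%E) ->
  0 <= q <= 1 ->
  (1 <= T)%N ->
  0 < tau < eps ->
  (forall m t, measurable_mx (F m t)) ->
  (forall m t, uniform_signs (P m) (F m t)) ->
  (forall m, independent_flips (P m) (F m) (S m) (N m)) ->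
  (expectation (P m) (fun w => norm_2inf (S m w)) @[m --> \oo] --> 0%E) ->
  (expectation (P m) (fun w => norm_2inf (S m w)^T) @[m --> \oo] --> 0%E) ->
  (mine (expectation (P m) (fun w => rho_2 (S m w)))
        (expectation (P m) (fun w => rho_inf (S m w))) @[m --> \oo] --> 0%E) ->
  P m [set w | flippa ty q tau (X m w) (fun t => F m t w) = k m]
    @[m --> \oo] --> 1%E.
Proof.
move=> n_oo p_oo mtheta theta0 mu mz SE mN XE iN sN hnoise eps0 hgap q01 T0 tau_eps.
move=> mF uF iF e1 e2 e3.
have /andP[tau0 taueps] := tau_eps.
have mS m : measurable_mx (S m).
  move=> i j; under eq_fun => w do rewrite SE summxE.
  apply: measurable_sum => l; under eq_fun do rewrite mxE.
  apply: measurable_funM => //; move: i j.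
  by apply: measurable_mulmx => //; exact: measurable_trmx.
(* A factorization of inner dimension k expresses that S has rank at most k; the weights go into the
   columns of U. *)
pose U m w : 'M[R]_(n m, k m) := \matrix_(r, i) (theta m i w * u m i w r 0).
pose V m w : 'M[R]_(k m, p m) := \matrix_(i, c) z m i w c 0.
have SUV m w : S m w = U m w *m V m w.
  rewrite SE; apply/matrixP => r c; rewrite summxE [RHS]mxE; apply: eq_bigr => i _.
  by rewrite !mxE big_ord1 !mxE mulrA.
(* Quarters of the two margins tau and eps - tau, so that both sides of the threshold tolerate all
   deviations at once. *)
pose dl := Num.min (tau / 4) ((eps - tau) / 4).
have dl0 : 0 < dl by rewrite lt_min !divr_gt0 // subr_gt0.
have dl1 : 3 * dl <= tau.
  have : dl <= tau / 4 by rewrite ge_min lexx.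
  by move: dl0 => /ltW; lra.
have dl2 : 4 * dl <= eps - tau.
  have : dl <= (eps - tau) / 4 by rewrite ge_min lexx orbT.
  lra.
pose Good m := [set w | flippa ty q tau (X m w) (fun t => F m t w) = k m].
pose Gap m := [set w | ((opnorm (N m w) + eps)%:E < sing_val (X m w) (k m))%E].
pose Noise m := [set w | dl < `|opnorm (N m w) - sbar|].
have mX m : measurable_mx (X m).
  by move=> i j; rewrite (_ : X m = fun w => S m w + N m w); [exact: measurable_addmx|exact/funext].
have mGood m : measurable (Good m) by exact: measurable_flippa.
have mGap m : measurable (Gap m) by exact: (measurable_gap eps (mS m) (mN m) (XE m)).
pose h m := (P m (~` Gap m) + P m (Noise m) + T%:R%:E * (P m (Noise m) +
    (dl^-1 * 50 ^+ 2)%:E * (expectation (P m) (fun w => norm_2inf (S m w))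
      + expectation (P m) (fun w => norm_2inf (S m w)^T)
      + mine (expectation (P m) (fun w => rho_2 (S m w)))
             (expectation (P m) (fun w => rho_inf (S m w))))))%E.
have gap0 : P m (~` Gap m) @[m --> \oo] --> 0%E.
  under eq_fun do rewrite probability_setC //.
  rewrite -(@subee _ 1%E) //; apply: cvgeB => //; exact: cvg_cst.
have h0 : h m @[m --> \oo] --> 0%E.
  (* The limit is written in the shape of [h], to be reached term by term. *)
  have -> : 0%E = (0 + 0 + T%:R%:E * (0 + (dl^-1 * 50 ^+ 2)%:E * (0 + 0 + 0)))%E :> \bar R.
    by rewrite !(adde0, mule0).
  have noise0 := hnoise dl dl0.
  have fin0 (x : \bar R) : x = 0%E -> (0 +? x)%E by move=> ->.
  rewrite [X in (X + _)%E]adde0.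
  apply: cvgeD; first by apply: fin0; rewrite !(adde0, mule0).
    by rewrite -[X in _ --> X]adde0; exact: cvgeD.
  apply: cvgeZl => //; apply: cvgeD => //.
  apply: cvgeZl => //; apply: cvgeD => //; exact: cvgeD.
(* The bound by [rho_2] uses ln (n+p) >= 1, hence n + p >= 4, which holds from some index on. *)
have n4 : \forall m \near \oo, (4 <= n m)%N.
  by apply: (n_oo [set x | (4 <= x)%N]); exact: nbhs_infty_ge.
have bad0 : P m (~` Good m) @[m --> \oo] --> 0%E.
  apply: (@squeeze_cvge _ _ _ _ (fun=> 0%E) _ h) => //; last exact: cvg_cst.
  near=> m; rewrite measure_ge0 /=.
  apply: (@prob_bad_le _ _ _ (P m) _ _ _ _ ty q tau eps sbar dl (F m) (S m) (N m) (X m) (U m) (V m)) => //.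
    exact: ltW.
  have : (4 <= n m)%N by near: m; exact: n4.
  by move=> /leq_trans; apply; exact: leq_addr.
rewrite (_ : (fun m => _) = (fun m => 1 - P m (~` Good m))%E); last first.
  by apply/funext => m; rewrite -probability_setC ?setCK //; exact: measurableC.
rewrite -[X in _ --> X]sube0; apply: cvgeB => //; exact: cvg_cst.
Unshelve. all: by end_near.
Qed.
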